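(* Let $0<\theta<\pi/2$. Then (i) $\mathbb{D}_\theta$ is a continuous operator on $(L^2(\mathbb{R}))^4$ and $\mathbb{D}_\theta\big((L^2(\mathbb{R}))^4\big)\subset (L^2_0(\mathbb{R}))^4$; (ii) as an operator on $(L^2_0(\mathbb{R}))^4$, $\mathbb{D}_\theta$ is the sum of an operator of norm $\le 1/\sqrt{2}$ and a compact operator.
   Context: Fix $a>0$ and $k>0$. All square roots are principal ($\mathrm{Arg}\in(-\pi,\pi]$), $R(w,z):=(w^2+z^2)^{1/2}$ for $w,z\in\mathbb{C}$, and $h(x_1,x_2)=\frac{ikx_1}{2}\frac{H_1^{(1)}(kR(x_1,x_2))}{R(x_1,x_2)}$. For $0<\theta<\pi/2$ let $\tau_\theta(s)=-a+(s+a)e^{i\theta}$ for $s<-a$, $\tau_\theta(s)=s$ for $|s|\le a$, $\tau_\theta(s)=a+(s-a)e^{i\theta}$ for $s>a$. Let $S\psi(t)=\psi(-t)$ and $D_\theta\psi(t)=\int_{\mathbb{R}}h(\tau_\theta(t)-a,\,a-\tau_\theta(s))\psi(s)\tau_\theta'(s)\,\mathrm{d}s$ for $t>a$, $D_\theta\psi(t)=0$ for $t\le a$. Let $L^2_0(\mathbb{R})=\{\psi\in L^2(\mathbb{R}):\psi=0\text{ a.e. on }(-a,a)\}$. Define $\mathbb{D}_\theta$ on $(L^2(\mathbb{R}))^4$ componentwise by $(\mathbb{D}_\theta\Phi)^j=S D_\theta\varphi^{j-1}+D_\theta S\varphi^{j+1}$ for $\Phi=\{\varphi^0,\varphi^1,\varphi^2,\varphi^3\}$,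 indices mod 4. *)

(* Defs.v *)
From HB Require Import structures.
From mathcomp Require Import all_boot all_order all_algebra.
From mathcomp Require Import all_classical all_reals all_analysis.
From mathcomp Require Import complex.
Set Implicit Arguments. Unset Strict Implicit. Unset Printing Implicit Defensive.
Import Order.TTheory GRing.Theory Num.Theory.
Import numFieldTopology.Exports numFieldNormedType.Exports.
Local Open Scope ring_scope.
Local Open Scope complex_scope.
Local Open Scope classical_set_scope.

Section Defs.
Variable R : realType.
Local Notation C := R[i].
Local Notation mu := (@lebesgue_measure R).

Definition cabs (z : C) : R :=
  Num.sqrt (complex.Re z ^+ 2 + complex.Im z ^+ 2).

(* principal argument, in (-pi, pi] *)
Definition carg (z : C) : R :=
  let x := complex.Re z in let y := complex.Im z in
  if 0 < x then atan (y / x)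
  else if x < 0 then (if 0 <= y then atan (y / x) + pi else atan (y / x) - pi)
  else if 0 < y then pi / 2 else if y < 0 then - (pi / 2) else 0.

Definition clog (z : C) : C := (ln (cabs z)) +i* (carg z).

Definition csqrt (z : C) : C :=
  (Num.sqrt (cabs z) * cos (carg z / 2)) +i* (Num.sqrt (cabs z) * sin (carg z / 2)).

Definition eith (th : R) : C := (cos th) +i* (sin th).

Definition csum (u : nat -> C) : C :=
  (limn (series (fun n => complex.Re (u n)) : R^nat)) +i* (limn (series (fun n => complex.Im (u n)) : R^nat)).

Definition harmonic (m : nat) : R := \sum_(1 <= j < m.+1) (j%:R)^-1.

Definition euler_gamma : R := limn (fun n : nat => harmonic n - ln n%:R).

(* digamma at positive integers: psi (m+1) = - gamma + H_m *)
Definition psi_nat1 (m : nat) : R := - euler_gamma + harmonic m.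

Definition besselJ1 (z : C) : C :=
  csum (fun m => (-1) ^+ m * (z / 2) ^+ (2 * m).+1 / ((m`!)%:R * ((m.+1)`!)%:R)).

(* Y_1(z) (DLMF 10.8.1 with n = 1, principal branch of log) *)
Definition besselY1 (z : C) : C :=
  - (2 / (pi%:C * z)) + (2 / pi%:C) * clog (z / 2) * besselJ1 z
  - (z / 2) / pi%:C *
    csum (fun m => (psi_nat1 m + psi_nat1 m.+1)%:C * (- (z ^+ 2) / 4) ^+ m
                    / ((m`!)%:R * ((m.+1)`!)%:R)).

Definition hankel1 (z : C) : C := besselJ1 z + 'i * besselY1 z.

Definition Rw (w z : C) : C := csqrt (w ^+ 2 + z ^+ 2).

Definition hker (k : R) (x1 x2 : C) : C :=
  ('i * k%:C * x1 / 2) * hankel1 (k%:C * Rw x1 x2) / Rw x1 x2.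

Definition tau (a th s : R) : C :=
  if s < - a then (- a)%:C + (s + a)%:C * eith th
  else if s <= a then s%:C
  else a%:C + (s - a)%:C * eith th.

(* derivative of tau (defined off the null set {-a, a}) *)
Definition dtau (a th s : R) : C := if `|s| <= a then 1 else eith th.

Definition Sop (psi : R -> C) : R -> C := fun t => psi (- t).

Definition cint (f : R -> C) : C :=
  (Rintegral mu setT (fun x => complex.Re (f x))) +i* (Rintegral mu setT (fun x => complex.Im (f x))).

Definition cintegrable (f : R -> C) : Prop :=
  [/\ measurable_fun setT (fun x => complex.Re (f x)),
      measurable_fun setT (fun x => complex.Im (f x)) &
      (\int[mu]_x (cabs (f x))%:E < +oo)%E].

Definition Dintegrand (a k th : R) (psi : R -> C) (t : R) : R -> C :=
  fun s => hker k (tau a th t - a%:C) (a%:C - tau a th s) * psi s * dtau a th s.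

Definition Dop (a k th : R) (psi : R -> C) : R -> C :=
  fun t => if a < t then cint (Dintegrand a k th psi t) else 0.

Definition L2 (f : R -> C) : Prop :=
  [/\ measurable_fun setT (fun x => complex.Re (f x)),
      measurable_fun setT (fun x => complex.Im (f x)) &
      (\int[mu]_x ((cabs (f x)) ^+ 2)%:E < +oo)%E].

Definition L20 (a : R) (f : R -> C) : Prop :=
  L2 f /\ {ae mu, forall t, - a < t < a -> f t = 0}.

Definition l2norm (f : R -> C) : R :=
  Num.sqrt (Rintegral mu setT (fun x => (cabs (f x)) ^+ 2)).

Definition vec := 'I_4 -> R -> C.

Definition vL2 (F : vec) : Prop := forall j, L2 (F j).
Definition vL20 (a : R) (F : vec) : Prop := forall j, L20 a (F j).
Definition vnorm (F : vec) : R := Num.sqrt (\sum_(j < 4) (l2norm (F j)) ^+ 2).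
Definition vsub (F G : vec) : vec := fun j t => F j t - G j t.
Definition vadd (F G : vec) : vec := fun j t => F j t + G j t.
Definition vscale (c : C) (F : vec) : vec := fun j t => c * F j t.
(* equality in (L^2)^4, i.e. componentwise almost everywhere *)
Definition vae (F G : vec) : Prop := forall j, {ae mu, forall t, F j t = G j t}.

End Defs.

Definition prev4 (j : 'I_4) : 'I_4 := Ordinal (ltn_pmod (j + 3) (isT : (0 < 4)%N)).
Definition next4 (j : 'I_4) : 'I_4 := Ordinal (ltn_pmod (j + 1) (isT : (0 < 4)%N)).

Definition DD (R : realType) (a k th : R) (F : vec R) : vec R :=
  fun j t => Sop (Dop a k th (F (prev4 j))) t + Dop a k th (Sop (F (next4 j))) t.

(* a (bounded-or-not) linear operator on (L^2_0)^4, well defined on a.e.-classes *)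
Definition opL20 (R : realType) (a : R) (A : vec R -> vec R) : Prop :=
  [/\ forall F, vL20 a F -> vL20 a (A F),
      forall F G, vL20 a F -> vL20 a G -> vae F G -> vae (A F) (A G) &
      forall (c : R[i]) F G, vL20 a F -> vL20 a G ->
        vae (A (vadd (vscale c F) G)) (vadd (vscale c (A F)) (A G))].

Definition compact_op (R : realType) (a : R) (K : vec R -> vec R) : Prop :=
  forall u : nat -> vec R, (forall n, vL20 a (u n)) ->
    (exists M : R, forall n, vnorm (u n) <= M) ->
    exists (phi : nat -> nat) (G : vec R),
      [/\ {homo phi : m n / (m < n)%N >-> (m < n)%N}, vL20 a G &
          (fun n => vnorm (vsub (K (u (phi n))) G)) @ \oo --> (0 : R)].

(* Main.v *)
Require Import Defs.
From HB Require Import structures.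
From mathcomp Require Import all_boot all_order all_algebra.
From mathcomp Require Import all_classical all_reals all_analysis.
From mathcomp Require Import measurable_realfun complex.
From mathcomp Require Import ring lra.
Set Implicit Arguments. Unset Strict Implicit. Unset Printing Implicit Defensive.
Import Order.TTheory GRing.Theory Num.Theory.
Import numFieldTopology.Exports numFieldNormedType.Exports.
Local Open Scope ring_scope.
Local Open Scope complex_scope.
Local Open Scope classical_set_scope.
Local Notation Re := complex.Re.
Local Notation Im := complex.Im.

(** With [u = t - a] and [v = s - a], the kernel of [D_theta] at [(t, s)], [t > a],
    is [O(u / (u^2 + v^2))]: near [(a, a)] because [z H_1(z)] tends to [-2i/pi], and far
    away because [H_1] decays along the rotated contour. To obtain this decay from the
    power series of [H_1], the functions [K_0] and [K_1] at [w = -iz/2] are also written as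
    Laplace-type integrals over [[1, +oo[]. After scaling [w] by a parameter [s > 0], the
    series and the integrals solve the same first order system in [s], which is singular
    at [0], and they have the same behaviour at [0]; Euler's constant enters through
    [int_1^oo e^(-A x) / x dx + ln A -> - gamma]. The difference of the two solutions
    satisfies an integral inequality whose iteration forces it to vanish.

    The singular part [kA = u / (pi (u^2 + v^2) (1 + u^2 + v^2))], for [t, s > a], is at most
    [1/pi] times a homogeneous kernel. Schur's test with the weight [v^(-1/2)] bounds its
    norm by [(1/pi) (pi / sqrt 2) = 1 / sqrt 2]. In each component of the vector operator
    the two terms have disjoint supports, and they only see the parts [s > a] and [s < -a]
    of the data, so the same bound holds on the product space.

    The remainder [kK] is [O(1 / (1 + u^2 + v^2))] and continuous in [t]. Along a
    subsequence of a bounded sequence the images converge at every rational [t], then at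
    every [t] by [L^2]-continuity of [t |-> kK(t, .)], and then in [L^2] by dominated
    convergence. *)

(** * Complex numbers through their real and imaginary parts *)

Section ComplexBasics.
Variable R : realType.
Local Notation C := R[i].
Implicit Types x y z w : C.

(** The rotation keeps the argument of [R^2] away from [0] as soon as [R^2] is large; since
    [H_1(z) = -(2/pi) K_1(-iz)], this gives decay, which the series hides behind cancellation. The
    system solved by [K_0(2ws)] and [2ws K_1(2ws)] is singular at [s = 0], so no theorem on initial
    values applies: the bound [O(s)] on both components of the difference excludes the regular
    solution [I_0] as well as the logarithmic one.

    For [t, s > a] both legs of [R] are rotated by the same angle, which cancels against [tau']. The
    leading term of the kernel is therefore real and depends on neither [k] nor [theta], and so does
    the bound on the norm. For [s < a] close to [a] the kernel is just as singular, but elements of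
    [L^2_0] do not see it. Hence the decomposition lives on [L^2_0], while continuity on [L^2] needs
    a second Schur test with both sides of [a]. The number [pi / sqrt 2] is the integral of
    [sqrt z / (1 + z^2)] over the positive half line. *)

Lemma ceqP x y : Re x = Re y -> Im x = Im y -> x = y.
Proof. by case: x y => a b [c d] /= -> ->. Qed.

Lemma creD x y : Re (x + y) = Re x + Re y. Proof. by case: x y => ? ? []. Qed.
Lemma cimD x y : Im (x + y) = Im x + Im y. Proof. by case: x y => ? ? []. Qed.
Lemma creN x : Re (- x) = - Re x. Proof. by case: x. Qed.
Lemma cimN x : Im (- x) = - Im x. Proof. by case: x. Qed.
Lemma creB x y : Re (x - y) = Re x - Re y. Proof. by rewrite creD creN. Qed.
Lemma cimB x y : Im (x - y) = Im x - Im y. Proof. by rewrite cimD cimN. Qed.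
Lemma creM x y : Re (x * y) = Re x * Re y - Im x * Im y.
Proof. by case: x y => ? ? []. Qed.
Lemma cimM x y : Im (x * y) = Re x * Im y + Im x * Re y.
Proof. by case: x y => ? ? []. Qed.
Lemma creV x : Re x^-1 = Re x / (Re x ^+ 2 + Im x ^+ 2).
Proof. by case: x. Qed.
Lemma cimV x : Im x^-1 = - (Im x / (Re x ^+ 2 + Im x ^+ 2)).
Proof. by case: x => a b /=; rewrite ?mulNr. Qed.
Lemma creC (a : R) : Re a%:C = a. Proof. by []. Qed.
Lemma cimC (a : R) : Im a%:C = 0. Proof. by []. Qed.
Lemma cre0 : Re (0 : C) = 0. Proof. by []. Qed.
Lemma cim0 : Im (0 : C) = 0. Proof. by []. Qed.
Lemma cre1 : Re (1 : C) = 1. Proof. by []. Qed.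
Lemma cim1 : Im (1 : C) = 0. Proof. by []. Qed.
Lemma natC n : (n%:R : C) = (n%:R : R)%:C.
Proof. by rewrite rmorph_nat. Qed.
Lemma crenat n : Re (n%:R : C) = n%:R. Proof. by rewrite natC. Qed.
Lemma cimnat n : Im (n%:R : C) = 0. Proof. by rewrite natC. Qed.

Definition cE := (creD, cimD, creN, cimN, creM, cimM, creC, cimC, cre0, cim0, cre1, cim1,
  crenat, cimnat).

Lemma cabsE z : cabs z = ComplexField.Normc.normc z.
Proof. by case: z. Qed.

Lemma cabs_ge0 z : 0 <= cabs z. Proof. exact: sqrtr_ge0. Qed.
Lemma cabsM x y : cabs (x * y) = cabs x * cabs y.
Proof. by rewrite !cabsE ComplexField.Normc.normcM. Qed.
Lemma cabsV x : cabs x^-1 = (cabs x)^-1.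
Proof. by rewrite !cabsE ComplexField.Normc.normcV. Qed.
Lemma cabsD x y : cabs (x + y) <= cabs x + cabs y.
Proof. by rewrite !cabsE le_normcD. Qed.
Lemma cabsN x : cabs (- x) = cabs x.
Proof. by rewrite !cabsE normcN. Qed.
Lemma cabsB x y : cabs (x - y) <= cabs x + cabs y.
Proof. by rewrite (le_trans (cabsD _ _))// cabsN. Qed.
Lemma cabs2 z : cabs z ^+ 2 = Re z ^+ 2 + Im z ^+ 2.
Proof. by rewrite sqr_sqrtr// addr_ge0// sqr_ge0. Qed.
Lemma cabsC (a : R) : cabs a%:C = `|a|.
Proof. by rewrite /cabs /= expr0n addr0 sqrtr_sqr. Qed.
Lemma cabs0 : cabs (0 : C) = 0.
Proof. by rewrite (cabsC 0) normr0. Qed.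
Lemma cabs1 : cabs (1 : C) = 1.
Proof. by rewrite (cabsC 1) normr1. Qed.
Lemma cabsX x n : cabs (x ^+ n) = cabs x ^+ n.
Proof.
elim: n => [|n IH]; first by rewrite !expr0 cabs1.
by rewrite !exprS cabsM IH.
Qed.
Lemma cabs_nat n : cabs (n%:R : C) = n%:R.
Proof. by rewrite natC cabsC ger0_norm. Qed.
Lemma cabsi : cabs ('i : C) = 1.
Proof. by rewrite /cabs/= expr0n expr1n add0r sqrtr1. Qed.
Lemma cabs_eq0 z : (cabs z == 0) = (z == 0).
Proof.
apply/eqP/eqP => [|->]; last exact: cabs0.
by rewrite cabsE => /ComplexField.Normc.eq0_normc.
Qed.
Lemma cabs_gt0 z : (0 < cabs z) = (z != 0).
Proof. by rewrite lt_neqAle cabs_ge0 andbT eq_sym cabs_eq0. Qed.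
Lemma Re_le_cabs z : `|Re z| <= cabs z.
Proof.
by rewrite -ler_sqr ?nnegrE ?cabs_ge0// cabs2 real_normK ?num_real// lerDl sqr_ge0.
Qed.
Lemma Im_le_cabs z : `|Im z| <= cabs z.
Proof.
by rewrite -ler_sqr ?nnegrE ?cabs_ge0// cabs2 real_normK ?num_real// lerDr sqr_ge0.
Qed.
(** The factors [2] in [csum_bound], [cJ_le], [cJ_dist] and [cderiv_pow_bound] come from this crude
    bound. *)
Lemma cabs_le_ReIm z : cabs z <= `|Re z| + `|Im z|.
Proof.
rewrite -ler_sqr ?nnegrE ?addr_ge0 ?cabs_ge0// cabs2.
have /= := normr_ge0 (Re z); have := normr_ge0 (Im z).
rewrite -(real_normK (num_real (Re z))) -(real_normK (num_real (Im z))).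
by nra.
Qed.

End ComplexBasics.

(** * Measurability of complex functions *)

Section ComplexMeasurable.
Variable R : realType.
Local Notation C := R[i].

(** Componentwise, as in [L2] and [cintegrable]. The domain is general because kernels are
    measurable functions on [R * R]. *)
Definition cmeas d (T : measurableType d) (f : T -> C) :=
  measurable_fun setT (fun x => Re (f x)) /\
  measurable_fun setT (fun x => Im (f x)).

Section closure.
Context d (T : measurableType d).
Implicit Types f g : T -> C.

Lemma cmeas_cst c : cmeas (fun _ : T => c).
Proof. by split; exact: measurable_cst. Qed.

Lemma cmeasC (f : T -> R) : measurable_fun setT f -> cmeas (fun x => (f x)%:C).
Proof. by split => //=; exact: measurable_cst. Qed.

Lemma cmeasD f g : cmeas f -> cmeas g -> cmeas (fun x => f x + g x).
Proof.
move=> [f1 f2] [g1 g2]; split.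
  by under eq_fun do rewrite creD; exact: measurable_funD.
by under eq_fun do rewrite cimD; exact: measurable_funD.
Qed.

Lemma cmeasN f : cmeas f -> cmeas (fun x => - f x).
Proof.
move=> [f1 f2]; split.
  by under eq_fun do rewrite creN; exact: measurableT_comp.
by under eq_fun do rewrite cimN; exact: measurableT_comp.
Qed.

Lemma cmeasM f g : cmeas f -> cmeas g -> cmeas (fun x => f x * g x).
Proof.
move=> [f1 f2] [g1 g2]; split.
  under eq_fun do rewrite creM.
  by apply: measurable_funB; exact: measurable_funM.
under eq_fun do rewrite cimM.
by apply: measurable_funD; exact: measurable_funM.
Qed.

Lemma cmeasX f n : cmeas f -> cmeas (fun x => f x ^+ n).
Proof.
move=> mf; elim: n => [|n IH]; first exact: cmeas_cst.
by under eq_fun do rewrite exprS; exact: cmeasM.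
Qed.

(** Inversion is continuous off [0] only, so the line is cut at [0]; on a singleton every function
    is measurable. *)
Lemma measurable_fun_invr (f : T -> R) :
  measurable_fun setT f -> measurable_fun setT (fun x => (f x)^-1).
Proof.
move=> mf.
have m1 : measurable_fun setT (fun x : R => x^-1).
  rewrite -(setUv [set 0 : R]); apply/measurable_funU => //.
    exact: measurableC.
  split; last first.
    apply: open_continuous_measurable_fun.
      exact/closed_openC/accessible_closed_set1/hausdorff_accessible/Rhausdorff.
    by move=> x; rewrite inE /= => /eqP x0; exact: inv_continuous.
  exact: measurable_fun_set1.
exact: (measurableT_comp m1 mf).
Qed.

Lemma cmeasV f : cmeas f -> cmeas (fun x => (f x)^-1).
Proof.
move=> [f1 f2].
have md : measurable_fun setT (fun x => (Re (f x) ^+ 2 + Im (f x) ^+ 2)^-1).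
  apply: measurable_fun_invr.
  by apply: measurable_funD; exact: measurable_funX.
split.
  by under eq_fun do rewrite creV; exact: measurable_funM.
under eq_fun do rewrite cimV.
by apply: measurableT_comp => //; exact: measurable_funM.
Qed.

Lemma measurable_cabs f : cmeas f -> measurable_fun setT (fun x => cabs (f x)).
Proof.
move=> [f1 f2]; rewrite /cabs.
have ms : measurable_fun setT (@Num.sqrt R).
  by apply: continuous_measurable_fun; exact: sqrt_continuous.
apply: (measurableT_comp ms).
by apply: measurable_funD; exact: measurable_funX.
Qed.

Lemma cmeas_if (b : T -> bool) f g : measurable_fun setT b ->
  cmeas f -> cmeas g -> cmeas (fun x => if b x then f x else g x).
Proof.
move=> mb [f1 f2] [g1 g2]; split.
  under eq_fun => x do rewrite (fun_if (@complex.Re R)).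
  by apply: measurable_fun_ifT.
under eq_fun => x do rewrite (fun_if (@complex.Im R)).
by apply: measurable_fun_ifT.
Qed.

End closure.
End ComplexMeasurable.

(** * Convergence of complex functions along a filter *)

Section ComplexLimits.
Variable R : realType.
Local Notation C := R[i].

Definition ccvg T (F : set_system T) (f : T -> C) (l : C) :=
  (Re (f x) @[x --> F] --> Re l) /\ (Im (f x) @[x --> F] --> Im l).

Section closure.
Context T (F : set_system T) {FF : Filter F}.
Implicit Types f g : T -> C.

Lemma ccvg_cst c : ccvg F (fun _ => c) c.
Proof. by split; exact: cvg_cst. Qed.

Lemma ccvgC (f : T -> R) (l : R) : f x @[x --> F] --> l -> ccvg F (fun x => (f x)%:C) l%:C.
Proof. by split => //=; exact: cvg_cst. Qed.

Lemma ccvgD f g l m : ccvg F f l -> ccvg F g m -> ccvg F (fun x => f x + g x) (l + m).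
Proof.
move=> [f1 f2] [g1 g2]; split.
  by under eq_fun do rewrite creD; rewrite creD; exact: cvgD.
by under eq_fun do rewrite cimD; rewrite cimD; exact: cvgD.
Qed.

Lemma ccvgN f l : ccvg F f l -> ccvg F (fun x => - f x) (- l).
Proof.
move=> [f1 f2]; split.
  by under eq_fun do rewrite creN; rewrite creN; exact: cvgN.
by under eq_fun do rewrite cimN; rewrite cimN; exact: cvgN.
Qed.

Lemma ccvgM f g l m : ccvg F f l -> ccvg F g m -> ccvg F (fun x => f x * g x) (l * m).
Proof.
move=> [f1 f2] [g1 g2]; split.
  by under eq_fun do rewrite creM; rewrite creM; apply: cvgB; exact: cvgM.
by under eq_fun do rewrite cimM; rewrite cimM; apply: cvgD; exact: cvgM.
Qed.

Lemma ccvgX f l n : ccvg F f l -> ccvg F (fun x => f x ^+ n) (l ^+ n).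
Proof.
move=> fl; elim: n => [|n IH]; first exact: ccvg_cst.
by under eq_fun do rewrite exprS; rewrite exprS; exact: ccvgM.
Qed.

Lemma ccvgV f l : l != 0 -> ccvg F f l -> ccvg F (fun x => (f x)^-1) l^-1.
Proof.
move=> l0 [f1 f2].
have d0 : Re l ^+ 2 + Im l ^+ 2 != 0.
  by rewrite -cabs2 expf_neq0// cabs_eq0.
have cd : (Re (f x) ^+ 2 + Im (f x) ^+ 2)^-1 @[x --> F]
    --> (Re l ^+ 2 + Im l ^+ 2)^-1.
  apply: cvgV => //; apply: cvgD; rewrite expr2.
    by under eq_fun do rewrite expr2; exact: cvgM.
  by under eq_fun do rewrite expr2; exact: cvgM.
split.
  by under eq_fun do rewrite creV; rewrite creV; exact: cvgM.
by under eq_fun do rewrite cimV; rewrite cimV; apply: cvgN; exact: cvgM.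
Qed.

Lemma cvg_cabs f l : ccvg F f l -> cabs (f x) @[x --> F] --> cabs l.
Proof.
move=> [f1 f2]; rewrite /cabs.
apply: (cvg_comp _ (@Num.sqrt R)); last exact: sqrt_continuous.
apply: cvgD; rewrite expr2.
  by under eq_fun do rewrite expr2; exact: cvgM.
by under eq_fun do rewrite expr2; exact: cvgM.
Qed.

Lemma ccvg_dist f l : cabs (f x - l) @[x --> F] --> (0 : R) -> ccvg F f l.
Proof.
move=> h; split; apply/cvgrPdist_le => e e0;
  near=> x; rewrite distrC.
- apply: (@le_trans _ _ (cabs (f x - l))); first by rewrite -creB Re_le_cabs.
  rewrite -[leLHS]ger0_norm ?cabs_ge0//.
  by near: x; apply: cvgr0_norm_le.
- apply: (@le_trans _ _ (cabs (f x - l))); first by rewrite -cimB Im_le_cabs.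
  rewrite -[leLHS]ger0_norm ?cabs_ge0//.
  by near: x; apply: cvgr0_norm_le.
Unshelve. all: by end_near. Qed.

End closure.
End ComplexLimits.

(** * Real derivatives and the mean value theorem *)

Section RealDerivatives.
Variable R : realType.
Implicit Types (f g : R -> R) (x : R).

(** With the value of the derivative as an argument, [der] below can synthesize one, and
    [has_der_eq] leaves its comparison with the expected value to [ring] or [field]. *)
Definition has_der f x (l : R) := is_derive x (1 : R) f l.

Lemma has_der_eq f x l l' : has_der f x l -> l = l' -> has_der f x l'.
Proof. by move=> ? <-. Qed.

Lemma der_cst (a : R) x : has_der (fun=> a) x 0.
Proof. exact: is_derive_cst. Qed.
Lemma der_id x : has_der (fun y => y) x 1.
Proof. exact: is_derive_id. Qed.
Lemma der_D f g x df dg : has_der f x df -> has_der g x dg ->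
  has_der (fun y => f y + g y) x (df + dg).
Proof. by move=> ? ?; exact: is_deriveD. Qed.
Lemma der_N f x df : has_der f x df -> has_der (fun y => - f y) x (- df).
Proof. by move=> ?; exact: is_deriveN. Qed.
Lemma der_M f g x df dg : has_der f x df -> has_der g x dg ->
  has_der (fun y => f y * g y) x (df * g x + f x * dg).
Proof.
move=> fx gx; have h := @is_deriveM _ _ f g x 1 df dg fx gx.
by apply: (has_der_eq h); rewrite /GRing.scale/=; ring.
Qed.
Lemma der_comp (h g : R -> R) x dh dg : has_der h (g x) dh -> has_der g x dg ->
  has_der (fun y => h (g y)) x (dh * dg).
Proof. by move=> hx gx; exact: (@is_derive1_comp _ h g x dh dg). Qed.
Lemma der_exp g x dg : has_der g x dg -> has_der (fun y => expR (g y)) x (expR (g x) * dg).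
Proof. by move=> gx; apply: (der_comp (h := expR)) => //; exact: is_derive_expR. Qed.
Lemma der_sin g x dg : has_der g x dg -> has_der (fun y => sin (g y)) x (cos (g x) * dg).
Proof. by move=> gx; apply: (der_comp (h := sin)) => //; exact: is_derive_sin. Qed.
Lemma der_cos g x dg : has_der g x dg -> has_der (fun y => cos (g y)) x (- sin (g x) * dg).
Proof. by move=> gx; apply: (der_comp (h := cos)) => //; exact: is_derive_cos. Qed.
Lemma der_atan g x dg : has_der g x dg ->
  has_der (fun y => atan (g y)) x ((1 + g x ^+ 2)^-1 * dg).
Proof. by move=> gx; apply: (der_comp (h := atan)) => //; exact: is_derive1_atan. Qed.
Lemma der_ln g x dg : 0 < g x -> has_der g x dg ->
  has_der (fun y => ln (g y)) x ((g x)^-1 * dg).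
Proof. by move=> g0 gx; apply: (der_comp (h := @ln R)) => //; exact: is_derive1_ln. Qed.
Lemma der_X g x dg n : has_der g x dg ->
  has_der (fun y => g y ^+ n) x (n%:R * g x ^+ n.-1 * dg).
Proof.
move=> gx; have h := @is_deriveX _ _ g n x 1 dg gx.
by rewrite (_ : (fun y => _) = g ^+ n)//; apply/funext => y; rewrite exprfctE.
Qed.
Lemma der_V g x dg : g x != 0 -> has_der g x dg ->
  has_der (fun y => (g y)^-1) x (- (g x) ^- 2 * dg).
Proof.
move=> g0 gx.
have h : has_der (fun y : R => y^-1) (g x) (- (g x) ^- 2).
  split; first exact: derivable_invr || (apply: derivableV => //; exact: derivable_id).
  rewrite (_ : (fun y => y^-1) = (fun y => (id y)^-1))// deriveV//.
  by rewrite derive_id /GRing.scale/= mulr1.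
exact: der_comp h gx.
Qed.

Lemma der_continuous f x df : has_der f x df -> {for x, continuous f}.
Proof. by move=> [h _]; apply: differentiable_continuous; exact/derivable1_diffP. Qed.

(** Mean value theorem for [g - f]. Comparing derivatives replaces integration in several estimates
    on finite intervals. *)
Lemma der_le f g f' g' a b : a <= b ->
  (forall x, a <= x <= b -> has_der f x (f' x)) ->
  (forall x, a <= x <= b -> has_der g x (g' x)) ->
  (forall x, a <= x <= b -> f' x <= g' x) -> f b - f a <= g b - g a.
Proof.
move=> ab fd gd fg.
have hd x : a <= x <= b -> has_der (fun y => g y + - f y) x (g' x + - f' x).
  by move=> xab; apply: der_D; [exact: gd|apply: der_N; exact: fd].
have [||c /=] := @MVT_segment _ (fun y => g y + - f y) (fun x => g' x + - f' x) a b ab.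
  by move=> x /[!in_itv]/= /andP[/ltW ? /ltW ?]; apply: hd; apply/andP.
  apply: continuous_in_subspaceT => x /[!inE]/= xab.
  exact: der_continuous (hd x xab).
rewrite in_itv/= => cab h.
rewrite -subr_ge0 (_ : _ - _ = (g b - f b) - (g a - f a)); last by ring.
by rewrite h mulr_ge0 ?subr_ge0// fg.
Qed.

Lemma der_norm_le f f' (M a b : R) : a <= b ->
  (forall x, a <= x <= b -> has_der f x (f' x)) ->
  (forall x, a <= x <= b -> `|f' x| <= M) -> `|f b - f a| <= M * (b - a).
Proof.
move=> ab fd fM.
have h1 : f b - f a <= M * b - M * a.
  apply: (@der_le f (fun y => M * y) f' (fun=> 0 * 0 + M * 1)) => // x xab.
    by apply: has_der_eq; [apply: der_M; [exact: der_cst|exact: der_id]|rewrite !mul0r].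
  by rewrite mul0r add0r mulr1; exact: le_trans (ler_norm _) (fM _ xab).
have h2 : (- (M * b)) - (- (M * a)) <= f b - f a.
  apply: (@der_le (fun y => - (M * y)) f (fun=> - (0 * 0 + M * 1)) f') => // x xab.
    by apply: der_N; apply: has_der_eq; [apply: der_M; [exact: der_cst|exact: der_id]|rewrite !mul0r].
  rewrite mul0r add0r mulr1 lerNl.
  by rewrite (le_trans _ (fM _ xab))// -normrN ler_norm.
by rewrite ler_norml; apply/andP; split; lra.
Qed.

Lemma sin_le_norm x : `|sin x| <= `|x|.
Proof.
have h (y : R) : 0 <= y -> `|sin y| <= y.
  move=> y0; have : `|sin y - sin 0| <= 1 * (y - 0).
    apply: (der_norm_le (f' := cos)) => // z _; first exact: is_derive_sin.
    by rewrite ler_norml cos_geN1 cos_le1.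
  by rewrite sin0 !subr0 mul1r.
have [x0|x0] := leP 0 x; first by rewrite [leRHS]ger0_norm// h.
by rewrite -normrN -sinN (ltr0_norm x0) h// oppr_ge0 ltW.
Qed.

Lemma cos_sub1_le x : `|1 - cos x| <= `|x|.
Proof.
have h (y : R) : 0 <= y -> `|1 - cos y| <= y.
  move=> y0; have : `|cos y - cos 0| <= 1 * (y - 0).
    apply: (der_norm_le (f' := fun z => - sin z)) => // z _; first exact: is_derive_cos.
    by rewrite normrN ler_norml sin_geN1 sin_le1.
  by rewrite cos0 subr0 mul1r distrC.
have [x0|x0] := leP 0 x; first by rewrite [leRHS]ger0_norm// h.
by rewrite -cosN (ltr0_norm x0) h// oppr_ge0 ltW.
Qed.

End RealDerivatives.

(** [der_cst] is tried before the structural rules, so a subterm free of the variable gets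
    derivative [0]; the side conditions of [der_ln] and [der_V] are left as goals. *)
Ltac der := repeat first [ exact: der_cst | exact: der_id | apply: der_exp | apply: der_sin
  | apply: der_cos | apply: der_atan | apply: der_ln | apply: der_V | apply: der_N | apply: der_D
  | apply: der_M | apply: der_X ].

(** * Entire power series in a complex variable *)

Section PowerSeries.
Variable R : realType.
Local Notation C := R[i].

Definition csumn (u : nat -> C) n : C := \sum_(0 <= m < n) u m.

Lemma Re_csumn u n : Re (csumn u n) = series (fun m => Re (u m)) n.
Proof.
rewrite /csumn seriesEnat /=; elim: n => [|n IH]; first by rewrite !big_geq.
by rewrite !big_nat_recr//= creD IH.
Qed.

Lemma Im_csumn u n : Im (csumn u n) = series (fun m => Im (u m)) n.
Proof.
rewrite /csumn seriesEnat /=; elim: n => [|n IH]; first by rewrite !big_geq.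
by rewrite !big_nat_recr//= cimD IH.
Qed.

Lemma csumE u l : ccvg \oo (csumn u) l -> csum u = l.
Proof.
move=> [h1 h2]; apply: ceqP; rewrite /csum /=; apply/cvg_lim => //.
  by rewrite (_ : series _ = fun n => Re (csumn u n))//; apply/funext => n; rewrite Re_csumn.
by rewrite (_ : series _ = fun n => Im (csumn u n))//; apply/funext => n; rewrite Im_csumn.
Qed.

Lemma le_cvg_lim_series (f g : R^nat) : (forall n, `|f n| <= g n) ->
  cvgn (series g) -> cvgn (series f) /\ `|limn (series f)| <= limn (series g).
Proof.
move=> fg cg.
have g0 n : 0 <= g n by exact: le_trans (fg n).
have cn : cvgn [normed series f].
  by apply: series_le_cvg cg => n /=; rewrite ?normr_ge0.
split; first exact: normed_cvg.
rewrite (le_trans (lim_series_norm cn))//.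
by apply: lim_series_le => //= n.
Qed.

(** Domination by the exponential series settles the convergence of both components, without which
    [csum], built on [limn], says nothing. *)
Lemma csum_bound (u : nat -> C) b x : 0 <= b -> 0 <= x ->
  (forall m, cabs (u m) <= b * (x ^+ m / m`!%:R)) ->
  ccvg \oo (csumn u) (csum u) /\ cabs (csum u) <= 2 * b * expR x.
Proof.
move=> b0 x0 ub.
pose g : R^nat := fun m => b * (x ^+ m / m`!%:R).
have gE : series g = (fun n => b * series (exp_coeff x) n).
  by apply/funext => n; rewrite !seriesEnat/= mulr_sumr.
have cg : cvgn (series g).
  by rewrite gE; apply: is_cvgMr; exact: is_cvg_series_exp_coeff.
have lg : limn (series g) = b * expR x.
  rewrite gE; apply/cvg_lim => //; apply: cvgMr.
  exact: is_cvg_series_exp_coeff.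
have [c1 l1] : cvgn (series (fun m => Re (u m))) /\
    `|limn (series (fun m => Re (u m)))| <= limn (series g).
  by apply: le_cvg_lim_series => // n; rewrite (le_trans (Re_le_cabs _))// ub.
have [c2 l2] : cvgn (series (fun m => Im (u m))) /\
    `|limn (series (fun m => Im (u m)))| <= limn (series g).
  by apply: le_cvg_lim_series => // n; rewrite (le_trans (Im_le_cabs _))// ub.
split; last first.
  rewrite (le_trans (cabs_le_ReIm _))//=.
  by move: l1 l2; rewrite lg => l1 l2; lra.
split; rewrite /csum /=.
  by under eq_fun do rewrite Re_csumn.
by under eq_fun do rewrite Im_csumn.
Qed.

Definition cps (c : nat -> R) (q : C) : C := csum (fun m => (c m)%:C * q ^+ m).

(** The coefficients met below are roughly of size [1/m!^2]. A single factorial already gives entire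
    functions, and it is preserved by [pseries_diffs] with the same [B]. *)
Definition fbound B (c : nat -> R) := 0 <= B /\ forall m, `|c m| <= B / m`!%:R.

Section bounded.
Variables (B : R) (c : nat -> R).
Hypothesis cB : fbound B c.

Lemma cps_bound q : ccvg \oo (csumn (fun m => (c m)%:C * q ^+ m)) (cps c q) /\
  cabs (cps c q) <= 2 * B * expR (cabs q).
Proof.
have [B0 cb] := cB.
apply: csum_bound => //; first exact: cabs_ge0.
move=> m; rewrite cabsM cabsC cabsX.
rewrite mulrCA mulrC; apply: ler_wpM2l; first by rewrite exprn_ge0// cabs_ge0.
exact: cb.
Qed.

(** The factor [m M^(m-1)] of the usual estimate is absorbed into [(M + 1)^m], so that the bound
    keeps the shape required by [csum_bound]. *)
Lemma cabs_subX (q q' : C) (M : R) m : cabs q <= M -> cabs q' <= M ->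
  cabs (q ^+ m - q' ^+ m) <= cabs (q - q') * (M + 1) ^+ m.
Proof.
move=> qM q'M; have M0 : 0 <= M by exact: le_trans (cabs_ge0 q) qM.
elim: m => [|m IH].
  by rewrite !expr0 subrr cabs0 mulr1 cabs_ge0.
have -> : q ^+ m.+1 - q' ^+ m.+1 = q * (q ^+ m - q' ^+ m) + (q - q') * q' ^+ m.
  by rewrite !exprS; ring.
rewrite (le_trans (cabsD _ _))// !cabsM cabsX exprSr mulrDr mulr1 mulrDr.
rewrite lerD//.
  rewrite mulrA mulrC; apply: ler_pM => //; exact: cabs_ge0.
apply: ler_wpM2l; first exact: cabs_ge0.
apply: lerXn2r; rewrite ?nnegrE ?cabs_ge0 ?addr_ge0//.
by rewrite (le_trans q'M)// lerDl.
Qed.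

Lemma cps_lip q q' M : cabs q <= M -> cabs q' <= M ->
  cabs (cps c q - cps c q') <= 2 * (B * cabs (q - q')) * expR (M + 1).
Proof.
move=> qM q'M; have M0 : 0 <= M by exact: le_trans (cabs_ge0 q) qM.
have [B0 cb] := cB.
pose u m : C := (c m)%:C * q ^+ m - (c m)%:C * q' ^+ m.
have [_ h] : ccvg \oo (csumn u) (csum u) /\
    cabs (csum u) <= 2 * (B * cabs (q - q')) * expR (M + 1).
  apply: csum_bound; rewrite ?mulr_ge0 ?cabs_ge0 ?addr_ge0// => m.
  rewrite /u -mulrBr cabsM cabsC -mulrA mulrCA mulrA.
  rewrite -[leRHS](_ : (B / m`!%:R) * (cabs (q - q') * (M + 1) ^+ m) = _).
    by apply: ler_pM => //; rewrite ?cabs_ge0//; exact: cabs_subX.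
  by ring.
suff <- : csum u = cps c q - cps c q' by [].
apply: csumE.
have [h1 _] := cps_bound q; have [h2 _] := cps_bound q'.
rewrite (_ : csumn u = fun n => csumn (fun m => (c m)%:C * q ^+ m) n +
    - csumn (fun m => (c m)%:C * q' ^+ m) n); first exact: ccvgD h1 (ccvgN h2).
by apply/funext => n; rewrite /csumn -sumrB.
Qed.

Lemma ccvg_cps T (F : set_system T) {FF : ProperFilter F} (f : T -> C) l :
  ccvg F f l -> ccvg F (fun x => cps c (f x)) (cps c l).
Proof.
move=> fl; have [B0 cb] := cB.
apply: ccvg_dist.
have h0 : cabs (f x - l) @[x --> F] --> (0 : R).
  rewrite -(cabs0 R) -(subrr l); apply: cvg_cabs.
  by apply: ccvgD => //; exact: ccvg_cst.
pose K := 2 * B * expR (cabs l + 1 + 1).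
have h1 : K * cabs (f x - l) @[x --> F] --> (0 : R).
  by rewrite -(mulr0 K); exact: cvgMr.
apply: (squeeze_cvgr _ (cvg_cst 0) h1).
near=> x; rewrite cabs_ge0/=.
  have hx : cabs (f x - l) <= 1.
    rewrite -[leLHS]ger0_norm ?cabs_ge0//.
    by near: x; exact: (cvgr0_norm_le _ h0).
  rewrite (le_trans (@cps_lip _ _ (cabs l + 1) _ _))//.
  + rewrite -[f x](subrK l) (le_trans (cabsD _ _))// addrC lerD//.
  + by rewrite lerDl.
  + by rewrite /K le_eqVlt; apply/orP; left; apply/eqP; ring.
Unshelve. all: by end_near. Qed.

Lemma cmeas_cps d (T : measurableType d) (f : T -> C) :
  cmeas f -> cmeas (fun x => cps c (f x)).
Proof.
move=> mf.
have ms n : cmeas (fun x => csumn (fun m => (c m)%:C * f x ^+ m) n).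
  elim: n => [|n IH].
    by under eq_fun do rewrite /csumn big_geq//; exact: cmeas_cst.
  under eq_fun do rewrite /csumn big_nat_recr//=.
  apply: cmeasD => //; apply: cmeasM; first exact: cmeas_cst.
  exact: cmeasX.
split.
  apply: (measurable_fun_cvg (h := fun n x => Re (csumn (fun m => (c m)%:C * f x ^+ m) n))).
    by move=> n; have [] := ms n.
  by move=> x _; have [[]] := cps_bound (f x).
apply: (measurable_fun_cvg (h := fun n x => Im (csumn (fun m => (c m)%:C * f x ^+ m) n))).
  by move=> n; have [] := ms n.
by move=> x _; have [[]] := cps_bound (f x).
Qed.

Lemma fbound_diffs : fbound B (pseries_diffs c).
Proof.
have [B0 cb] := cB; split => // m; rewrite /pseries_diffs normrM ger0_norm//.
have := cb m.+1; rewrite factS natrM invfM mulrCA => h.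
have := ler_wpM2l (ler0n R m.+1) h.
by rewrite [X in _ <= X -> _]mulrA mulfV// mul1r.
Qed.

End bounded.

Definition cderiv (f : R -> C) (x : R) (l : C) :=
  has_der (fun y => Re (f y)) x (Re l) /\ has_der (fun y => Im (f y)) x (Im l).

Lemma cderiv_eq f x l l' : cderiv f x l -> l = l' -> cderiv f x l'.
Proof. by move=> ? <-. Qed.

Lemma cderivD f g x l m : cderiv f x l -> cderiv g x m ->
  cderiv (fun y => f y + g y) x (l + m).
Proof.
move=> [f1 f2] [g1 g2]; split.
  by under eq_fun do rewrite creD; rewrite creD; exact: der_D.
by under eq_fun do rewrite cimD; rewrite cimD; exact: der_D.
Qed.

Lemma cderivN f x l : cderiv f x l -> cderiv (fun y => - f y) x (- l).
Proof.
move=> [f1 f2]; split.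
  by under eq_fun do rewrite creN; rewrite creN; exact: der_N.
by under eq_fun do rewrite cimN; rewrite cimN; exact: der_N.
Qed.

Lemma cderiv_cst c x : cderiv (fun=> c) x 0.
Proof. by split; exact: der_cst. Qed.

Lemma cderivC (f : R -> R) (x l : R) : has_der f x l ->
  cderiv (fun y => (f y)%:C) x l%:C.
Proof. by split => //=; exact: der_cst. Qed.

Lemma cderivM f g x l m : cderiv f x l -> cderiv g x m ->
  cderiv (fun y => f y * g y) x (l * g x + f x * m).
Proof.
move=> [f1 f2] [g1 g2]; split.
  under eq_fun do rewrite creM.
  apply: has_der_eq.
    by apply: der_D; [apply: der_M f1 g1|apply: der_N; apply: der_M f2 g2].
  by rewrite !cE; ring.
under eq_fun do rewrite cimM.
apply: has_der_eq.
  by apply: der_D; [apply: der_M f1 g2|apply: der_M f2 g1].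
by rewrite !cE; ring.
Qed.

Lemma cderiv_comp (f : R -> C) (g : R -> R) (x : R) (l : C) (m : R) :
  has_der g x m -> cderiv f (g x) l -> cderiv (fun y => f (g y)) x (l * m%:C).
Proof.
move=> dg [f1 f2]; split.
  apply: has_der_eq; first exact: (der_comp f1 dg).
  by rewrite !cE mulr0 subr0.
apply: has_der_eq; first exact: (der_comp f2 dg).
by rewrite !cE mulr0 add0r.
Qed.

(** [fbound] with a radius: on the line [w * p] the coefficients acquire the factors [Re (w ^+ m)]
    and [Im (w ^+ m)], of size at most [cabs w ^+ m]. *)
Definition gbound B r (c : nat -> R) :=
  [/\ 0 <= B, 0 <= r & forall m, `|c m| <= B * (r ^+ m / m`!%:R)].

Lemma cvg_gbound_pseries B r c (K : R) : gbound B r c -> cvgn (pseries c K).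
Proof.
move=> [B0 r0 cb].
have cg : cvgn (series (fun m => B * ((r * `|K|) ^+ m / m`!%:R) : R)).
  rewrite (_ : series _ = (fun n => B * series (exp_coeff (r * `|K|)) n)).
    by apply: is_cvgMr; exact: is_cvg_series_exp_coeff.
  by apply/funext => n; rewrite !seriesEnat/= mulr_sumr.
rewrite /pseries.
suff [] : cvgn (series (fun i => c i * K ^+ i)) /\
  `|limn (series (fun i => c i * K ^+ i))| <=
    limn (series (fun m => B * ((r * `|K|) ^+ m / m`!%:R) : R)) by [].
apply: le_cvg_lim_series => // n.
rewrite normrM normrX exprMn.
rewrite [leRHS](_ : _ = (B * (r ^+ n / n`!%:R)) * `|K| ^+ n); last by ring.
by apply: ler_wpM2r; [rewrite exprn_ge0|exact: cb].
Qed.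

Lemma gbound_diffs B r c : gbound B r c -> gbound (B * r) r (pseries_diffs c).
Proof.
move=> [B0 r0 cb]; split => //; first exact: mulr_ge0.
move=> m; rewrite /pseries_diffs normrM ger0_norm//.
have := ler_wpM2l (ler0n R m.+1) (cb m.+1).
rewrite factS natrM; congr (_ <= _).
by rewrite exprS; field; rewrite pnatr_eq0 -lt0n fact_gt0 nat1r pnatr_eq0.
Qed.

Lemma gbound_derive B r c (x : R) : gbound B r c ->
  has_der (fun y => limn (pseries c y)) x (limn (pseries (pseries_diffs c) x)).
Proof.
move=> cb; have cb' := gbound_diffs cb; have cb'' := gbound_diffs cb'.
apply: (@pseries_snd_diffs _ c (`|x| + 1)).
  exact: cvg_gbound_pseries cb.
  exact: cvg_gbound_pseries cb'.
  exact: cvg_gbound_pseries cb''.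
by rewrite [ltRHS]ger0_norm ?addr_ge0// ltrDl.
Qed.

Lemma Re_cps_line c (w : C) (p : R) :
  Re (cps c (w * p%:C)) = limn (pseries (fun m => c m * Re (w ^+ m)) p).
Proof.
rewrite /cps /csum /= /pseries; congr (limn (series _)); apply/funext => n.
by rewrite exprMn -rmorphXn /= !cE; ring.
Qed.

Lemma Im_cps_line c (w : C) (p : R) :
  Im (cps c (w * p%:C)) = limn (pseries (fun m => c m * Im (w ^+ m)) p).
Proof.
rewrite /cps /csum /= /pseries; congr (limn (series _)); apply/funext => n.
by rewrite exprMn -rmorphXn /= !cE; ring.
Qed.

Lemma cps_scale B c q w : fbound B c ->
  w * cps c q = csum (fun m => w * ((c m)%:C * q ^+ m)).
Proof.
move=> cB; have [h _] := cps_bound cB q.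
apply/esym/csumE.
rewrite (_ : csumn _ = fun n => w * csumn (fun m => (c m)%:C * q ^+ m) n).
  by apply: ccvgM => //; exact: ccvg_cst.
by apply/funext => n; rewrite /csumn mulr_sumr.
Qed.

Lemma cpsD B B' c c' q : fbound B c -> fbound B' c' ->
  cps c q + cps c' q = cps (fun m => c m + c' m) q.
Proof.
move=> cB cB'; have [h _] := cps_bound cB q; have [h' _] := cps_bound cB' q.
apply/esym/csumE.
rewrite (_ : csumn _ = fun n => csumn (fun m => (c m)%:C * q ^+ m) n +
   csumn (fun m => (c' m)%:C * q ^+ m) n); first exact: ccvgD.
by apply/funext => n; rewrite /csumn -big_split/=; apply: eq_bigr => m _; rewrite rmorphD mulrDl.
Qed.

Lemma cps_real_scale B c q (a : R) : fbound B c ->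
  a%:C * cps c q = cps (fun m => a * c m) q.
Proof.
move=> cB; rewrite (cps_scale _ _ cB) /cps; congr csum; apply/funext => m.
by rewrite rmorphM mulrA.
Qed.

Lemma cps_shift B c q : fbound B c ->
  cps c q = (c 0%N)%:C + q * cps (fun m => c m.+1) q.
Proof.
move=> cB.
have cB' : fbound B (fun m => c m.+1).
  have [B0 cb] := cB; split => // m; rewrite (le_trans (cb _))//.
  by rewrite ler_wpM2l// lef_pV2 ?posrE ?ltr0n ?fact_gt0// ler_nat factS leq_pmull.
have [[h1 h2] _] := cps_bound cB' q.
apply: csumE.
have hs : ccvg \oo (fun n => csumn (fun m => (c m)%:C * q ^+ m) n.+1)
    ((c 0%N)%:C + q * cps (fun m => c m.+1) q).
  rewrite (_ : (fun n => csumn _ n.+1) = fun n => (c 0%N)%:C +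
     q * csumn (fun m => (c m.+1)%:C * q ^+ m) n).
    apply: ccvgD; first exact: ccvg_cst.
    by apply: ccvgM; [exact: ccvg_cst|split].
  apply/funext => n; rewrite /csumn big_nat_recl//= expr0 mulr1; congr (_ + _).
  by rewrite mulr_sumr; apply: eq_bigr => m _; rewrite exprS mulrCA.
have [h3 h4] := hs.
by split; [move: h3; rewrite -(cvg_shiftS (fun n => Re (csumn (fun m => (c m)%:C * q ^+ m) n)))|
  move: h4; rewrite -(cvg_shiftS (fun n => Im (csumn (fun m => (c m)%:C * q ^+ m) n)))].
Qed.

Lemma cps0 B c : fbound B c -> cps c 0 = (c 0%N)%:C.
Proof. by move=> cB; rewrite (cps_shift _ cB) mul0r addr0. Qed.

(** On the line [w * y] the real and imaginary parts are real power series in [y], so termwise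
    differentiation in one real variable takes the place of holomorphy. *)
Lemma cps_derive B c (w : C) (p : R) : fbound B c ->
  cderiv (fun y => cps c (w * y%:C)) p (w * cps (pseries_diffs c) (w * p%:C)).
Proof.
move=> cB; have [B0 cb] := cB.
have hg (g : C -> R) : (forall z, `|g z| <= cabs z) ->
    gbound B (cabs w) (fun m => c m * g (w ^+ m)).
  move=> gle; split => //; first exact: cabs_ge0.
  move=> m; rewrite normrM -cabsX mulrCA [leRHS]mulrC.
  by apply: ler_pM => //; exact: cb.
rewrite (cps_scale _ _ (fbound_diffs cB)); split.
  under eq_fun do rewrite Re_cps_line.
  apply: has_der_eq; first exact: gbound_derive (hg _ (@Re_le_cabs _)).
  rewrite /csum/= /pseries; congr (limn (series _)); apply/funext => n.
  by rewrite /= /pseries_diffs (exprS w) exprMn -rmorphXn /= !cE; ring.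
under eq_fun do rewrite Im_cps_line.
apply: has_der_eq; first exact: gbound_derive (hg _ (@Im_le_cabs _)).
rewrite /csum/= /pseries; congr (limn (series _)); apply/funext => n.
by rewrite /= /pseries_diffs (exprS w) exprMn -rmorphXn /= !cE; ring.
Qed.

End PowerSeries.

(** * Series form of the Hankel function *)

Section Bessel.
Variable R : realType.
Local Notation C := R[i].

(** [cps cI q] is [I_1(2 sqrt q) / sqrt q]; [cP] gives the digamma series of [Y_1], the one that
    does not multiply the logarithm. *)
Definition cI (m : nat) : R := (m`!%:R * m.+1`!%:R)^-1.
Definition cP (m : nat) : R := (psi_nat1 R m + psi_nat1 R m.+1) * cI m.

Lemma fact_gt0R m : 0 < (m`!%:R : R). Proof. by rewrite ltr0n fact_gt0. Qed.

Lemma fbound_cI : fbound 1 cI.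
Proof.
split => // m; rewrite /cI ger0_norm ?invr_ge0 ?mulr_ge0// div1r.
rewrite lef_pV2 ?posrE ?mulr_gt0 ?fact_gt0R//.
by rewrite ler_peMr// ler1n fact_gt0.
Qed.

Lemma harmonic_ge0 m : 0 <= Defs.harmonic R m.
Proof. by apply: sumr_ge0 => i _; rewrite invr_ge0. Qed.

Lemma harmonicS m : Defs.harmonic R m.+1 = Defs.harmonic R m + (m.+1%:R)^-1.
Proof. by rewrite /Defs.harmonic big_nat_recr. Qed.

Lemma harmonic_le m : Defs.harmonic R m <= m%:R.
Proof.
elim: m => [|m IH]; first by rewrite /Defs.harmonic big_geq.
rewrite harmonicS -[leRHS]natr1 lerD// invf_le1 ?ltr0n//.
by rewrite ler1n.
Qed.

Lemma psi_nat1S m : psi_nat1 R m.+1 = psi_nat1 R m + (m.+1%:R)^-1.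
Proof. by rewrite /psi_nat1 harmonicS addrA. Qed.

Lemma psi_nat1_le m : `|psi_nat1 R m| <= `|euler_gamma R| + m%:R.
Proof.
rewrite /psi_nat1 (le_trans (ler_normD _ _))// normrN lerD2l.
by rewrite ger0_norm ?harmonic_ge0// harmonic_le.
Qed.

Lemma fbound_cP : fbound (2 * `|euler_gamma R| + 2) cP.
Proof.
split; first by rewrite addr_ge0// mulr_ge0.
move=> m; rewrite /cP normrM.
(* Since [H_m <= m], the digamma sum grows at most linearly, and the factor [m + 1] is paid by
   [(m + 1)!]. *)
have h : `|psi_nat1 R m + psi_nat1 R m.+1| <= (2 * `|euler_gamma R| + 2) * m.+1%:R.
  rewrite (le_trans (ler_normD _ _))//.
  have := psi_nat1_le m; have := psi_nat1_le m.+1; rewrite -natr1.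
  have : 0 <= (m%:R : R) by []. have := normr_ge0 (euler_gamma R).
  by nra.
have cI0 : 0 <= cI m by rewrite invr_ge0 mulr_ge0.
rewrite (ger0_norm cI0) (le_trans (ler_wpM2r cI0 h))//.
rewrite -mulrA; apply: ler_wpM2l; first by rewrite addr_ge0// mulr_ge0.
have -> : m.+1%:R * cI m = m`!%:R^-1 * m`!%:R^-1.
  by rewrite /cI factS natrM; field; rewrite pnatr_eq0 -lt0n fact_gt0 nat1r pnatr_eq0.
by rewrite ler_piMr// ?invr_ge0// invf_le1 ?fact_gt0R// ler1n fact_gt0.
Qed.

Lemma besselJ1E (z : C) : besselJ1 z = z / 2 * cps cI (- (z ^+ 2) / 4).
Proof.
rewrite (cps_scale _ _ fbound_cI) /besselJ1; congr csum; apply/funext => m.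
rewrite /cI rmorphV ?unitfE ?mulf_neq0 ?gt_eqF ?fact_gt0R//= rmorphM !rmorph_nat.
have -> : - z ^+ 2 / 4 = -1 * (z / 2) ^+ 2 by field.
by rewrite exprS exprM [in RHS]exprMn; ring.
Qed.

(** Pole, logarithm and entire series are separated here. Boundedness near [0], measurability,
    continuity and the passage to [K_1] all start from this form. *)
Lemma hankel1E (z : C) : hankel1 z = - (2 * 'i / (pi%:C * z)) +
  z / 2 * ((1 + 2 * 'i / pi%:C * clog (z / 2)) * cps cI (- (z ^+ 2) / 4)
           - 'i / pi%:C * cps cP (- (z ^+ 2) / 4)).
Proof.
rewrite /hankel1 /besselY1 besselJ1E.
have -> : csum (fun m => (psi_nat1 R m + psi_nat1 R m.+1)%:C * (- z ^+ 2 / 4) ^+ m /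
    (m`!%:R * m.+1`!%:R)) = cps cP (- (z ^+ 2) / 4).
  rewrite /cps; congr csum; apply/funext => m.
  rewrite /cP rmorphM /cI rmorphV ?unitfE ?mulf_neq0 ?gt_eqF ?fact_gt0R//= rmorphM !rmorph_nat.
  by ring.
by rewrite /=; ring.
Qed.

End Bessel.

(** * Improper integrals over the half line from 1 *)

Section ImproperIntegrals.
Variable R : realType.
Local Notation mu := (@lebesgue_measure R).
Local Notation I1 := `[(1 : R), +oo[%classic.

Lemma measurable_I1 : measurable I1. Proof. exact: measurable_itv. Qed.
Hint Resolve measurable_I1 : core.

Lemma I1E x : I1 x = (1 <= x). Proof. by rewrite /= in_itv/= andbT. Qed.

Lemma FTC_I1_ge0 (f F : R -> R) (l : R) :
  (forall x, 1 <= x -> 0 <= f x) ->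
  (forall x, 0 < x -> {for x, continuous f}) ->
  (forall x : R, 0 < x -> has_der F x (f x)) ->
  F x @[x --> +oo] --> l ->
  (\int[mu]_(x in I1) (f x)%:E = (l - F 1)%:E)%E.
Proof.
move=> f0 cf dF Fl; rewrite EFinB; apply: ge0_continuous_FTC2y => //.
- apply: continuous_in_subspaceT => x /[!inE]; rewrite I1E => x1.
  by apply: cf; apply: lt_le_trans x1.
- by move=> x x1; have [] := dF x (lt_trans ltr01 x1).
- apply: cvg_at_right_filter.
  exact: (der_continuous (dF 1 ltr01)).
- move=> x /[!in_itv]/= /andP[x1 _].
  by have h : is_derive x (1 : R) F (f x) := dF x (lt_trans ltr01 x1); rewrite derive1E derive_val.
Qed.

Lemma cvg_expRN_pinfty (A : R) : 0 < A -> expR (- (A * x)) @[x --> +oo] --> (0 : R).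
Proof.
move=> A0.
apply: (@cvg_comp _ _ _ (fun x => A * x) (fun x => expR (- x)) _ +oo); last exact: cvgr_expR.
exact: gt0_cvgMry.
Qed.

Lemma cvgV_pinfty : (x : R)^-1 @[x --> +oo] --> (0 : R).
Proof.
apply/cvgrPdist_le => e e0; near=> x.
have x0 : 0 < x by near: x; exact: nbhs_pinfty_gt.
have xe : e^-1 <= x by near: x; apply: nbhs_pinfty_ge; rewrite ?num_real.
by rewrite sub0r normrN gtr0_norm ?invr_gt0// invf_ple ?posrE.
Unshelve. all: by end_near. Qed.

Lemma integral_expRN (A : R) : 0 < A ->
  (\int[mu]_(x in I1) (expR (- (A * x)))%:E = (expR (- A) / A)%:E)%E.
Proof.
move=> A0.
apply: (eq_trans (@FTC_I1_ge0 _ (fun x => - (expR (- (A * x)) / A)) 0 _ _ _ _)); last first.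
- by rewrite sub0r opprK mulr1.
- rewrite -oppr0; apply: cvgN; rewrite -(mul0r A^-1); apply: cvgMl.
  exact: cvg_expRN_pinfty.
- move=> x _; apply: has_der_eq; first by der.
  by rewrite /=; field; rewrite gt_eqF.
- by move=> x _; apply: der_continuous; der.
- by move=> x _; exact: expR_ge0.
Qed.

Lemma measurable_expRN (A : R) : measurable_fun setT (fun x : R => expR (- (A * x))).
Proof.
apply: (measurableT_comp (f := expR)); first exact: measurable_expR.
by apply: measurableT_comp => //; exact: mulrl_measurable.
Qed.

Lemma integrable_expRN1 (A : R) : 0 < A ->
  mu.-integrable I1 (fun x => (expR (- (A * x)))%:E).
Proof.
move=> A0; apply/integrableP; split.
  by apply/measurable_EFinP; apply: measurable_funTS; exact: measurable_expRN.
under eq_integral => x _ do rewrite gee0_abs ?lee_fin ?expR_ge0//.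
by rewrite integral_expRN// ltry.
Qed.

Lemma integrable_expRN (A K : R) : 0 < A ->
  mu.-integrable I1 (fun x => (K * expR (- (A * x)))%:E).
Proof.
move=> A0; have h := integrable_expRN1 A0.
have := @integrableZl _ _ _ mu I1 measurable_I1 K _ h.
by apply: eq_integrable.
Qed.

Lemma dom_integrable (f : R -> R) (A K : R) : 0 < A -> measurable_fun I1 f ->
  (forall x, 1 <= x -> `|f x| <= K * expR (- (A * x))) ->
  mu.-integrable I1 (EFin \o f).
Proof.
move=> A0 mf fK.
apply: (le_integrable _ _ _ (integrable_expRN K A0)) => //.
  exact/measurable_EFinP.
move=> x; rewrite I1E => x1; rewrite lee_fin (le_trans (fK _ x1))//.
exact: ler_norm.
Qed.

Lemma FTC_I1 (f F : R -> R) (A K l : R) : 0 < A ->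
  (forall x, 1 <= x -> `|f x| <= K * expR (- (A * x))) ->
  (forall x, 0 < x -> {for x, continuous f}) ->
  (forall x : R, 0 < x -> has_der F x (f x)) ->
  F x @[x --> +oo] --> l ->
  Rintegral mu I1 f = l - F 1.
Proof.
move=> A0 fK cf dF Fl.
have mf : measurable_fun I1 f.
  apply: (@measurable_funS _ _ _ _ `](0 : R), +oo[) => //.
    by move=> x; rewrite I1E /= in_itv/= andbT => /(lt_le_trans ltr01).
  apply: open_continuous_measurable_fun; first exact: interval_open.
  by move=> x; rewrite inE/= in_itv/= andbT => /cf.
have fi := dom_integrable A0 mf fK.
have ki := integrable_expRN K A0.
(* Adding the dominating exponential makes the integrand nonnegative; the integral of the
   exponential is explicit and is subtracted at the end. *)
pose h x := f x + K * expR (- (A * x)).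
have hE : Rintegral mu I1 h = l - (F 1 - K * (expR (- A) / A)).
  rewrite /Rintegral.
  suff -> : (\int[mu]_(x in I1) (h x)%:E = (l - (F 1 + - (K * (expR (- (A * 1)) / A))))%:E)%E.
    by rewrite /= mulr1.
  apply: (@FTC_I1_ge0 h (fun x => F x + - (K * (expR (- (A * x)) / A))) l).
  - move=> x x1; rewrite /h; have := fK x x1; rewrite ler_norml => /andP[+ _].
    by rewrite -subr_ge0 opprK addrC.
  - move=> x x0; apply: continuousD; first exact: cf.
    by apply: der_continuous; der.
  - move=> x x0; apply: has_der_eq; first by apply: der_D; [exact: dF|der].
    by rewrite /h /=; field; rewrite gt_eqF.
  - rewrite -[X in _ --> X]addr0 -oppr0; apply: cvgD => //; apply: cvgN.
    rewrite -(mulr0 K); apply: cvgMr; rewrite -(mul0r A^-1); apply: cvgMl.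
    exact: cvg_expRN_pinfty.
have := @RintegralD _ _ _ mu I1 _ _ measurable_I1 fi ki.
rewrite -[X in X = _ -> _]/(Rintegral mu I1 h) hE.
have -> : (\int[mu]_(x in I1) (K * expR (- (A * x))) = K * (expR (- A) / A))%R.
  rewrite RintegralZl//; last exact: integrable_expRN1.
  by rewrite /Rintegral integral_expRN.
by move=> e; rewrite -[LHS](addrK (K * (expR (- A) / A))) -e; ring.
Qed.

(** Half of the exponent pays for the factor [x], by [y <= e^y] at [y = A x / 2]. *)
Lemma mulr_expRN_le (A x : R) : 0 < A -> 0 <= x ->
  x * expR (- (A * x)) <= 2 / A * expR (- (A / 2 * x)).
Proof.
move=> A0 x0.
have -> : - (A * x) = - (A / 2 * x) + - (A / 2 * x) by field.
rewrite expRD mulrA; apply: ler_wpM2r; first exact: expR_ge0.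
have h : A / 2 * x <= expR (A / 2 * x) by rewrite (le_trans _ (expR_ge1Dx _))// lerDr.
rewrite expRN -(ler_pM2l (divr_gt0 A0 (ltr0n R 2))) mulrA.
rewrite (_ : A / 2 * (2 / A) = 1); last by rewrite /=; field; rewrite gt_eqF.
by rewrite ler_pdivrMr ?expR_gt0// mul1r.
Qed.

Lemma Rintegral_norm_le (f g : R -> R) : measurable_fun I1 f ->
  mu.-integrable I1 (EFin \o g) ->
  (forall x, 1 <= x -> `|f x| <= g x) ->
  `|Rintegral mu I1 f| <= Rintegral mu I1 g.
Proof.
move=> mf ig fg.
have if_ : mu.-integrable I1 (EFin \o f).
  apply: (le_integrable _ _ _ ig) => //; first exact/measurable_EFinP.
  move=> x; rewrite I1E => x1; rewrite /= lee_fin (le_trans (fg _ x1))//.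
  exact: ler_norm.
apply: (le_trans (le_normr_Rintegral _ _)) => //.
apply: le_Rintegral => //; first exact: integrable_norm.
by move=> x; rewrite I1E => /fg.
Qed.

Lemma integral_sqrV : mu.-integrable I1 (fun x : R => (x ^- 2)%:E) /\
  Rintegral mu I1 (fun x : R => x ^- 2) = 1.
Proof.
have h : (\int[mu]_(x in I1) (x ^- 2)%:E = (0 - (- (1:R)^-1))%:E)%E.
  apply: (@FTC_I1_ge0 _ (fun x => - x^-1)).
  - by move=> x x1; rewrite invr_ge0 exprn_ge0// (le_trans ler01).
  - move=> x x0; apply: (@der_continuous _ (fun y => (y ^+ 2)^-1)).
    by apply: der_V; [rewrite expf_neq0// gt_eqF|der].
  - move=> x x0; apply: has_der_eq; first by der; rewrite gt_eqF.
    by rewrite /=; field; rewrite gt_eqF.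
  - by rewrite -oppr0; apply: cvgN; exact: cvgV_pinfty.
split; last by rewrite /Rintegral h /= invr1 sub0r opprK.
apply/integrableP; split.
  apply/measurable_EFinP/measurable_funTS; apply: measurable_fun_invr.
  exact: exprn_measurable.
under eq_integral => x _ do rewrite gee0_abs ?lee_fin ?invr_ge0 ?sqr_ge0//.
by rewrite h ltry.
Qed.

End ImproperIntegrals.

(** * Laplace-type integrals and their derivatives *)

Section LaplaceIntegrals.
Variable R : realType.
Local Notation C := R[i].
Local Notation mu := (@lebesgue_measure R).
Local Notation I1 := `[(1 : R), +oo[%classic.
Hint Resolve measurable_I1 : core.
Implicit Types (g y t h : R -> R) (A B K a b c d s x : R).

(** This is [exp(-A + i B)]. *)
Definition ce (A B : R) : C := (expR (- A) * cos B) +i* (expR (- A) * sin B).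

Lemma cabs_ce A B : cabs (ce A B) = expR (- A).
Proof.
rewrite /cabs /ce /= !exprMn -mulrDr cos2Dsin2 mulr1 sqrtr_sqr.
by rewrite ger0_norm// expR_ge0.
Qed.

Lemma ceD A B A' B' : ce (A + A') (B + B') = ce A B * ce A' B'.
Proof.
apply: ceqP; rewrite /ce /=.
  by rewrite opprD expRD cosD; ring.
by rewrite opprD expRD sinD; ring.
Qed.

Lemma ce_sub1 A B : 0 <= A -> cabs (ce A B - 1) <= A + 2 * `|B|.
Proof.
move=> A0; rewrite (le_trans (cabs_le_ReIm _))// !cE /=.
have e1 : expR (- A) <= 1 by rewrite -expR0 ler_expR oppr_le0.
have e2 : 1 - A <= expR (- A) by exact: expR_ge1Dx.
have e0 := expR_ge0 (- A).
have h1 : `|expR (- A) * cos B - 1| <= A + `|B|.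
  have -> : expR (- A) * cos B - 1 = (expR (- A) - 1) - expR (- A) * (1 - cos B) by ring.
  rewrite (le_trans (ler_normB _ _))// lerD//.
    by rewrite ler_norml; apply/andP; split; lra.
  rewrite normrM (ger0_norm e0) -[leRHS]mul1r; apply: ler_pM => //.
  exact: cos_sub1_le.
have h2 : `|expR (- A) * sin B - 0| <= `|B|.
  rewrite subr0 normrM (ger0_norm e0) -[leRHS]mul1r; apply: ler_pM => //.
  exact: sin_le_norm.
by rewrite oppr0 in h2 *; lra.
Qed.

(** For [t] equal to [cos] or [sin], the real or imaginary part of [g(x) exp(-(A - i B) y(x))]. *)
Definition kI (g y t : R -> R) (A B x : R) : R :=
  g x * (expR (- (A * y x)) * t (B * y x)).

Definition cJ (g y : R -> R) (A B : R) : C :=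
  (Rintegral mu I1 (kI g y cos A B)) +i* (Rintegral mu I1 (kI g y sin A B)).

Definition nicey (y : R -> R) := measurable_fun setT y /\
  forall x, 1 <= x -> x <= y x <= 2 * x.
Definition nicet (t : R -> R) := measurable_fun setT t /\ forall x, `|t x| <= 1.

Lemma nicet_cos : nicet cos.
Proof.
split; first by apply: continuous_measurable_fun; exact: continuous_cos.
by move=> x; rewrite ler_norml cos_geN1 cos_le1.
Qed.

Lemma nicet_sin : nicet sin.
Proof.
split; first by apply: continuous_measurable_fun; exact: continuous_sin.
by move=> x; rewrite ler_norml sin_geN1 sin_le1.
Qed.

Lemma nicet_Nsin : nicet (fun x => - sin x).
Proof.
have [m b] := nicet_sin; split; first exact: measurableT_comp.
by move=> x; rewrite normrN.
Qed.

Lemma measurable_kI g y t A B : measurable_fun setT g -> nicey y -> nicet t ->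
  measurable_fun setT (kI g y t A B).
Proof.
move=> mg [my _] [mt _]; apply: measurable_funM => //.
apply: measurable_funM.
  apply: (measurableT_comp (f := expR)); first exact: measurable_expR.
  by apply: measurableT_comp => //; exact: measurable_funM.
by apply: measurableT_comp => //; exact: measurable_funM.
Qed.

Lemma kI_le g y t A B x : 0 <= A -> nicey y -> nicet t -> 1 <= x ->
  `|kI g y t A B x| <= `|g x| * expR (- (A * x)).
Proof.
move=> A0 [_ yx] [_ tx] x1; rewrite /kI normrM; apply: ler_wpM2l => //.
rewrite normrM ger0_norm ?expR_ge0// -[leRHS]mulr1.
apply: ler_pM => //.
by rewrite ler_expR lerN2; apply: ler_wpM2l => //; have /andP[] := yx x x1.
Qed.

Lemma kI_bound g y t A B K x : 0 < A -> 0 <= K -> nicey y -> nicet t -> 1 <= x ->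
  `|g x| <= K * x -> `|kI g y t A B x| <= (K * (2 / A)) * expR (- (A / 2 * x)).
Proof.
move=> A0 K0 ny nt x1 gK; apply: (le_trans (kI_le _ _ (ltW A0) ny nt x1)).
apply: (@le_trans _ _ (K * x * expR (- (A * x)))).
  by apply: ler_wpM2r => //; exact: expR_ge0.
rewrite -[leLHS]mulrA -[leRHS]mulrA; apply: ler_wpM2l => //.
by apply: mulr_expRN_le => //; exact: le_trans x1.
Qed.

Lemma integrable_kI g y t A B K : 0 < A -> 0 <= K -> measurable_fun setT g ->
  nicey y -> nicet t -> (forall x, 1 <= x -> `|g x| <= K * x) ->
  mu.-integrable I1 (EFin \o kI g y t A B).
Proof.
move=> A0 K0 mg ny nt gK.
apply: (@dom_integrable _ _ (A / 2) (K * (2 / A))).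
- by rewrite divr_gt0.
- by apply: measurable_funTS; exact: measurable_kI.
- by move=> x x1; apply: kI_bound => //; exact: gK.
Qed.

(** The parameters move along a line: the directions used later are [A] alone, [B] alone and the ray
    [(c s, d s)]. *)
Lemma kI_der (g y t t' : R -> R) a b c d s K : 0 <= K -> 0 < a + c * s ->
  measurable_fun setT g -> nicey y -> nicet t -> nicet t' ->
  (forall x, has_der t x (t' x)) ->
  (forall x, 1 <= x -> `|g x| <= K) ->
  has_der (fun s => Rintegral mu I1 (kI g y t (a + c * s) (b + d * s))) s
   (- c * Rintegral mu I1 (kI (fun x => g x * y x) y t (a + c * s) (b + d * s))
    + d * Rintegral mu I1 (kI (fun x => g x * y x) y t' (a + c * s) (b + d * s))).
Proof.
move=> K0 s0 mg ny nt nt' dt gK.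
(* On the interval of radius [e] around [s], the coefficient [a + c r] stays above half of its value
   at [s], so one integrable [G] dominates all derivatives. The [+ 1] in [e] allows [c = 0]. *)
pose A1 := (a + c * s) / 2.
have A10 : 0 < A1 by rewrite divr_gt0.
pose e := A1 / (`|c| + 1).
have c1 : 0 < `|c| + 1 by rewrite ltr_wpDl.
have e0 : 0 < e by rewrite divr_gt0.
have sA r : `](s - e), (s + e)[%classic r -> A1 <= a + c * r.
  rewrite /= in_itv/= => /andP[h1 h2].
  have : `|c * (s - r)| <= A1.
    rewrite normrM; apply: (@le_trans _ _ (`|c| * e)).
      by apply: ler_wpM2l => //; rewrite ler_norml; apply/andP; split; lra.
    rewrite /e mulrA ler_pdivrMr// mulrC; apply: ler_wpM2l; first exact: ltW.
    by rewrite lerDl.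
  rewrite ler_norml => /andP[_].
  by rewrite (_ : c * (s - r) = A1 + A1 - (a + c * r)); [lra|rewrite /A1; field].
pose f r x := kI g y t (a + c * r) (b + d * r) x.
have gK' x : 1 <= x -> `|g x| <= K * x.
  by move=> x1; rewrite (le_trans (gK x x1))// ler_peMr.
have gyK x : 1 <= x -> `|g x * y x| <= 2 * K * x.
  move=> x1; rewrite normrM; have /andP[y1 y2] := ny.2 x x1.
  have y0 : 0 <= y x by rewrite (le_trans _ y1)// (le_trans _ x1).
  rewrite (ger0_norm y0) -mulrA mulrCA; apply: ler_pM => //; exact: gK.
have my : measurable_fun setT (fun x => g x * y x).
  by apply: measurable_funM => //; have [] := ny.
pose f1 r x := - c * kI (fun x => g x * y x) y t (a + c * r) (b + d * r) x
    + d * kI (fun x => g x * y x) y t' (a + c * r) (b + d * r) x.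
have df r x : has_der (f ^~ x) r (f1 r x).
  rewrite /f /kI; apply: has_der_eq.
    apply: der_M; first exact: der_cst.
    apply: der_M; first by der.
    by apply: (der_comp (h := t)); [exact: dt|der].
  by rewrite /f1 /kI /=; ring.
have d1f r x : (fun z : R => f z x)^`() r = f1 r x.
  by rewrite derive1E; have h : is_derive r (1 : R) (f ^~ x) (f1 r x) := df r x; rewrite derive_val.
pose G x := (`|c| + `|d|) * ((2 * K * (2 / A1)) * expR (- (A1 / 2 * x))).
have G0 x : 0 <= G x.
  by rewrite /G !mulr_ge0 ?addr_ge0 ?expR_ge0 ?invr_ge0// ltW.
have iG : mu.-integrable I1 (EFin \o G).
  rewrite (_ : EFin \o G = fun x => ((`|c| + `|d|) * (2 * K * (2 / A1)) *
    expR (- (A1 / 2 * x)))%:E); last by apply/funext => x; rewrite /G /= mulrA.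
  by apply: integrable_expRN; rewrite divr_gt0.
have Is : `](s - e), (s + e)[%classic s.
  by rewrite /= in_itv/=; apply/andP; split; lra.
have intf r : `](s - e), (s + e)[%classic r -> mu.-integrable I1 (EFin \o f r).
  by move=> /sA rA; apply: (integrable_kI _ _ K0) => //; apply: lt_le_trans rA.
have derf r x : `](s - e), (s + e)[%classic r -> I1 x -> derivable (f ^~ x) r 1.
  by move=> _ _; have [] := df r x.
have Gub r x : `](s - e), (s + e)[%classic r -> I1 x -> `|partial1of2 f r x| <= G x.
  move=> /sA rA; rewrite I1E => x1; rewrite /partial1of2 d1f /f1 /G.
  have kb t0 : nicet t0 -> `|kI (fun x => g x * y x) y t0 (a + c * r) (b + d * r) x| <=
      2 * K * (2 / A1) * expR (- (A1 / 2 * x)).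
    move=> nt0; have x0 : 0 <= x by rewrite (le_trans _ x1).
    apply: (le_trans (kI_le _ _ _ ny nt0 x1)); first by rewrite (le_trans (ltW A10)).
    apply: (@le_trans _ _ (2 * K * x * expR (- (A1 * x)))).
      apply: ler_pM => //; first exact: gyK.
      by rewrite ler_expR lerN2; exact: ler_wpM2r.
    rewrite -[leLHS]mulrA -[leRHS]mulrA; apply: ler_wpM2l; first by rewrite mulr_ge0.
    exact: mulr_expRN_le.
  rewrite (le_trans (ler_normD _ _))// [leRHS]mulrDl (normrM (- c)) (normrM d) normrN lerD//.
    by apply: ler_wpM2l => //; exact: kb.
  by apply: ler_wpM2l => //; exact: kb.
have h1 := @derivable_under_integral _ _ _ mu f I1 (@measurable_I1 R) s (s - e) (s + e) Is intf derf G G0 iG Gub.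
have h2 := @differentiation_under_integral _ _ _ mu f I1 (@measurable_I1 R) s (s - e) (s + e) Is intf derf G G0 iG Gub.
have h : has_der (fun s => Rintegral mu I1 (f s)) s (\int[mu]_(x in I1) f1 s x)%R.
  split => //; rewrite -derive1E h2; apply: eq_Rintegral => x _.
  by rewrite /partial1of2 d1f.
apply: (has_der_eq h).
have K20 : 0 <= 2 * K by rewrite mulr_ge0.
have i1 : mu.-integrable I1 (EFin \o kI (fun x => g x * y x) y t (a + c * s) (b + d * s)).
  exact: (integrable_kI _ _ K20).
have i2 : mu.-integrable I1 (EFin \o kI (fun x => g x * y x) y t' (a + c * s) (b + d * s)).
  exact: (integrable_kI _ _ K20).
have z1 k F : mu.-integrable I1 (EFin \o F) -> mu.-integrable I1 (EFin \o (fun x => k * F x)).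
  by move=> iF; have := @integrableZl _ _ _ mu I1 (@measurable_I1 R) k _ iF; exact: eq_integrable.
rewrite /f1 (@RintegralD _ _ _ mu I1 _ _ (@measurable_I1 R) (z1 _ _ i1) (z1 _ _ i2)).
by rewrite (@RintegralZl _ _ _ mu I1 _ _ (@measurable_I1 R) i1) (@RintegralZl _ _ _ mu I1 _ _ (@measurable_I1 R) i2).
Qed.

(** The two real derivatives recombine into multiplication of the integrand by [-(c - i d) y]. *)
Lemma cJ_der (g y : R -> R) a b c d s K : 0 <= K -> 0 < a + c * s ->
  measurable_fun setT g -> nicey y -> (forall x, 1 <= x -> `|g x| <= K) ->
  cderiv (fun s => cJ g y (a + c * s) (b + d * s)) s
   (- (c -i* d) * cJ (fun x => g x * y x) y (a + c * s) (b + d * s)).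
Proof.
move=> K0 s0 mg ny gK; split.
  apply: has_der_eq.
    by apply: (kI_der _ _ K0 s0 mg ny nicet_cos nicet_Nsin) => // x; exact: is_derive_cos.
  rewrite /cJ !cE /=.
  have -> : (\int[mu]_(x in I1) kI (fun x => g x * y x) y (fun x => - sin x) (a + c * s) (b + d * s) x =
     - \int[mu]_(x in I1) kI (fun x => g x * y x) y sin (a + c * s) (b + d * s) x)%R.
    rewrite -mulN1r -RintegralZl//.
      by apply: eq_Rintegral => x _; rewrite /kI; ring.
    apply: (@integrable_kI _ _ _ _ _ (2 * K)) => //; [by rewrite mulr_ge0| |exact: nicet_sin|].
      by apply: measurable_funM => //; have [] := ny.
    move=> x x1; rewrite normrM; have /andP[y1 y2] := ny.2 x x1.
    have y0 : 0 <= y x by rewrite (le_trans _ y1)// (le_trans _ x1).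
    by rewrite (ger0_norm y0) -mulrA mulrCA; apply: ler_pM => //; exact: gK.
  by rewrite /Rintegral; ring.
apply: has_der_eq.
  by apply: (kI_der _ _ K0 s0 mg ny nicet_sin nicet_cos) => // x; exact: is_derive_sin.
by rewrite /cJ !cE /= /Rintegral; ring.
Qed.

Lemma cJ_le g y A B (h : R -> R) : 0 <= A -> measurable_fun setT g -> nicey y ->
  mu.-integrable I1 (EFin \o h) -> (forall x, 1 <= x -> `|g x| * expR (- (A * x)) <= h x) ->
  cabs (cJ g y A B) <= 2 * Rintegral mu I1 h.
Proof.
move=> A0 mg ny ih gh; rewrite (le_trans (cabs_le_ReIm _))//= mulr_natl mulr2n.
apply: lerD; (apply: Rintegral_norm_le => //; first by apply: measurable_funTS;
  apply: measurable_kI => //; exact: nicet_cos || exact: nicet_sin);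
  move=> x x1; apply: le_trans (gh x x1); apply: kI_le => //; exact: nicet_cos || exact: nicet_sin.
Qed.

End LaplaceIntegrals.

(** * Integral forms of K_0 and K_1 *)

Section MacdonaldIntegrals.
Variable R : realType.
Local Notation C := R[i].
Local Notation mu := (@lebesgue_measure R).
Local Notation I1 := `[(1 : R), +oo[%classic.
Hint Resolve measurable_I1 : core.
Implicit Types (g y t h : R -> R) (A B K a b s x : R).

Definition idR (x : R) : R := x.
(** The phase of the Macdonald integrals. The substitution [x -> 1/x] folds the half line from [0]
    onto [[1, +oo[]: with [w = A - i B], [cJ gV yK A B] is [K_0(2w)] and [cJ gE yK A B] is
    [2 K_1(2w)]. *)
Definition yK (x : R) : R := x + x^-1.
Definition gV (x : R) : R := x^-1.
Definition g1 (x : R) : R := 1.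
Definition gE (x : R) : R := 1 + x ^- 2.
(** Chosen so that [gE * yK = gQ + 4 gV]: the first term is removed by [cJ_ibp], the second brings
    back [K_0]. *)
Definition gQ (x : R) : R := (x - x^-1) * (1 - x ^- 2).

Lemma measurable_invX n : measurable_fun setT (fun x : R => x ^- n).
Proof. by apply: measurable_fun_invr; exact: exprn_measurable. Qed.

Lemma measurable_inv1 : measurable_fun setT (fun x : R => x^-1).
Proof. by apply: measurable_fun_invr; exact: measurable_id. Qed.

Lemma inv_le1 x : 1 <= x -> 0 < x^-1 <= 1.
Proof.
by move=> x1; rewrite invr_gt0 (lt_le_trans ltr01 x1)/= invf_le1// (lt_le_trans ltr01 x1).
Qed.

Lemma nicey_idR : nicey idR.
Proof.
split; first exact: measurable_id.
by move=> x x1; rewrite /idR lexx/=; lra.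
Qed.

Lemma nicey_yK : nicey yK.
Proof.
split; first by apply: measurable_funD; [exact: measurable_id|exact: measurable_inv1].
by move=> x x1; have /andP[? ?] := inv_le1 x1; rewrite /yK; apply/andP; split; lra.
Qed.

Lemma measurable_gV : measurable_fun setT gV. Proof. exact: measurable_inv1. Qed.
Lemma measurable_g1 : measurable_fun setT g1. Proof. exact: measurable_cst. Qed.
Lemma measurable_gE : measurable_fun setT gE.
Proof. by apply: measurable_funD; [exact: measurable_cst|exact: measurable_invX]. Qed.
Lemma measurable_gQ : measurable_fun setT gQ.
Proof.
apply: measurable_funM; apply: measurable_funB; rewrite ?invr1.
- exact: measurable_id.
- exact: measurable_inv1.
- exact: measurable_cst.
- exact: measurable_invX.
Qed.

Lemma invX2_le1 x : 1 <= x -> 0 < x ^- 2 <= 1.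
Proof.
move=> /inv_le1/andP[h1 h2]; rewrite -exprVn exprn_gt0//=.
by rewrite exprn_ile1// ltW.
Qed.

Lemma gV_le x : 1 <= x -> `|gV x| <= 1.
Proof. by move=> /inv_le1/andP[h1 h2]; rewrite /gV gtr0_norm. Qed.
Lemma g1_le x : 1 <= x -> `|g1 x| <= 1.
Proof. by rewrite /g1 normr1. Qed.
Lemma gE_le x : 1 <= x -> `|gE x| <= 2.
Proof.
by move=> /invX2_le1/andP[h1 h2]; rewrite /gE ger0_norm; lra.
Qed.
Lemma gQ_le x : 1 <= x -> `|gQ x| <= 1 * x.
Proof.
move=> x1; have /andP[h1 h2] := inv_le1 x1; have /andP[h3 h4] := invX2_le1 x1.
rewrite /gQ normrM mul1r -[leRHS]mulr1; apply: ler_pM => //.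
  by rewrite ger0_norm; lra.
by rewrite ger0_norm; lra.
Qed.

Lemma lin_le g K : 0 <= K -> (forall x, 1 <= x -> `|g x| <= K) ->
  forall x, 1 <= x -> `|g x| <= K * x.
Proof. by move=> K0 h x x1; rewrite (le_trans (h x x1))// ler_peMr. Qed.

Lemma cJ_ext g g' y A B : (forall x, 1 <= x -> g x = g' x) -> cJ g y A B = cJ g' y A B.
Proof.
move=> gg; rewrite /cJ; congr (_ +i* _); apply: eq_Rintegral => x;
  by rewrite inE I1E /kI => /gg ->.
Qed.

Lemma integrableZ K (F : R -> R) : mu.-integrable I1 (EFin \o F) ->
  mu.-integrable I1 (EFin \o (fun x => K * F x)).
Proof.
by move=> iF; have := @integrableZl _ _ _ mu I1 (@measurable_I1 R) K _ iF; exact: eq_integrable.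
Qed.

Lemma integrableDR (F G : R -> R) : mu.-integrable I1 (EFin \o F) ->
  mu.-integrable I1 (EFin \o G) -> mu.-integrable I1 (EFin \o (fun x => F x + G x)).
Proof.
by move=> iF iG; have := @integrableD _ _ _ mu I1 (@measurable_I1 R) _ _ iF iG; exact: eq_integrable.
Qed.

Lemma cJ_lin g g' y A B K K' k : 0 < A -> 0 <= K -> 0 <= K' -> nicey y ->
  measurable_fun setT g -> measurable_fun setT g' ->
  (forall x, 1 <= x -> `|g x| <= K * x) -> (forall x, 1 <= x -> `|g' x| <= K' * x) ->
  cJ (fun x => g x + k * g' x) y A B = cJ g y A B + k%:C * cJ g' y A B.
Proof.
move=> A0 K0 K'0 ny mg mg' gK gK'.
have H t : nicet t -> Rintegral mu I1 (kI (fun x => g x + k * g' x) y t A B) =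
    Rintegral mu I1 (kI g y t A B) + k * Rintegral mu I1 (kI g' y t A B).
  move=> nt.
  have i1 : mu.-integrable I1 (EFin \o kI g y t A B) by exact: (integrable_kI _ A0 K0).
  have i2 : mu.-integrable I1 (EFin \o kI g' y t A B) by exact: (integrable_kI _ A0 K'0).
  rewrite -(@RintegralZl _ _ _ mu I1 _ _ (@measurable_I1 R) i2).
  rewrite -(@RintegralD _ _ _ mu I1 _ _ (@measurable_I1 R) i1 (integrableZ k i2)).
  by apply: eq_Rintegral => x _; rewrite /kI; ring.
apply: ceqP; rewrite /cJ ?creD ?cimD ?creM ?cimM /=.
  by rewrite H ?mul0r ?subr0//; exact: nicet_cos.
by rewrite H ?mul0r ?addr0//; exact: nicet_sin.
Qed.

(** Used for replacing the phase [x + 1/x] by [x] when the parameter is small. *)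
Lemma cJ_dist g g' y y' A B K K' (h : R -> R) : 0 < A -> 0 <= K -> 0 <= K' ->
  nicey y -> nicey y' -> measurable_fun setT g -> measurable_fun setT g' ->
  (forall x, 1 <= x -> `|g x| <= K * x) -> (forall x, 1 <= x -> `|g' x| <= K' * x) ->
  mu.-integrable I1 (EFin \o h) ->
  (forall x, 1 <= x -> cabs ((g x)%:C * ce (A * y x) (B * y x) -
     (g' x)%:C * ce (A * y' x) (B * y' x)) <= h x) ->
  cabs (cJ g y A B - cJ g' y' A B) <= 2 * Rintegral mu I1 h.
Proof.
move=> A0 K0 K'0 ny ny' mg mg' gK gK' ih hh.
have H t : nicet t -> (forall x, 1 <= x -> `|kI g y t A B x - kI g' y' t A B x| <= h x) ->
    `|Rintegral mu I1 (kI g y t A B) - Rintegral mu I1 (kI g' y' t A B)| <= Rintegral mu I1 h.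
  move=> nt hx.
  have i1 : mu.-integrable I1 (EFin \o kI g y t A B) by exact: (integrable_kI _ A0 K0).
  have i2 : mu.-integrable I1 (EFin \o kI g' y' t A B) by exact: (integrable_kI _ A0 K'0).
  rewrite -(@RintegralB _ _ _ mu I1 _ _ (@measurable_I1 R) i1 i2).
  apply: Rintegral_norm_le => //.
  by apply: measurable_funTS; apply: measurable_funB; exact: measurable_kI.
rewrite (le_trans (cabs_le_ReIm _))// mulr_natl mulr2n creB cimB lerD//=.
  apply: H; first exact: nicet_cos.
  move=> x x1; apply: le_trans (hh x x1); apply: le_trans (Re_le_cabs _).
  by rewrite /kI /ce creB !creM /= !mul0r !subr0.
apply: H; first exact: nicet_sin.
move=> x x1; apply: le_trans (hh x x1); apply: le_trans (Im_le_cabs _).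
by rewrite /kI /ce cimB !cimM /= !mul0r !addr0.
Qed.

Lemma cvg_expRN_dom (F : R -> R) A K : 0 < A ->
  (forall x, 1 <= x -> `|F x| <= K * expR (- (A * x))) -> F x @[x --> +oo] --> (0 : R).
Proof.
move=> A0 FK; apply/cvgr0Pnorm_le => e e0.
have h : K * expR (- (A * x)) @[x --> +oo] --> (0 : R).
  by rewrite -(mulr0 K); apply: cvgMr; exact: cvg_expRN_pinfty.
near=> x.
have x1 : 1 <= x by near: x; exact: nbhs_pinfty_ge.
rewrite (le_trans (FK _ x1))// (le_trans (ler_norm _))//.
by near: x; move/cvgr0_norm_le : h; apply.
Unshelve. all: by end_near. Qed.

Lemma cJ_exp A B : 0 < A -> (A -i* B) * cJ g1 idR A B = ce A B.
Proof.
move=> A0.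
have i t : nicet t -> mu.-integrable I1 (EFin \o kI g1 idR t A B).
  move=> nt; apply: (@integrable_kI _ _ _ _ _ _ 1) => //; [exact: measurable_g1|exact: nicey_idR|].
  by apply: lin_le => //; exact: g1_le.
have b t x : nicet t -> 1 <= x -> `|kI g1 idR t A B x| <= 1 * expR (- (A * x)).
  move=> nt x1; rewrite (le_trans (kI_le _ _ (ltW A0) nicey_idR nt x1))//.
  by rewrite /g1 normr1.
have ic := i _ (nicet_cos R); have is_ := i _ (nicet_sin R).
have h1 : A * Rintegral mu I1 (kI g1 idR cos A B) + B * Rintegral mu I1 (kI g1 idR sin A B)
   = expR (- A) * cos B.
  rewrite -(@RintegralZl _ _ _ mu I1 _ _ (@measurable_I1 R) ic) -(@RintegralZl _ _ _ mu I1 _ _ (@measurable_I1 R) is_).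
  rewrite -(@RintegralD _ _ _ mu I1 _ _ (@measurable_I1 R) (integrableZ A ic) (integrableZ B is_)).
  rewrite (@FTC_I1 _ _ (fun x => - (expR (- (A * x)) * cos (B * x))) A (`|A| + `|B|) 0)//.
  - by rewrite sub0r opprK !mulr1.
  - move=> x x1; rewrite (le_trans (ler_normD _ _))// mulrDl !normrM lerD// ler_wpM2l//.
      by have := b _ _ (nicet_cos R) x1; rewrite /kI mul1r !normrM.
    by have := b _ _ (nicet_sin R) x1; rewrite /kI mul1r !normrM.
  - by move=> x x0; rewrite /kI /g1 /idR; apply: der_continuous; der.
  - move=> x x0; rewrite /kI /g1 /idR; apply: has_der_eq; first by der.
    by rewrite /=; ring.
  - apply: (@cvg_expRN_dom _ A 1) => // x x1; rewrite normrN.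
    by have := b _ _ (nicet_cos R) x1; rewrite /kI /g1 mul1r.
have h2 : A * Rintegral mu I1 (kI g1 idR sin A B) + - B * Rintegral mu I1 (kI g1 idR cos A B)
   = expR (- A) * sin B.
  rewrite -(@RintegralZl _ _ _ mu I1 _ _ (@measurable_I1 R) ic) -(@RintegralZl _ _ _ mu I1 _ _ (@measurable_I1 R) is_).
  rewrite -(@RintegralD _ _ _ mu I1 _ _ (@measurable_I1 R) (integrableZ A is_) (integrableZ (- B) ic)).
  rewrite (@FTC_I1 _ _ (fun x => - (expR (- (A * x)) * sin (B * x))) A (`|A| + `|B|) 0)//.
  - by rewrite sub0r opprK !mulr1.
  - move=> x x1; rewrite (le_trans (ler_normD _ _))// mulrDl !normrM normrN lerD// ler_wpM2l//.
      by have := b _ _ (nicet_sin R) x1; rewrite /kI mul1r !normrM.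
    by have := b _ _ (nicet_cos R) x1; rewrite /kI mul1r !normrM.
  - by move=> x x0; rewrite /kI /g1 /idR; apply: der_continuous; der.
  - move=> x x0; rewrite /kI /g1 /idR; apply: has_der_eq; first by der.
    by rewrite /=; ring.
  - apply: (@cvg_expRN_dom _ A 1) => // x x1; rewrite normrN.
    by have := b _ _ (nicet_sin R) x1; rewrite /kI /g1 mul1r.
apply: ceqP; rewrite /cJ /ce ?creM ?cimM.
  by rewrite [RHS]/= -h1 /= /Rintegral; ring.
by rewrite [RHS]/= -h2 /= /Rintegral; ring.
Qed.

(** Integration by parts: [1 - x^-2] is the derivative of [yK], [gE] that of [x - 1/x], and
    [x - 1/x] vanishes at the endpoint [1]. This plays the role of Bessel's second order
    equation. *)
Lemma cJ_ibp A B : 0 < A -> (A -i* B) * cJ gQ yK A B = cJ gE yK A B.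
Proof.
move=> A0; have A20 : 0 < A / 2 by rewrite divr_gt0.
have gE' x : 1 <= x -> `|gE x| <= 2 * x by apply: lin_le => // z; exact: gE_le.
have iE t : nicet t -> mu.-integrable I1 (EFin \o kI gE yK t A B).
  move=> nt; apply: (@integrable_kI _ _ _ _ _ _ 2) => //; [exact: measurable_gE|exact: nicey_yK].
have iQ t : nicet t -> mu.-integrable I1 (EFin \o kI gQ yK t A B).
  move=> nt; apply: (@integrable_kI _ _ _ _ _ _ 1) => //; [exact: measurable_gQ|exact: nicey_yK|exact: gQ_le].
pose G t x := (x - x^-1) * (expR (- (A * yK x)) * t (B * yK x)).
have G0 t : nicet t -> G t x @[x --> +oo] --> (0 : R).
  move=> nt; apply: (@cvg_expRN_dom _ (A / 2) (1 * (2 / A))) => // x x1.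
  apply: (@kI_bound _ (fun x => x - x^-1)) => //; first exact: nicey_yK.
  have /andP[h1 h2] := inv_le1 x1.
  by rewrite ger0_norm; lra.
have main t t' : nicet t -> nicet t' ->
   (forall x, has_der t x (t' x)) -> (forall x, {for x, continuous t'}) ->
   Rintegral mu I1 (kI gE yK t A B) + - A * Rintegral mu I1 (kI gQ yK t A B)
   + B * Rintegral mu I1 (kI gQ yK t' A B) = 0.
  move=> nt nt' dt ct'.
  have q1 := integrableZ (- A) (iQ _ nt); have q2 := integrableZ B (iQ _ nt').
  rewrite -(@RintegralZl _ _ _ mu I1 _ _ (@measurable_I1 R) (iQ _ nt)).
  rewrite -(@RintegralZl _ _ _ mu I1 _ _ (@measurable_I1 R) (iQ _ nt')).
  rewrite -(@RintegralD _ _ _ mu I1 _ _ (@measurable_I1 R) (iE _ nt) q1).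
  rewrite -(@RintegralD _ _ _ mu I1 _ _ (@measurable_I1 R) (integrableDR (iE _ nt) q1) q2).
  rewrite (@FTC_I1 _ _ (G t) (A / 2) (2 * (2 / A) + `|A| * (1 * (2 / A)) + `|B| * (1 * (2 / A))) 0)//.
  - by rewrite /G invr1 subrr mul0r subr0.
  - move=> x x1; rewrite (le_trans (ler_normD _ _))// mulrDl lerD//; last first.
      rewrite normrM -[leRHS]mulrA ler_wpM2l//; apply: kI_bound => //; [exact: nicey_yK|exact: gQ_le].
    rewrite (le_trans (ler_normD _ _))// mulrDl lerD//.
      apply: kI_bound => //; [exact: nicey_yK|exact: gE'].
    rewrite normrM normrN -[leRHS]mulrA ler_wpM2l//; apply: kI_bound => //; [exact: nicey_yK|exact: gQ_le].
  - move=> x x0; have xn0 : x != 0 by rewrite gt_eqF.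
    have cy : {for x, continuous yK}.
      by rewrite /yK; apply: der_continuous; der.
    have ce_ : {for x, continuous (fun x => expR (- (A * yK x)))}.
      by rewrite /yK; apply: der_continuous; der.
    have cg1 : {for x, continuous gE}.
      by rewrite /gE; apply: der_continuous; der; rewrite expf_neq0.
    have cg2 : {for x, continuous gQ}.
      by rewrite /gQ; apply: der_continuous; der; rewrite ?expf_neq0.
    have cB : {for x, continuous (fun x => B * yK x)}.
      by apply: continuousM => //; exact: cst_continuous.
    have ctt : {for x, continuous (fun x => t (B * yK x))}.
      by apply: (continuous_comp cB); exact: (der_continuous (dt _)).
    have ctt' : {for x, continuous (fun x => t' (B * yK x))}.
      by apply: (continuous_comp cB); exact: ct'.
    rewrite /kI; apply: continuousD; first apply: continuousD.
    + by apply: continuousM => //; exact: continuousM.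
    + by apply: continuousM; [exact: cst_continuous|apply: continuousM => //; exact: continuousM].
    + by apply: continuousM; [exact: cst_continuous|apply: continuousM => //; exact: continuousM].
  - move=> x x0; have xn0 : x != 0 by rewrite gt_eqF.
    rewrite /G /kI /yK; apply: has_der_eq.
      apply: der_M; first by der.
      apply: der_M; first by der.
      by apply: (der_comp (h := t)); [exact: dt|der].
    by rewrite /= /gE /gQ; field.
  - exact: G0.
have h1 := main _ _ (nicet_cos R) (nicet_Nsin R) (fun x => is_derive_cos x)
  (fun x => continuousN (@continuous_sin R x)).
have h2 := main _ _ (nicet_sin R) (nicet_cos R) (fun x => is_derive_sin x) (@continuous_cos R).
have eN : Rintegral mu I1 (kI gQ yK (fun x => - sin x) A B) = - Rintegral mu I1 (kI gQ yK sin A B).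
  rewrite -mulN1r -(@RintegralZl _ _ _ mu I1 _ _ (@measurable_I1 R) (iQ _ (nicet_sin R))).
  by apply: eq_Rintegral => x _; rewrite /kI; ring.
rewrite eN in h1.
apply: ceqP; rewrite /cJ ?creM ?cimM /=; rewrite /Rintegral in h1 h2 *.
  by apply/eqP; rewrite -subr_eq0 -oppr_eq0 -[X in _ == X]h1; apply/eqP; ring.
by apply/eqP; rewrite -subr_eq0 -oppr_eq0 -[X in _ == X]h2; apply/eqP; ring.
Qed.

End MacdonaldIntegrals.

(** * Euler's constant and the exponential integral *)

Section EulerGamma.
Variable R : realType.
Local Notation C := R[i].
Local Notation mu := (@lebesgue_measure R).
Local Notation I1 := `[(1 : R), +oo[%classic.
Implicit Types (A B K a b s x : R).

(** The exponential integral [E_1(A)]. *)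
Definition tE (A : R) : R := Re (cJ (@gV R) (@idR R) A 0).

Lemma cJ_gV_id A B : 0 < A ->
  (A -i* B) * cJ (fun x => gV x * idR x) (@idR R) A B = ce A B.
Proof.
move=> A0; rewrite (@cJ_ext _ _ (@g1 R)); first exact: cJ_exp.
by move=> x x1; rewrite /gV /idR /g1 mulVf// gt_eqF// (lt_le_trans ltr01).
Qed.

Lemma tE_der A : 0 < A -> has_der tE A (- (expR (- A) / A)).
Proof.
move=> A0.
have A0' : 0 < 0 + 1 * A by rewrite add0r mul1r.
have [h _] : cderiv (fun s => cJ (@gV R) (@idR R) (0 + 1 * s) (0 + 0 * s)) A
    (- (1 -i* 0) * cJ (fun x => gV x * idR x) (@idR R) (0 + 1 * A) (0 + 0 * A)).
  apply: (cJ_der _ _ ler01 A0'); [exact: measurable_gV|exact: nicey_idR|exact: gV_le].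
rewrite (_ : tE = fun s => Re (cJ (@gV R) (@idR R) (0 + 1 * s) (0 + 0 * s))); last first.
  by apply/funext => s; rewrite /tE !add0r mul1r mul0r.
apply: (has_der_eq h); rewrite !add0r mul1r mul0r oppr0.
have /(congr1 (@complex.Re R)) := cJ_gV_id 0 A0.
rewrite /ce creM /= cos0 mulr1 oppr0 mul0r subr0 => <-.
by rewrite /Rintegral /=; field; rewrite gt_eqF.
Qed.

Lemma tE_le A : 0 < A -> `|tE A| <= 2 * (expR (- A) / A).
Proof.
move=> A0; rewrite (le_trans (Re_le_cabs _))//.
have -> : expR (- A) / A = Rintegral mu I1 (fun x => expR (- (A * x))).
  by rewrite /Rintegral integral_expRN.
apply: cJ_le; [exact: ltW|exact: measurable_gV|exact: nicey_idR|exact: integrable_expRN1|].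
move=> x x1; rewrite ler_piMl ?expR_ge0//; exact: gV_le.
Qed.

(** For [N = n], a primitive of [(1 - (1 - x/n)^n) / x]; its increase from [0] to [n] is the
    harmonic number [H_n]. *)
Definition qN (n N : nat) (x : R) : R :=
  - \sum_(j < N) (1 - x / n%:R) ^+ j.+1 / j.+1%:R.

Lemma qN_der n N x : (0 < n)%N ->
  has_der (qN n N) x ((\sum_(j < N) (1 - x / n%:R) ^+ j) / n%:R).
Proof.
move=> n0; elim: N => [|N IH].
  rewrite (_ : qN n 0 = fun=> 0); first by rewrite big_ord0 mul0r; exact: der_cst.
  by apply/funext => y; rewrite /qN big_ord0 oppr0.
rewrite (_ : qN n N.+1 = fun y => qN n N y + - ((1 - y / n%:R) ^+ N.+1 / N.+1%:R)); last first.
  by apply/funext => y; rewrite /qN big_ord_recr/= opprD.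
apply: has_der_eq; first by apply: der_D; [exact: IH|der].
rewrite big_ord_recr /= mulrDl; congr (_ + _).
by field; rewrite nat1r !pnatr_eq0 -lt0n n0.
Qed.

Lemma qN_der' n x : (0 < n)%N -> 0 < x ->
  has_der (qN n n) x ((1 - (1 - x / n%:R) ^+ n) / x).
Proof.
move=> n0 x0; apply: (has_der_eq (qN_der n x n0)).
have nn : (n%:R : R) != 0 by rewrite pnatr_eq0 -lt0n.
apply: (mulIf (lt0r_neq0 x0)); rewrite divfK ?gt_eqF//.
have := subrX1 (1 - x / n%:R) n.
rewrite (_ : 1 - x / n%:R - 1 = - (x / n%:R)); last by ring.
by move=> e; rewrite -[in RHS]opprB e; ring.
Qed.

Lemma qN0 n : qN n n 0 = - Defs.harmonic R n.
Proof.
rewrite /qN /Defs.harmonic big_add1 big_mkord; congr (- _); apply: eq_bigr => j _.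
by rewrite mul0r subr0 expr1n mul1r.
Qed.

Lemma qNn n : (0 < n)%N -> qN n n n%:R = 0.
Proof.
move=> n0; rewrite /qN big1 ?oppr0// => j _.
by rewrite mulfV ?pnatr_eq0 -?lt0n// subrr expr0n mul0r.
Qed.

(** With [z = x/n], one side is [1 - z <= e^-z]. The other is [e^-z (1 - z^2) <= 1 - z], because
    [1 + z <= e^z], followed by Bernoulli's inequality for [(1 - z^2)^n]. *)
Lemma exp_pow_bounds n x : (0 < n)%N -> 0 <= x <= n%:R ->
  0 <= expR (- x) - (1 - x / n%:R) ^+ n <= x ^+ 2 * expR (- x) / n%:R.
Proof.
move=> n0 /andP[x0 xn].
have n0' : 0 < (n%:R : R) by rewrite ltr0n.
have z0 : 0 <= x / n%:R by rewrite divr_ge0.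
have z1 : x / n%:R <= 1 by rewrite ler_pdivrMr// mul1r.
set z := x / n%:R in z0 z1 *.
have ex : expR (- x) = expR (- z) ^+ n.
  by rewrite -expRM_natr; congr expR; rewrite /z; field; rewrite gt_eqF.
have h1 : (1 - z) ^+ n <= expR (- x).
  rewrite ex; apply: lerXn2r; rewrite ?nnegrE ?expR_ge0 ?subr_ge0//.
  exact: expR_ge1Dx.
have bern m (y : R) : 0 <= y <= 1 -> 1 - m%:R * y <= (1 - y) ^+ m.
  move=> /andP[y0 y1]; elim: m => [|m IH]; first by rewrite mul0r subr0 expr0.
  rewrite exprS; apply: (@le_trans _ _ ((1 - y) * (1 - m%:R * y))).
    rewrite -natr1; have m0 : 0 <= (m%:R : R) by [].
    have : 0 <= m%:R * y ^+ 2 by rewrite mulr_ge0// sqr_ge0.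
    by nra.
  by apply: ler_wpM2l => //; rewrite subr_ge0.
have h2 : expR (- x) * (1 - x ^+ 2 / n%:R) <= (1 - z) ^+ n.
  apply: (@le_trans _ _ ((expR (- z) * (1 - z ^+ 2)) ^+ n)).
    rewrite exprMn -ex; apply: ler_wpM2l; first exact: expR_ge0.
    have -> : x ^+ 2 / n%:R = n%:R * z ^+ 2 by rewrite /z; field; rewrite gt_eqF.
    by apply: bern; rewrite sqr_ge0/= exprn_ile1.
  apply: lerXn2r; rewrite ?nnegrE ?subr_ge0//.
    by rewrite mulr_ge0 ?expR_ge0// subr_ge0 exprn_ile1.
  rewrite expRN ler_pdivrMl ?expR_gt0//.
  have -> : 1 - z ^+ 2 = (1 + z) * (1 - z) by ring.
  by apply: ler_wpM2r; [rewrite subr_ge0|exact: expR_ge1Dx].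
by apply/andP; split; [rewrite subr_ge0|nra].
Qed.

(** The derivative of [tE + ln - qN n n] is [((1 - x/n)^n - e^-x) / x], which [exp_pow_bounds]
    controls. In [3/n], one part bounds the integral of [x e^-x / n] and two bound [tE n]; the
    summand [A] bounds the increase of [qN] on [[0, A]]. *)
Lemma tE_harmonic n A : (0 < n)%N -> 0 < A <= n%:R ->
  `|tE A + ln A + (Defs.harmonic R n - ln n%:R)| <= A + 3 / n%:R.
Proof.
move=> n0 /andP[A0 An].
have n1 : 1 <= (n%:R : R) by rewrite ler1n.
have n0' : 0 < (n%:R : R) by rewrite ltr0n.
pose f x := tE x + ln x + - qN n n x.
have fd x : A <= x <= n%:R -> has_der f x (((1 - x / n%:R) ^+ n - expR (- x)) / x).
  move=> /andP[Ax xn]; have x0 : 0 < x by exact: lt_le_trans Ax.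
  apply: has_der_eq.
    apply: der_D; last by apply: der_N; exact: qN_der'.
    apply: der_D; first exact: tE_der.
    by apply: (@der_ln _ id x 1) => //; exact: der_id.
  by rewrite /=; field; rewrite !gt_eqF.
have f1 : f n%:R - f A <= 0 - 0.
  apply: (@der_le _ f (fun=> 0) _ (fun=> 0) _ _ An fd) => x xab; first exact: der_cst.
  have x0 : 0 < x by have /andP[h _] := xab; exact: lt_le_trans h.
  have /andP[h _] : 0 <= expR (- x) - (1 - x / n%:R) ^+ n <= x ^+ 2 * expR (- x) / n%:R.
    by apply: exp_pow_bounds => //; rewrite ltW//=; have /andP[] := xab.
  by rewrite pmulr_lle0 ?invr_gt0//; lra.
have f2 : (n%:R + 1) * expR (- n%:R) / n%:R - (A + 1) * expR (- A) / n%:R <= f n%:R - f A.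
  apply: (@der_le _ (fun x => (x + 1) * expR (- x) / n%:R) f (fun x => - (x * expR (- x) / n%:R)) _ _ _ An _ fd).
    move=> x _; apply: has_der_eq; first by der.
    by rewrite /=; field; rewrite gt_eqF.
  move=> x xab.
  have x0 : 0 < x by have /andP[h _] := xab; exact: lt_le_trans h.
  have /andP[_ h] : 0 <= expR (- x) - (1 - x / n%:R) ^+ n <= x ^+ 2 * expR (- x) / n%:R.
    by apply: exp_pow_bounds => //; rewrite ltW//=; have /andP[] := xab.
  rewrite ler_pdivlMr//.
  have -> : - (x * expR (- x) / n%:R) * x = - (x ^+ 2 * expR (- x) / n%:R) by ring.
  by lra.
have g1 : 0 <= (n%:R + 1) * expR (- (n%:R : R)) / n%:R.
  by rewrite !mulr_ge0 ?expR_ge0 ?invr_ge0 ?addr_ge0 // ltW.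
have g2 : (A + 1) * expR (- A) / n%:R <= 1 / n%:R.
  apply: ler_wpM2r; first by rewrite invr_ge0 ltW.
  by rewrite expRN ler_pdivrMr ?expR_gt0// mul1r addrC expR_ge1Dx.
have tn : `|tE n%:R| <= 2 / n%:R.
  by rewrite (le_trans (tE_le n0'))// ler_wpM2l// ler_piMl ?invr_ge0 ?(ltW n0')//.
have qA : `|qN n n A - qN n n 0| <= 1 * (A - 0).
  apply: (@der_norm_le _ _ _ 1 0 A (ltW A0) (fun x _ => qN_der n x n0)) => x /andP[x0 xA].
  have z0 : 0 <= x / n%:R by rewrite divr_ge0// ltW.
  have z1 : x / n%:R <= 1 by rewrite ler_pdivrMr// mul1r (le_trans xA)//.
  rewrite ger0_norm; last first.
    rewrite divr_ge0 ?(ltW n0')// sumr_ge0// => j _.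
    by rewrite exprn_ge0// subr_ge0.
  rewrite ler_pdivrMr// mul1r -[leRHS](_ : \sum_(j < n) 1 = n%:R); last first.
    by rewrite sumr_const card_ord.
  apply: ler_sum => j _; rewrite exprn_ile1// ?subr_ge0//.
  by rewrite lerBlDr lerDl.
rewrite qN0 subr0 mul1r opprK in qA.
have fn : f n%:R = tE n%:R + ln n%:R by rewrite /f qNn// oppr0 addr0.
rewrite fn in f1 f2; rewrite /f in f1 f2.
move: qA tn; rewrite !ler_norml => /andP[q1 q2] /andP[t1 t2].
clear -f1 f2 g1 g2 q1 q2 t1 t2.
by apply/andP; split; lra.
Qed.

(** [euler_gamma] is a [limn], so its convergence is owed. By [tE_harmonic] the sequence ends up
    within [A + 3/n] of the fixed number [-(tE A + ln A)], with [A] as small as desired: it is a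
    Cauchy sequence. *)
Lemma cvg_euler_gamma :
  (fun n => Defs.harmonic R n - ln n%:R : R) @ \oo --> euler_gamma R.
Proof.
suff : cvgn (fun n => Defs.harmonic R n - ln n%:R : R) by [].
apply/cauchy_cvgP/cauchy_exP => e e0.
(* The bound [1] ensures [A <= n + 1], as [tE_harmonic] requires. *)
pose A := Num.min 1 (e / 4).
have A0 : 0 < A <= 1 by rewrite /A lt_min ltr01 divr_gt0//= ge_min lexx.
exists (- (tE A + ln A)).
have [/= N _ hN] : \forall n \near \oo, 3 / n.+1%:R < e / 2.
  have : (3 : R) * (n.+1%:R)^-1 @[n --> \oo] --> 3 * (0 : R).
    by apply: cvgMr; exact: cvg_harmonic.
  rewrite mulr0 => /cvgr0_norm_lt/(_ (e / 2) ltac:(by rewrite divr_gt0)).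
  apply: filterS => n; apply: le_lt_trans; exact: ler_norm.
exists N.+1 => //= -[//|n] /= Nn; rewrite /ball /= -opprD normrN.
have A0n : 0 < A <= n.+1%:R.
  by have /andP[-> h] := A0; rewrite (le_trans h)// ler1n.
apply: (le_lt_trans (tE_harmonic (ltn0Sn n) A0n)).
have A4 : A <= e / 4 by rewrite /A ge_min lexx orbT.
have : 3 / n.+1%:R < e / 2 by exact: hN.
by move=> h; apply: (le_lt_trans (lerD A4 (ltW h))); lra.
Qed.

Lemma tE_gamma A : 0 < A -> `|tE A + ln A + euler_gamma R| <= A.
Proof.
move=> A0.
have h : `|tE A + ln A + (Defs.harmonic R n - ln n%:R)| @[n --> \oo] -->
   `|tE A + ln A + euler_gamma R|.
  by apply: cvg_norm; apply: cvgD; [exact: cvg_cst|exact: cvg_euler_gamma].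
have h' : A + 3 / n%:R @[n --> \oo] --> A + 3 * (0 : R).
  apply: cvgD; first exact: cvg_cst.
  apply: cvgMr; rewrite -cvg_shiftS; exact: cvg_harmonic.
rewrite mulr0 addr0 in h'.
apply: (ler_cvg_to h h'); exists (Num.truncn A).+1 => // n /= nA.
apply: tE_harmonic; first exact: leq_ltn_trans nA.
by rewrite A0/= ltW// (lt_le_trans (truncnS_gt A))// ler_nat.
Qed.

End EulerGamma.

(** * The integral solution of the system and its behaviour at 0 *)

Section MacdonaldSystem.
Variable R : realType.
Local Notation C := R[i].
Local Notation mu := (@lebesgue_measure R).
Local Notation I1 := `[(1 : R), +oo[%classic.
Implicit Types (A B K a b s x : R).
Variables (c d : R).
Hypotheses (c0 : 0 < c) (d0 : 0 < d).

(** [Lam e] is the principal logarithm of [wc e]. The imaginary part is a variable because [T_asym]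
    moves it from [0] to [d]. *)
Definition wc (e : R) : C := c -i* e.
Definition Lam (e : R) : C := (ln (c ^+ 2 + e ^+ 2) / 2) -i* (atan (e / c)).

Lemma wc_norm2 e : 0 < c ^+ 2 + e ^+ 2.
Proof. by rewrite ltr_pwDl ?sqr_ge0// exprn_gt0. Qed.

Lemma wc_neq0 e : wc e != 0.
Proof. by rewrite /wc eq_complex /= negb_and gt_eqF. Qed.

Lemma Lam_der e : cderiv Lam e (- 'i / wc e).
Proof.
have n0 := lt0r_neq0 (wc_norm2 e); have cn0 := lt0r_neq0 c0.
split.
  rewrite /Lam /=; apply: has_der_eq; first by der; exact: wc_norm2.
  by rewrite /= sqrrN; field; rewrite n0.
rewrite /Lam /=; apply: has_der_eq; first by der.
by rewrite /= sqrrN; field; rewrite n0 cn0.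
Qed.

Lemma T_der s e : 0 < s ->
  cderiv (fun e => cJ (@gV R) (@idR R) (c * s) (e * s) + Lam e) e
    ('i * (ce (c * s) (e * s) - 1) / wc e).
Proof.
move=> s0; have cs0 : 0 < c * s by rewrite mulr_gt0.
have cs0' : 0 < c * s + 0 * e by rewrite mul0r addr0.
have h1 : cderiv (fun e => cJ (@gV R) (@idR R) (c * s + 0 * e) (0 + s * e)) e
    (- (0 -i* s) * cJ (fun x => gV x * idR x) (@idR R) (c * s + 0 * e) (0 + s * e)).
  by apply: (cJ_der _ _ ler01 cs0'); [exact: measurable_gV|exact: nicey_idR|exact: gV_le].
rewrite (_ : (fun e => _) = fun e => cJ (@gV R) (@idR R) (c * s + 0 * e) (0 + s * e) + Lam e); last first.
  by apply/funext => e'; rewrite mul0r addr0 add0r (mulrC s).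
apply: cderiv_eq; first exact: (cderivD h1 (Lam_der e)).
rewrite mul0r addr0 add0r.
have := cJ_gV_id (s * e) cs0.
have -> : c * s -i* (s * e) = s%:C * wc e.
  by apply: ceqP; rewrite /wc ?creM ?cimM /=; ring.
move=> h; rewrite (mulrC e s) -h.
have -> : - (0 -i* s) = 'i * s%:C by apply: ceqP; rewrite ?creM ?cimM ?creN ?cimN /=; ring.
by field; rewrite wc_neq0.
Qed.

(** [E_1(w s) + log w] is compared with its value at the real point [c], known from [tE_gamma],
    along the vertical segment from [c] to [c - i d]. By [T_der] the derivative there is
    [i (e^(-w s) - 1) / w], of modulus at most [3 s]. *)
Lemma T_asym s : 0 < s ->
  cabs (cJ (@gV R) (@idR R) (c * s) (d * s) + Lam d + (ln s + euler_gamma R)%:C)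
    <= c * s + 6 * d * s.
Proof.
move=> s0; have cs0 : 0 < c * s by rewrite mulr_gt0.
pose f e := cJ (@gV R) (@idR R) (c * s) (e * s) + Lam e.
pose f' e := 'i * (ce (c * s) (e * s) - 1) / wc e.
have fd e : cderiv f e (f' e) by exact: T_der.
have fb e : 0 <= e <= d -> cabs (f' e) <= 3 * s.
  move=> /andP[e0 ed]; rewrite /f' !cabsM cabsi mul1r cabsV.
  have w0 : 0 < cabs (wc e) by rewrite cabs_gt0 wc_neq0.
  rewrite ler_pdivrMr//.
  rewrite (le_trans (ce_sub1 _ (ltW cs0)))// ger0_norm ?mulr_ge0 ?(ltW s0)//.
  have h1 : c <= cabs (wc e) by rewrite (le_trans _ (Re_le_cabs _))// ler_norm.
  have h2 : e <= cabs (wc e) by rewrite (le_trans _ (Im_le_cabs _))//= normrN ler_norm.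
  have := ler_wpM2r (ltW s0) h1; have := ler_wpM2r (ltW s0) h2.
  by lra.
have b1 : `|Re (f d) - Re (f 0)| <= 3 * s * (d - 0).
  apply: (@der_norm_le _ (fun e => Re (f e)) (fun e => Re (f' e)) (3 * s) 0 d); first exact: ltW.
    by move=> x _; have [] := fd x.
  by move=> x xd; rewrite (le_trans (Re_le_cabs _))// fb.
have b2 : `|Im (f d) - Im (f 0)| <= 3 * s * (d - 0).
  apply: (@der_norm_le _ (fun e => Im (f e)) (fun e => Im (f' e)) (3 * s) 0 d); first exact: ltW.
    by move=> x _; have [] := fd x.
  by move=> x xd; rewrite (le_trans (Im_le_cabs _))// fb.
have b3 : cabs (f d - f 0) <= 6 * d * s.
  rewrite (le_trans (cabs_le_ReIm _))// creB cimB; lra.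
have f0 : f 0 = (tE (c * s) + ln c)%:C.
  apply: ceqP; rewrite /f mul0r.
    rewrite creD /Lam /= expr0n addr0 /tE; congr (_ + _).
    by rewrite lnXn// mulr2n; field.
  rewrite cimD /Lam /= mul0r atan0 oppr0 addr0.
  rewrite /Rintegral (eq_integral (fun=> 0%E)) ?integral0// => x _.
  by rewrite /kI mul0r sin0 !mulr0.
have -> : f d + (ln s + euler_gamma R)%:C = (f d - f 0) +
    (tE (c * s) + ln (c * s) + euler_gamma R)%:C.
  rewrite f0 lnM//; apply: ceqP; rewrite ?creD ?cimD ?creN ?cimN /=; ring.
rewrite (le_trans (cabsD _ _))// addrC lerD// cabsC.
exact: tE_gamma.
Qed.

(** With [w = c - i d], these are [K_0(2ws)] and [2ws K_1(2ws)]. Multiplying [K_1] by its argument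
    removes the pole: [Ei] tends to [1] at [0]. *)
Definition K0i (s : R) : C := cJ (@gV R) (@yK R) (c * s) (d * s).
Definition Ei (s : R) : C := wc d * s%:C * cJ (@gE R) (@yK R) (c * s) (d * s).

Lemma cs_w s : (c * s) -i* (d * s) = wc d * s%:C.
Proof. by apply: ceqP; rewrite /wc ?creM ?cimM /=; ring. Qed.

Lemma sC_neq0 s : 0 < s -> (s%:C : C) != 0.
Proof. by move=> s0; rewrite eq_complex /= negb_and gt_eqF. Qed.

Lemma K0i_der s : 0 < s -> cderiv K0i s (- (Ei s / s%:C)).
Proof.
move=> s0; have cs0 : 0 < 0 + c * s by rewrite add0r mulr_gt0.
have h1 : cderiv (fun s => cJ (@gV R) (@yK R) (0 + c * s) (0 + d * s)) s
    (- (c -i* d) * cJ (fun x => gV x * yK x) (@yK R) (0 + c * s) (0 + d * s)).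
  by apply: (cJ_der _ _ ler01 cs0); [exact: measurable_gV|exact: nicey_yK|exact: gV_le].
rewrite (_ : K0i = fun s => cJ (@gV R) (@yK R) (0 + c * s) (0 + d * s)); last first.
  by apply/funext => s'; rewrite !add0r.
apply: (cderiv_eq h1); rewrite !add0r /Ei.
rewrite (@cJ_ext _ (fun x => gV x * yK x) (@gE R)); last first.
  move=> x x1; have x0 : x != 0 by rewrite gt_eqF// (lt_le_trans ltr01).
  by rewrite /gV /yK /gE; field.
by rewrite -/(wc d); field; exact: sC_neq0.
Qed.

Lemma Ei_der s : 0 < s -> cderiv Ei s (- (4 * wc d ^+ 2 * s%:C * K0i s)).
Proof.
move=> s0; have cs0 : 0 < 0 + c * s by rewrite add0r mulr_gt0.
have h1 : cderiv (fun s => cJ (@gE R) (@yK R) (0 + c * s) (0 + d * s)) s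
    (- (c -i* d) * cJ (fun x => gE x * yK x) (@yK R) (0 + c * s) (0 + d * s)).
  by apply: (cJ_der _ _ (ler0n R 2) cs0); [exact: measurable_gE|exact: nicey_yK|exact: gE_le].
have h2 : cderiv (fun s => wc d * s%:C) s (0 * s%:C + wc d * 1%:C).
  by apply: cderivM; [exact: cderiv_cst|apply: cderivC; exact: der_id].
rewrite (_ : Ei = fun s => wc d * s%:C * cJ (@gE R) (@yK R) (0 + c * s) (0 + d * s)); last first.
  by apply/funext => s'; rewrite !add0r.
apply: cderiv_eq; first exact: (cderivM h2 h1).
rewrite !add0r in cs0 *; rewrite mul0r add0r mulr1.
rewrite (@cJ_ext _ (fun x => gE x * yK x) (fun x => gQ x + 4 * gV x)); last first.
  move=> x x1; have x0 : x != 0 by rewrite gt_eqF// (lt_le_trans ltr01).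
  by rewrite /gV /yK /gE /gQ; field.
rewrite (@cJ_lin _ (@gQ R) (@gV R) _ _ _ 1 1)//; last first.
- by apply: lin_le => //; exact: gV_le.
- exact: gQ_le.
- exact: measurable_gV.
- exact: measurable_gQ.
- exact: nicey_yK.
rewrite -/(wc d) -/(K0i s) -(cJ_ibp (d * s) cs0) cs_w.
have -> : (4 : R)%:C = (4 : C) by rewrite rmorph_nat.
by ring.
Qed.

(** Replacing the phase [x + 1/x] by [x] costs [O(s/x)]; with the weight [1/x] the error is
    [O(s) x^-2], which is integrable. What remains is [E_1(w s)], estimated in [T_asym]. *)
Lemma K0i_asym s : 0 < s ->
  cabs (K0i s + Lam d + (ln s + euler_gamma R)%:C) <= (3 * c + 10 * d) * s.
Proof.
move=> s0; have cs0 : 0 < c * s by rewrite mulr_gt0.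
have ds0 : 0 < d * s by rewrite mulr_gt0.
have [ih hE] := integral_sqrV R.
pose M := c * s + 2 * (d * s).
have h : cabs (K0i s - cJ (@gV R) (@idR R) (c * s) (d * s)) <= 2 * M.
  have e : Rintegral mu I1 (fun x => M * x ^- 2) = M.
    by rewrite (@RintegralZl _ _ _ mu I1 _ _ (@measurable_I1 R) ih) hE mulr1.
  rewrite -[in leRHS]e; apply: (@cJ_dist _ _ _ _ _ _ _ 1 1) => //.
  - exact: nicey_yK.
  - exact: nicey_idR.
  - exact: measurable_gV.
  - exact: measurable_gV.
  - by apply: lin_le => //; exact: gV_le.
  - by apply: lin_le => //; exact: gV_le.
  - exact: integrableZ.
  move=> x x1; have /andP[x0 x1'] := inv_le1 x1.
  rewrite -mulrBr cabsM cabsC /yK /idR !mulrDr ceD.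
  rewrite -[X in _ * cabs (_ - X)]mulr1 -mulrBr cabsM cabs_ce /gV (gtr0_norm x0).
  have e1 : expR (- (c * s * x)) <= 1.
    by rewrite -[leRHS]expR0 ler_expR oppr_le0 mulr_ge0 ?(ltW cs0)// (le_trans _ x1).
  have e2 := ce_sub1 (d * s / x) (mulr_ge0 (ltW cs0) (ltW x0)).
  rewrite (ger0_norm (mulr_ge0 (ltW ds0) (ltW x0))) in e2.
  rewrite (_ : M * x ^- 2 = x^-1 * (1 * (c * s / x + 2 * (d * s / x)))); last first.
    by rewrite /M; field; rewrite gt_eqF// (lt_le_trans ltr01).
  apply: ler_wpM2l; first exact: ltW.
  by apply: ler_pM => //; exact: cabs_ge0.
have -> : K0i s + Lam d + (ln s + euler_gamma R)%:C =
  (K0i s - cJ (@gV R) (@idR R) (c * s) (d * s)) +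
  (cJ (@gV R) (@idR R) (c * s) (d * s) + Lam d + (ln s + euler_gamma R)%:C) by ring.
rewrite (le_trans (cabsD _ _))//.
have := T_asym s0; move: h; rewrite /M => h1 h2.
by rewrite (le_trans (lerD h1 h2))//; lra.
Qed.

(** For the phase [x] and the weight [1], the integral times [w s] is exactly [e^(-w s)], by
    [cJ_exp]. The error integral stays bounded as [s] tends to [0], since [s] times the integral of
    [e^(-c s x)] does, and the factor [w s] makes it [O(s)]. *)
Lemma Ei_asym s : 0 < s ->
  cabs (Ei s - 1) <= (cabs (wc d) * (2 * ((c + 2 * d) / c + 1)) + (c + 2 * d)) * s.
Proof.
move=> s0; have cs0 : 0 < c * s by rewrite mulr_gt0.
have ds0 : 0 < d * s by rewrite mulr_gt0.
have [ih hE] := integral_sqrV R.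
pose M := c * s + 2 * (d * s).
have M0 : 0 <= M by rewrite /M addr_ge0 ?mulr_ge0// ltW.
have h : cabs (cJ (@gE R) (@yK R) (c * s) (d * s) - cJ (@g1 R) (@idR R) (c * s) (d * s))
    <= 2 * ((c + 2 * d) / c + 1).
  have ie : mu.-integrable I1 (EFin \o (fun x => expR (- (c * s * x)))).
    exact: integrable_expRN1.
  have e : Rintegral mu I1 (fun x => M * expR (- (c * s * x)) + x ^- 2) <= (c + 2 * d) / c + 1.
    rewrite (@RintegralD _ _ _ mu I1 _ _ (@measurable_I1 R) (integrableZ M ie) ih) hE.
    rewrite (@RintegralZl _ _ _ mu I1 _ _ (@measurable_I1 R) ie) lerD2r.
    rewrite /Rintegral integral_expRN//=.
    rewrite (_ : M * (expR (- (c * s)) / (c * s)) = (c + 2 * d) / c * expR (- (c * s))); last first.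
      by rewrite /M; field; rewrite !gt_eqF.
    rewrite ler_piMr//; first by rewrite divr_ge0 ?addr_ge0 ?mulr_ge0// ltW.
    by rewrite -[leRHS]expR0 ler_expR oppr_le0 ltW.
  apply: le_trans (ler_wpM2l (ler0n R 2) e).
  apply: (@cJ_dist _ _ _ _ _ _ _ 2 1) => //.
  - exact: nicey_yK.
  - exact: nicey_idR.
  - exact: measurable_gE.
  - exact: measurable_g1.
  - by apply: lin_le => //; exact: gE_le.
  - by apply: lin_le => //; exact: g1_le.
  - exact: (integrableDR (integrableZ M ie) ih).
  move=> x x1; have /andP[x0 x1'] := inv_le1 x1.
  have /andP[x2 x2'] := invX2_le1 x1.
  rewrite /yK /idR /g1 !mulrDr ceD.
  have e1 : expR (- (c * s * x)) <= 1.
    by rewrite -[leRHS]expR0 ler_expR oppr_le0 mulr_ge0 ?(ltW cs0)// (le_trans _ x1).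
  have e0 := expR_ge0 (- (c * s * x)).
  set E1 := ce (c * s * x) (d * s * x); set E2 := ce _ _.
  have -> : (gE x)%:C * (E1 * E2) - 1%:C * E1 = E1 * (E2 - 1) + (x ^- 2)%:C * (E1 * E2).
    have -> : (gE x)%:C = 1 + (x ^- 2)%:C :> C by rewrite /gE rmorphD.
    by ring.
  rewrite (le_trans (cabsD _ _))// lerD//.
    rewrite cabsM cabs_ce mulrC; apply: ler_wpM2r => //.
    rewrite (le_trans (ce_sub1 _ (mulr_ge0 (ltW cs0) (ltW x0))))//.
    rewrite (ger0_norm (mulr_ge0 (ltW ds0) (ltW x0))) /M lerD//.
      by rewrite ler_piMr// ltW.
    by rewrite ler_wpM2l// ler_piMr// ltW.
  rewrite !cabsM cabsC (gtr0_norm x2) !cabs_ce ler_piMr ?(ltW x2)//.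
  rewrite mulr_ile1 ?expR_ge0//.
  by rewrite -[leRHS]expR0 ler_expR oppr_le0 mulr_ge0 ?(ltW cs0)// ltW.
have -> : Ei s - 1 = wc d * s%:C * (cJ (@gE R) (@yK R) (c * s) (d * s) -
    cJ (@g1 R) (@idR R) (c * s) (d * s)) + (ce (c * s) (d * s) - 1).
  by rewrite /Ei -(cJ_exp (d * s) cs0) cs_w; ring.
rewrite (le_trans (cabsD _ _))// mulrDl lerD//.
  rewrite !cabsM cabsC (gtr0_norm s0) mulrAC.
  by apply: ler_wpM2r; [exact: ltW|apply: ler_wpM2l => //; exact: cabs_ge0].
rewrite (le_trans (ce_sub1 _ (ltW cs0)))// (gtr0_norm ds0).
by lra.
Qed.

End MacdonaldSystem.

(** * The series solution of the system *)

Section MacdonaldSeries.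
Variable R : realType.
Local Notation C := R[i].
Implicit Types (s x M B : R).

(** Coefficients of [I_0(2 sqrt q)]; [cPK] is the digamma series of [K_0]. The shifted [cX] and [cW]
    stand for [q] times the series of [cI] and [cP], so that [diffs_cX] and [diffs_cW] are
    identities between coefficients. *)
Definition cK (m : nat) : R := (m`!%:R * m`!%:R)^-1.
Definition cPK (m : nat) : R := psi_nat1 R m * cK m.
Definition cX (m : nat) : R := if m is m'.+1 then cI R m' else 0.
Definition cW (m : nat) : R := if m is m'.+1 then cP R m' else 0.

Lemma factV_le1 m : (m`!%:R : R)^-1 <= 1.
Proof. by rewrite invf_le1 ?fact_gt0R// ler1n fact_gt0. Qed.

Lemma fbound_cK : fbound 1 cK.
Proof.
split => // m; rewrite /cK ger0_norm ?invr_ge0 ?mulr_ge0// div1r invfM.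
by rewrite ler_piMr ?invr_ge0// factV_le1.
Qed.

Lemma natr_le_fact m : (m%:R : R) <= m`!%:R.
Proof. by rewrite ler_nat; case: m => // m; rewrite factS leq_pmulr// fact_gt0. Qed.

Lemma fbound_cPK : fbound (`|euler_gamma R| + 1) cPK.
Proof.
split; first by rewrite addr_ge0.
move=> m; rewrite /cPK normrM /cK [X in _ * X]ger0_norm ?invr_ge0 ?mulr_ge0// invfM mulrA.
apply: ler_wpM2r; first by rewrite invr_ge0.
rewrite ler_pdivrMr ?fact_gt0R// (le_trans (psi_nat1_le R m))//.
have f1 : 1 <= (m`!%:R : R) by rewrite ler1n fact_gt0.
have := natr_le_fact m; have := normr_ge0 (euler_gamma R).
by nra.
Qed.

Lemma fbound_cX : fbound 1 cX.
Proof.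
split => // -[|m] /=; first by rewrite normr0 fact0 divr1.
rewrite /cI ger0_norm ?invr_ge0 ?mulr_ge0// div1r invfM.
by rewrite ler_piMl ?invr_ge0// factV_le1.
Qed.

Lemma fbound_cW : fbound (2 * (2 * `|euler_gamma R| + 2)) cW.
Proof.
have g0 := normr_ge0 (euler_gamma R).
split; first by lra.
case=> [|m] /=; first by rewrite normr0 fact0 divr1; lra.
rewrite /cP normrM /cI [X in _ * X]ger0_norm ?invr_ge0 ?mulr_ge0// invfM mulrA.
apply: ler_wpM2r; first by rewrite invr_ge0.
rewrite ler_pdivrMr ?fact_gt0R//.
rewrite (le_trans (ler_normD _ _))//.
have f1 : 1 <= (m`!%:R : R) by rewrite ler1n fact_gt0.
have := natr_le_fact m; have := psi_nat1_le R m; have := psi_nat1_le R m.+1; rewrite -natr1.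
have : 0 <= (m%:R : R) by [].
by nra.
Qed.

Lemma facR_neq0 m : (m`!%:R : R) != 0. Proof. by rewrite gt_eqF// fact_gt0R. Qed.

Lemma diffs_cK : pseries_diffs cK = cI R.
Proof.
apply/funext => m; rewrite /pseries_diffs /cK /cI factS natrM.
by field; rewrite facR_neq0 nat1r pnatr_eq0.
Qed.

Lemma diffs_cX : pseries_diffs cX = cK.
Proof.
apply/funext => m; rewrite /pseries_diffs /cK /cX /cI factS natrM.
by field; rewrite facR_neq0 nat1r pnatr_eq0.
Qed.

Lemma diffs_cW : pseries_diffs cW = fun m => 2 * cPK m + cI R m.
Proof.
apply/funext => m; rewrite /pseries_diffs /cW /cP /cPK /cK /cI factS natrM psi_nat1S.
by field; rewrite facR_neq0 nat1r pnatr_eq0.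
Qed.

Lemma cps_near0 B c M (q : C) : fbound B c -> cabs q <= M ->
  cabs (cps c q - (c 0%N)%:C) <= 2 * (B * cabs q) * expR (M + 1).
Proof.
move=> cB qM; have M0 : 0 <= M by exact: le_trans (cabs_ge0 q) qM.
have := cps_lip cB qM (q' := 0); rewrite cabs0 => /(_ M0).
by rewrite (cps0 cB) subr0.
Qed.

Lemma cps_cX q : cps cX q = q * cps (cI R) q.
Proof. by rewrite (cps_shift _ fbound_cX) /= add0r. Qed.

Lemma cps_cW q : cps cW q = q * cps (cP R) q.
Proof. by rewrite (cps_shift _ fbound_cW) /= add0r. Qed.

(** Once the constant term [1] of [cK] is split off, the coefficients match by
    [psi(m + 2) = psi(m + 1) + 1/(m + 1)]. This is what turns the derivative of [K0s] into
    [- Es / s]. *)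
Lemma cps_cK_rec q : cps cK q - 2 * q * cps (pseries_diffs cPK) q = 1 - cps cW q.
Proof.
have cKS : fbound 1 (fun m => cK m.+1).
  have [_ cb] := fbound_cK; split => // m; rewrite (le_trans (cb _))//.
  by rewrite ler_wpM2l// lef_pV2 ?posrE ?fact_gt0R// ler_nat factS leq_pmull.
have e : cps (fun m => cK m.+1) q + cps (cP R) q = 2%:C * cps (pseries_diffs cPK) q.
  rewrite (cpsD _ cKS (fbound_cP R)) (cps_real_scale _ _ (fbound_diffs fbound_cPK)).
  congr (cps _ q); apply/funext => m.
  rewrite /cK /cP /cI /pseries_diffs /cPK /cK factS natrM psi_nat1S.
  by field; rewrite facR_neq0 nat1r pnatr_eq0.
rewrite (cps_shift _ fbound_cK) cps_cW /cK fact0 mulr1 invr1.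
have -> : 2 * q * cps (pseries_diffs cPK) q = q * (2%:C * cps (pseries_diffs cPK) q).
  by rewrite (_ : 2%:C = 2 :> C); [ring|rewrite rmorph_nat].
by rewrite -e; ring.
Qed.

Variables (w Lw : C).

(** With [Lw] a logarithm of [w], [K0s] and [Es] are the classical series of [K_0(2ws)] and
    [2ws K_1(2ws)]; their argument is [w^2 s^2]. *)
Definition qs s : C := w ^+ 2 * (s ^+ 2)%:C.
Definition Es s : C := 1 + 2 * ((ln s)%:C + Lw) * cps cX (qs s) - cps cW (qs s).
Definition K0s s : C := - (((ln s)%:C + Lw) * cps cK (qs s)) + cps cPK (qs s).

Lemma cps_qs_der B c s : fbound B c ->
  cderiv (fun s => cps c (qs s)) s (w ^+ 2 * cps (pseries_diffs c) (qs s) * (2 * s)%:C).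
Proof.
move=> cB.
have h1 : has_der (fun s => s ^+ 2) s (2 * s).
  by apply: has_der_eq; [der|rewrite /=; ring].
exact: (@cderiv_comp _ (fun p => cps c (w ^+ 2 * p%:C)) _ _ _ _ h1 (cps_derive _ _ cB)).
Qed.

Lemma lnL_der s : 0 < s -> cderiv (fun s => (ln s)%:C + Lw) s ((s^-1)%:C + 0).
Proof.
move=> s0; apply: cderivD; last exact: cderiv_cst.
by apply: cderivC; exact: is_derive1_ln.
Qed.

Lemma sC0 s : 0 < s -> (s%:C : C) != 0.
Proof. by move=> s0; rewrite eq_complex /= negb_and gt_eqF. Qed.

Lemma Es_der s : 0 < s -> cderiv Es s (- (4 * w ^+ 2 * s%:C * K0s s)).
Proof.
move=> s0; have l := lnL_der s0.
have l2 := cderivM (cderiv_cst (2 : C) s) l.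
have h := cderivD (cderivD (cderiv_cst (1 : C) s) (cderivM l2 (cps_qs_der s fbound_cX)))
   (cderivN (cps_qs_der s fbound_cW)).
apply: (cderiv_eq h); rewrite diffs_cX diffs_cW.
rewrite -(cpsD _ (B := 2 * (`|euler_gamma R| + 1)) (B' := 1)); last exact: fbound_cI.
  rewrite -(cps_real_scale _ _ fbound_cPK) cps_cX /K0s.
  move: (cps (cI R) (qs s)) (cps cK (qs s)) (cps cPK (qs s)) => I K P.
  rewrite !rmorphM fmorphV /= !rmorph_nat.
  rewrite /qs rmorphXn /=.
  by field; exact: sC0.
have [B0 cb] := fbound_cPK; split; first by rewrite mulr_ge0.
by move=> m; rewrite normrM ger0_norm// -mulrA ler_wpM2l.
Qed.

Lemma K0s_der s : 0 < s -> cderiv K0s s (- (Es s / s%:C)).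
Proof.
move=> s0; have l := lnL_der s0.
have h := cderivD (cderivN (cderivM l (cps_qs_der s fbound_cK))) (cps_qs_der s fbound_cPK).
apply: (cderiv_eq h); rewrite diffs_cK /Es.
have -> : cps cW (qs s) = 1 - (cps cK (qs s) - 2 * qs s * cps (pseries_diffs cPK) (qs s)).
  by rewrite cps_cK_rec; ring.
rewrite cps_cX.
move: (cps (cI R) (qs s)) (cps cK (qs s)) (cps (pseries_diffs cPK) (qs s)) => I K P.
rewrite !rmorphM fmorphV /= !rmorph_nat /qs rmorphXn /=.
by field; exact: sC0.
Qed.

(** Crude, but [s^2 ln s = O(s)] is all that [Es_near] and [K0s_near] require. *)
Lemma ln_bound s : 0 < s <= 1 -> `|ln s| <= s^-1.
Proof.
move=> /andP[s0 s1]; rewrite ler0_norm ?ln_le0// -lnV ?posrE//.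
have v0 : 0 < s^-1 by rewrite invr_gt0.
rewrite -ler_expR lnK ?posrE//.
by rewrite (le_trans _ (expR_ge1Dx _))// lerDr.
Qed.

Lemma qs_le s : 0 < s <= 1 -> cabs (qs s) = cabs w ^+ 2 * s ^+ 2 /\
  cabs (qs s) <= cabs w ^+ 2.
Proof.
move=> /andP[s0 s1].
have e : cabs (qs s) = cabs w ^+ 2 * s ^+ 2.
  by rewrite /qs cabsM cabsX cabsC ger0_norm// sqr_ge0.
by split => //; rewrite e ler_piMr ?sqr_ge0// exprn_ile1// ltW.
Qed.

Lemma series_near0 B c : fbound B c -> exists2 K : R, 0 <= K &
  forall s, 0 < s <= 1 -> cabs (cps c (qs s) - (c 0%N)%:C) <= K * s ^+ 2.
Proof.
move=> cB; have [B0 _] := cB.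
exists (2 * (B * cabs w ^+ 2) * expR (cabs w ^+ 2 + 1)).
  by rewrite !mulr_ge0 ?expR_ge0 ?cabs_ge0// exprn_ge0// cabs_ge0.
move=> s s01; have [e h] := qs_le s01.
by rewrite (le_trans (cps_near0 cB h))// e le_eqVlt; apply/orP; left; apply/eqP; ring.
Qed.

Lemma lnL_bound s : 0 < s <= 1 -> cabs ((ln s)%:C + Lw) * s ^+ 2 <= (1 + cabs Lw) * s.
Proof.
move=> s01; have /andP[s0 s1] := s01.
apply: (@le_trans _ _ ((s^-1 + cabs Lw) * s ^+ 2)).
  apply: ler_wpM2r; first exact: sqr_ge0.
  by rewrite (le_trans (cabsD _ _))// lerD2r cabsC ln_bound.
rewrite mulrDl (_ : s^-1 * s ^+ 2 = s); last by field; rewrite gt_eqF.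
rewrite mulrDl mul1r lerD2l; apply: ler_wpM2l; first exact: cabs_ge0.
by rewrite expr2 ler_piMr// ltW.
Qed.

Lemma Es_near : exists2 K : R, 0 <= K & forall s, 0 < s <= 1 -> cabs (Es s - 1) <= K * s.
Proof.
have [K1 K10 h1] := series_near0 fbound_cX; have [K2 K20 h2] := series_near0 fbound_cW.
exists (2 * K1 * (1 + cabs Lw) + K2); first by rewrite addr_ge0// !mulr_ge0// addr_ge0// cabs_ge0.
move=> s s01; have /andP[s0 s1] := s01.
have -> : Es s - 1 = 2 * (((ln s)%:C + Lw) * (cps cX (qs s) - (cX 0)%:C)) - (cps cW (qs s) - (cW 0)%:C).
  by rewrite /Es /= !subr0; ring.
rewrite (le_trans (cabsB _ _))// [leRHS]mulrDl; apply: lerD.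
  rewrite !cabsM cabs_nat -[leRHS]mulrA -[leRHS]mulrA; apply: ler_wpM2l => //.
  apply: (@le_trans _ _ (cabs ((ln s)%:C + Lw) * (K1 * s ^+ 2))).
    by apply: ler_wpM2l; [exact: cabs_ge0|exact: h1].
  by rewrite mulrCA; apply: ler_wpM2l => //; exact: lnL_bound.
rewrite (le_trans (h2 _ s01))// ler_wpM2l// expr2 ler_piMr// ltW//.
Qed.

Lemma K0s_near : exists2 K : R, 0 <= K & forall s, 0 < s <= 1 ->
  cabs (K0s s + Lw + (ln s + euler_gamma R)%:C) <= K * s.
Proof.
have [K1 K10 h1] := series_near0 fbound_cK; have [K2 K20 h2] := series_near0 fbound_cPK.
exists (K1 * (1 + cabs Lw) + K2); first by rewrite addr_ge0// !mulr_ge0// addr_ge0// cabs_ge0.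
move=> s s01; have /andP[s0 s1] := s01.
have -> : K0s s + Lw + (ln s + euler_gamma R)%:C =
   - (((ln s)%:C + Lw) * (cps cK (qs s) - (cK 0)%:C)) + (cps cPK (qs s) - (cPK 0)%:C).
  (* [cPK 0] is [psi(1) = - gamma]: here Euler's constant enters on the side of the series. *)
  rewrite /K0s /cPK /psi_nat1 /Defs.harmonic big_geq// /cK fact0 mulr1 invr1 mulr1 addr0.
  by rewrite rmorphD rmorphN /=; ring.
rewrite (le_trans (cabsD _ _))// cabsN [leRHS]mulrDl; apply: lerD.
  rewrite cabsM.
  apply: (@le_trans _ _ (cabs ((ln s)%:C + Lw) * (K1 * s ^+ 2))).
    by apply: ler_wpM2l; [exact: cabs_ge0|exact: h1].
  by rewrite mulrCA -mulrA; apply: ler_wpM2l => //; exact: lnL_bound.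
rewrite (le_trans (h2 _ s01))// ler_wpM2l// expr2 ler_piMr// ltW//.
Qed.

End MacdonaldSeries.

(** * Uniqueness for the singular system *)

Section Uniqueness.
Variable R : realType.
Local Notation C := R[i].
Implicit Types (s x M B K : R).

(* Integrating [|f'| <= K s^n] from 0, where [f] vanishes. *)
Lemma cderiv_pow_bound (f f' : R -> C) B K n : 0 <= K ->
  (forall s, 0 < s <= 1 -> cderiv f s (f' s)) ->
  (forall s, 0 < s <= 1 -> cabs (f s) <= B * s) ->
  (forall s, 0 < s <= 1 -> cabs (f' s) <= K * s ^+ n) ->
  forall s, 0 < s <= 1 -> cabs (f s) <= 2 * (K / n.+1%:R * s ^+ n.+1).
Proof.
move=> K0 fd fB fK s s01; have /andP[s0 s1] := s01.
have n0 : (n.+1%:R : R) != 0 by rewrite pnatr_eq0.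
have main (p : C -> R) (F' : R -> R) : (forall z, `|p z| <= cabs z) ->
    (forall x, 0 < x <= 1 -> has_der (fun y => p (f y)) x (F' x)) ->
    (forall x, 0 < x <= 1 -> `|F' x| <= K * x ^+ n) ->
    `|p (f s)| <= K / n.+1%:R * s ^+ n.+1.
  move=> pz pd pF.
  have key e : 0 < e <= s -> `|p (f s)| <= K / n.+1%:R * s ^+ n.+1 + B * e.
    move=> /andP[e0 es].
    have in01 x : e <= x <= s -> 0 < x <= 1.
      by move=> /andP[h1 h2]; rewrite (lt_le_trans e0 h1) (le_trans h2 s1).
    have gd x : has_der (fun y => K / n.+1%:R * y ^+ n.+1) x (K * x ^+ n).
      apply: has_der_eq; first by der.
      by rewrite /= mul0r add0r; field; rewrite nat1r.
    have g0 : 0 <= K / n.+1%:R * e ^+ n.+1.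
      by rewrite !mulr_ge0 ?invr_ge0// exprn_ge0// ltW.
    have pe : `|p (f e)| <= B * e.
      by rewrite (le_trans (pz _))// fB// e0 (le_trans es).
    have h1 := @der_le _ _ _ _ _ _ _ es (fun x xe => pd x (in01 x xe)) (fun x _ => gd x)
      (fun x xe => le_trans (ler_norm _) (pF x (in01 x xe))).
    have h2 := @der_le _ (fun y => - (K / n.+1%:R * y ^+ n.+1)) _ (fun x => - (K * x ^+ n)) _ _ _ es
      (fun x _ => der_N (gd x)) (fun x xe => pd x (in01 x xe)).
    have {}h2 : - (K / n.+1%:R * s ^+ n.+1) - - (K / n.+1%:R * e ^+ n.+1) <= p (f s) - p (f e).
      apply: h2 => x xe; rewrite lerNl (le_trans _ (pF x (in01 x xe)))//.
      by rewrite -normrN ler_norm.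
    move: pe; rewrite !ler_norml => /andP[p1 p2].
    move: (K / _ * s ^+ _) (K / _ * e ^+ _) (B * e) (p (f s)) (p (f e)) g0 h1 h2 p1 p2.
    by clear => U V W X Y *; apply/andP; split; lra.
  apply/ler_addgt0Pr => e e0.
  pose e1 := Num.min s (e / (`|B| + 1)).
  have B1 : 0 < `|B| + 1 by rewrite ltr_wpDl.
  have e10 : 0 < e1 <= s by rewrite /e1 lt_min s0 divr_gt0//= ge_min lexx.
  rewrite (le_trans (key e1 e10))// lerD2l.
  have /andP[e1g _] := e10.
  apply: (@le_trans _ _ ((`|B| + 1) * e1)).
    by apply: ler_wpM2r; [exact: ltW|rewrite (le_trans (ler_norm _))// lerDl].
  by rewrite mulrC -ler_pdivlMr// /e1 ge_min lexx orbT.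
rewrite (le_trans (cabs_le_ReIm _))// mulr_natl mulr2n lerD//.
  apply: (main (@complex.Re R) (fun x => Re (f' x))); first exact: Re_le_cabs.
    by move=> x /fd[].
  by move=> x x01; rewrite (le_trans (Re_le_cabs _))// fK.
apply: (main (@complex.Im R) (fun x => Im (f' x))); first exact: Im_le_cabs.
  by move=> x /fd[].
by move=> x x01; rewrite (le_trans (Im_le_cabs _))// fK.
Qed.

(** Integrating both equations gains a factor [|k| s^2 / (n + 1)^2], so iteration yields
    [|D0| <= B |k|^n / n!^2 s^(2n)], and [n] tends to infinity. The bounds [B * s] start the
    iteration and express, at each integration, the vanishing at [0]. *)
Lemma system_unique (D0 DE : R -> C) (k : C) B :
  (forall s, 0 < s <= 1 -> cderiv DE s (- (k * s%:C * D0 s))) ->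
  (forall s, 0 < s <= 1 -> cderiv D0 s (- (DE s / s%:C))) ->
  (forall s, 0 < s <= 1 -> cabs (D0 s) <= B * s) ->
  (forall s, 0 < s <= 1 -> cabs (DE s) <= B * s) ->
  D0 1 = 0 /\ DE 1 = 0.
Proof.
move=> dE d0 b0 bE.
have i1 : 0 < (1 : R) <= 1 by rewrite ltr01 lexx.
have B0 : 0 <= B.
  by have := b0 1 i1; rewrite mulr1; apply: le_trans; exact: cabs_ge0.
pose P n := forall s, 0 < s <= 1 -> cabs (D0 s) <= B * (cabs k ^+ n / n`!%:R ^+ 2) * s ^+ (2 * n).
have fg n : 0 < (n`!%:R : R) by exact: fact_gt0R.
have step n : (forall s, 0 < s <= 1 -> cabs (D0 s) <= B * (cabs k ^+ n / n`!%:R ^+ 2) * s ^+ (2 * n)) ->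
    (forall s, 0 < s <= 1 -> cabs (DE s) <=
       2 * ((cabs k * (B * (cabs k ^+ n / n`!%:R ^+ 2))) / ((2 * n).+2)%:R * s ^+ (2 * n).+2)).
  move=> Pn.
  have K0 : 0 <= cabs k * (B * (cabs k ^+ n / n`!%:R ^+ 2)).
    by rewrite !mulr_ge0 ?cabs_ge0 ?invr_ge0 ?exprn_ge0 ?cabs_ge0.
  apply: (cderiv_pow_bound K0 dE bE) => s s01; have /andP[s0 s1] := s01.
  rewrite cabsN !cabsM cabsC (gtr0_norm s0) (exprS s).
  apply: (@le_trans _ _ (cabs k * s * (B * (cabs k ^+ n / n`!%:R ^+ 2) * s ^+ (2 * n)))).
    by apply: ler_wpM2l; [rewrite mulr_ge0 ?cabs_ge0// ltW|exact: Pn].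
  by rewrite le_eqVlt; apply/orP; left; apply/eqP; ring.
have PS n : P n.
  elim: n => [|n IH] => [s s01|].
    have /andP[s0 s1] := s01.
    rewrite muln0 !expr0 fact0 expr1n divr1 !mulr1 (le_trans (b0 s s01))//.
    by rewrite ler_piMr.
  have hE := step n IH.
  have K0 : 0 <= 2 * (cabs k * (B * (cabs k ^+ n / n`!%:R ^+ 2)) / ((2 * n).+2)%:R).
    by rewrite !mulr_ge0 ?cabs_ge0 ?invr_ge0 ?exprn_ge0 ?cabs_ge0.
  move=> s s01.
  have h := @cderiv_pow_bound D0 (fun s => - (DE s / s%:C)) B _ (2 * n).+1 K0 d0 b0.
  have {}h : cabs (D0 s) <= 2 * (2 * (cabs k * (B * (cabs k ^+ n / n`!%:R ^+ 2)) / ((2 * n).+2)%:R)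
      / ((2 * n).+2)%:R * s ^+ (2 * n).+2).
    apply: h => // x x01; have /andP[x0 x1] := x01.
    rewrite cabsN cabsM cabsV cabsC (gtr0_norm x0) ler_pdivrMr// (le_trans (hE x x01))//.
    by rewrite (exprSr x); rewrite le_eqVlt; apply/orP; left; apply/eqP; ring.
  apply: (le_trans h); rewrite le_eqVlt; apply/orP; left; apply/eqP.
  (* The two factors [2] from [cderiv_pow_bound] cancel against [(2n + 2)^2 = 4 (n + 1)^2], which
     leaves exactly the square of the factorial. *)
  have -> : (2 * n.+1 = (2 * n).+2)%N by rewrite mulnS.
  have e : ((2 * n).+2)%:R = 2 * (n.+1%:R : R) by rewrite -natrM mulnS.
  rewrite e factS natrM (exprS (cabs k)).
  have n1 : (n.+1%:R : R) != 0 by rewrite pnatr_eq0.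
  by field; rewrite nat1r n1 gt_eqF.
have lim0 (X : R) : (forall n, X <= B * (cabs k ^+ n / n`!%:R)) -> X <= 0.
  move=> h.
  have c1 : B * (cabs k ^+ n / n`!%:R) @[n --> \oo] --> B * (0 : R).
    apply: cvgMr.
    exact: (@cvg_series_cvg_0 _ R^o _ (is_cvg_series_exp_coeff (cabs k))).
  rewrite mulr0 in c1.
  by apply: (ler_cvg_to (cvg_cst X) c1); exact: nearW.
have fle n : (n`!%:R ^+ 2 : R)^-1 <= (n`!%:R)^-1.
  rewrite lef_pV2 ?posrE ?exprn_gt0// expr2 ler_peMr ?(ltW (fg n))//.
  by rewrite ler1n fact_gt0.
have Z0 : cabs (D0 1) <= 0.
  apply: lim0 => n; rewrite (le_trans (PS n 1 i1))// expr1n mulr1.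
  by rewrite ler_wpM2l// ler_wpM2l ?exprn_ge0 ?cabs_ge0.
have ZE : cabs (DE 1) <= 0.
  have bD n : cabs (DE 1) <= cabs k * (B * (cabs k ^+ n / n`!%:R)).
    rewrite (le_trans (step n (PS n) 1 i1))// expr1n mulr1.
    apply: (@le_trans _ _ (2 * (cabs k * (B * (cabs k ^+ n / n`!%:R ^+ 2)) / 2))).
      rewrite ler_wpM2l// ler_wpM2l//.
        by rewrite !mulr_ge0 ?cabs_ge0 ?invr_ge0 ?exprn_ge0 ?cabs_ge0.
      by rewrite lef_pV2 ?posrE// ler_nat.
    rewrite mulrC divfK// ler_wpM2l ?cabs_ge0// ler_wpM2l// ler_wpM2l ?exprn_ge0 ?cabs_ge0//.
  have [k0|k0] := eqVneq (cabs k) 0; first by have := bD 0%N; rewrite k0 mul0r.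
  have kp : 0 < cabs k by rewrite lt_neqAle eq_sym k0 cabs_ge0.
  have := lim0 (cabs (DE 1) / cabs k).
  rewrite ler_pdivrMr// mul0r; apply => n.
  by rewrite ler_pdivrMr// mulrC.
by split; apply/eqP; rewrite -cabs_eq0 eq_le ?Z0 ?ZE cabs_ge0.
Qed.

End Uniqueness.

(** * Decay of the Hankel function in sectors of the first quadrant *)

Section HankelDecay.
Variable R : realType.
Local Notation C := R[i].

Lemma Ei_Es (c d : R) : 0 < c -> 0 < d -> Ei c d 1 = Es (wc c d) (Lam c d) 1.
Proof.
move=> c0 d0.
pose D0 s := K0i c d s - K0s (wc c d) (Lam c d) s.
pose DE s := Ei c d s - Es (wc c d) (Lam c d) s.
have [KE KE0 hE] := Es_near (wc c d) (Lam c d).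
have [KK KK0 hK] := K0s_near (wc c d) (Lam c d).
pose BE := cabs (wc c d) * (2 * ((c + 2 * d) / c + 1)) + (c + 2 * d).
have BE0 : 0 <= BE.
  rewrite /BE addr_ge0 ?mulr_ge0 ?cabs_ge0//; last by rewrite addr_ge0 ?mulr_ge0// ltW.
  by rewrite addr_ge0// divr_ge0 ?addr_ge0 ?mulr_ge0// ltW.
pose B := (3 * c + 10 * d + KK) + (BE + KE).
have [_ /eqP] : D0 1 = 0 /\ DE 1 = 0.
  apply: (@system_unique _ D0 DE (4 * wc c d ^+ 2) B) => s s01; have /andP[s0 s1] := s01.
  - apply: cderiv_eq.
      exact: (cderivD (Ei_der d c0 s0) (cderivN (Es_der _ _ s0))).
    by rewrite /D0; ring.
  - apply: cderiv_eq.
      exact: (cderivD (K0i_der d c0 s0) (cderivN (K0s_der _ _ s0))).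
    by rewrite /DE; ring.
  - have -> : D0 s = (K0i c d s + Lam c d + (ln s + euler_gamma R)%:C) -
        (K0s (wc c d) (Lam c d) s + Lam c d + (ln s + euler_gamma R)%:C) by rewrite /D0; ring.
    rewrite (le_trans (cabsB _ _))//.
    rewrite (le_trans (lerD (K0i_asym c0 d0 s0) (hK s s01)))//.
    by rewrite /B -mulrDl ler_wpM2r ?(ltW s0)// lerDl addr_ge0.
  - have -> : DE s = (Ei c d s - 1) - (Es (wc c d) (Lam c d) s - 1) by rewrite /DE; ring.
    rewrite (le_trans (cabsB _ _))//.
    rewrite (le_trans (lerD (Ei_asym c0 d0 s0) (hE s s01)))//.
    rewrite /B -mulrDl ler_wpM2r ?(ltW s0)// lerDr.
    by rewrite !addr_ge0 ?mulr_ge0// ltW.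
by rewrite subr_eq0 => /eqP.
Qed.

Lemma atanV (x : R) : 0 < x -> atan x^-1 = pi / 2 - atan x.
Proof.
move=> x0.
have h : tan (pi / 2 - atan x) = x^-1.
  rewrite /tan sinB cosB cos_pihalf sin_pihalf !mul0r !mul1r subr0 add0r.
  by rewrite -[X in _ = X^-1](atanK x) /tan invf_div.
rewrite -h tanK// in_itv/=.
have a0 : 0 < atan x by rewrite -atan0; exact: lt_atan.
have := atan_ltpi2 x; have := pi_gt0 R => p0 a1.
by apply/andP; split; lra.
Qed.

(** [z/2 = i w] with [w = -iz/2] in the fourth quadrant, so the principal logarithms differ by
    [i pi / 2]; on the arguments this is [atanV]. *)
Lemma clog_half (z : C) : 0 < Re z -> 0 < Im z ->
  clog (z / 2) = Lam (Im z / 2) (Re z / 2) + (pi / 2)%:C * 'i.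
Proof.
move=> rz iz.
have e1 : Re (z / 2) = Re z / 2.
  by rewrite creM creV cimV crenat cimnat expr0n addr0 mul0r oppr0 mulr0 subr0; field.
have e2 : Im (z / 2) = Im z / 2.
  by rewrite cimM creV cimV crenat cimnat expr0n addr0 mul0r oppr0 mulr0 add0r; field.
apply: ceqP.
  rewrite /clog creD creM /Lam /= mulr0 mul0r subrr addr0 /cabs e1 e2.
  set X := (Re z / 2) ^+ 2 + _.
  have X0 : 0 < X by rewrite ltr_pwDl ?sqr_ge0// exprn_gt0// divr_gt0.
  have : ln (Num.sqrt X ^+ 2) = ln (Num.sqrt X) *+ 2 by rewrite lnXn// sqrtr_gt0.
  rewrite sqr_sqrtr ?(ltW X0)// => h.
  by rewrite (addrC (_ ^+ 2)) -/X h mulr2n; field.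
rewrite /clog cimD cimM /Lam /= mulr1 mul0r addr0 /carg e1 e2 divr_gt0//.
rewrite -[X in atan X]invrK atanV; last by rewrite invf_div divr_gt0// divr_gt0.
by rewrite invf_div addrC.
Qed.

(** This is [H_1(z) = -(2/pi) K_1(-iz)]. The shift [i pi / 2] of the logarithm cancels the summand
    [J_1]: what is left over is a multiple of [1 + i^2]. *)
Lemma hankel1_Ei (z : C) : 0 < Re z -> 0 < Im z ->
  hankel1 z = - (2 * 'i / (pi%:C * z)) * Ei (Im z / 2) (Re z / 2) 1.
Proof.
move=> rz iz.
have c0 : 0 < Im z / 2 by rewrite divr_gt0.
have d0 : 0 < Re z / 2 by rewrite divr_gt0.
rewrite (Ei_Es c0 d0) hankel1E clog_half// /Es ln1 cps_cX cps_cW.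
have -> : qs (wc (Im z / 2) (Re z / 2)) 1 = - z ^+ 2 / 4.
  rewrite /qs expr1n mulr1.
  have -> : wc (Im z / 2) (Re z / 2) = - 'i * z / 2.
    have i2 : (2 : C)^-1 = (2^-1 : R)%:C by rewrite fmorphV rmorph_nat.
    by rewrite i2; apply: ceqP; rewrite /wc ?creM ?cimM ?creN ?cimN /=; ring.
  by rewrite !exprMn sqrrN sqr_i exprVn -natrX; field.
have z0 : z != 0 by apply: contraTneq rz => ->; rewrite ltxx.
have p0 : (pi%:C : C) != 0.
  by rewrite eq_complex/= negb_and gt_eqF ?pi_gt0.
have pE : (pi / 2)%:C = pi%:C / 2 :> C by rewrite fmorph_div rmorph_nat.
rewrite pE add0r.
have ii : ('i : C) * 'i = -1 by rewrite -expr2 sqr_i.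
move: (cps (cI R) _) (cps (cP R) _) (Lam _ _) => I1 P1 L1.
apply/eqP; rewrite -subr_eq0; apply/eqP.
have -> : - (2 * 'i / (pi%:C * z)) + z / 2 * ((1 + 2 * 'i / pi%:C * (L1 + pi%:C / 2 * 'i)) * I1 -
    'i / pi%:C * P1) - - (2 * 'i / (pi%:C * z)) *
    (1 + 2 * L1 * (- z ^+ 2 / 4 * I1) - - z ^+ 2 / 4 * P1) = z / 2 * I1 * (1 + 'i * 'i).
  by clear pE; move: (pi%:C : C) p0 => p p0; field; rewrite z0 p0.
by rewrite ii subrr mulr0.
Qed.

(** [Ei] carries [e^(-c)] with [c = Im z / 2]. The exponential is given away through
    [e^(-c) <= 1/c], since an inverse square in a sector is enough for [hankel1_Rk]. *)
Lemma hankel1_decay (z : C) (dl : R) : 0 < Re z -> 0 < dl -> z != 0 ->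
  dl * cabs z <= Im z -> cabs (hankel1 z) <= 16 / dl ^+ 2 / cabs z ^+ 2.
Proof.
move=> rz dl0 z0 iz.
have az : 0 < cabs z by rewrite cabs_gt0.
have iz0 : 0 < Im z by apply: lt_le_trans iz; rewrite mulr_gt0.
pose c := Im z / 2; have c0 : 0 < c by rewrite divr_gt0.
have cz : dl * cabs z / 2 <= c by rewrite ler_pM2r.
have hJ : cabs (cJ (@gE R) (@yK R) (c * 1) (Re z / 2 * 1)) <= 2 * (2 * (expR (- c) / c)).
  have -> : 2 * (expR (- c) / c) = Rintegral lebesgue_measure `[(1 : R), +oo[%classic
      (fun x => 2 * expR (- (c * x))).
    rewrite (@RintegralZl _ _ _ lebesgue_measure _ _ _ (@measurable_I1 R) (integrable_expRN1 c0)).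
    by rewrite /Rintegral integral_expRN.
  rewrite mulr1; apply: cJ_le; [exact: ltW|exact: measurable_gE|exact: nicey_yK|exact: integrable_expRN|].
  by move=> x x1; apply: ler_wpM2r; [exact: expR_ge0|exact: gE_le].
have ec : expR (- c) <= c^-1.
  by rewrite expRN lef_pV2 ?posrE ?expR_gt0// (le_trans _ (expR_ge1Dx _))// lerDr.
have wz : cabs (wc c (Re z / 2)) = cabs z / 2.
  have -> : wc c (Re z / 2) = - 'i * z * (2^-1 : R)%:C.
    by apply: ceqP; rewrite /wc /c ?creM ?cimM ?creN ?cimN /=; ring.
  by rewrite !cabsM cabsN cabsi mul1r cabsC ger0_norm// invr_ge0.
rewrite hankel1_Ei// cabsM cabsN !cabsM cabsV cabsM cabs_nat cabsi mulr1 cabsC.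
rewrite (gtr0_norm (pi_gt0 R)) -/c wz cabsC normr1.
have hJ' : cabs (cJ (@gE R) (@yK R) (c * 1) (Re z / 2 * 1)) <= 4 / c ^+ 2.
  rewrite (le_trans hJ)// mulrA -natrM ler_wpM2l//.
  by rewrite -exprVn expr2 ler_wpM2r// invr_ge0 ltW.
have c2 : 4 / c ^+ 2 <= 16 / dl ^+ 2 / cabs z ^+ 2.
  rewrite (_ : 16 / dl ^+ 2 / cabs z ^+ 2 = 4 / (dl * cabs z / 2) ^+ 2); last first.
    by field; rewrite !gt_eqF.
  rewrite ler_wpM2l// lef_pV2 ?posrE ?exprn_gt0 ?divr_gt0 ?mulr_gt0//.
  by apply: lerXn2r => //; rewrite nnegrE ltW// divr_gt0// mulr_gt0.
apply: le_trans c2; apply: le_trans hJ'.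
rewrite mulrA ler_piMl ?cabs_ge0//.
rewrite (_ : _ * (cabs z / 2 * 1) = pi^-1); last first.
  have p0 := lt0r_neq0 (pi_gt0 R); have q0 := lt0r_neq0 az.
  move: (cabs z) q0 (pi : R) p0; clear => Z Z0 p p0.
  by field; apply/andP; split.
by rewrite invf_le1 ?pi_gt0// (le_trans _ (pi_ge2 R))// ler1n.
Qed.

End HankelDecay.

(** * Regularity of the Hankel function and of the square root *)

Section HankelRegularity.
Variable R : realType.
Local Notation C := R[i].

Lemma mulr_ln_le (x : R) : 0 < x -> x * `|ln x| <= 1 + x ^+ 2.
Proof.
move=> x0.
have h1 : ln x <= x by rewrite ltW// ln_sublinear.
have h2 : - ln x <= x^-1.
  by rewrite -lnV ?posrE// ltW// ln_sublinear// invr_gt0.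
apply: (@le_trans _ _ (x * (x + x^-1))).
  apply: ler_wpM2l; first exact: ltW.
  have v0 : 0 < x^-1 by rewrite invr_gt0.
  by rewrite ler_norml; apply/andP; split; lra.
by rewrite mulrDr mulfV ?gt_eqF// -expr2 addrC.
Qed.

Lemma halfC (z : C) : z / 2 = (Re z / 2) +i* (Im z / 2).
Proof.
have i2 : (2 : C)^-1 = (2^-1 : R)%:C by rewrite fmorphV rmorph_nat.
by rewrite i2; apply: ceqP; rewrite ?creM ?cimM /=; ring.
Qed.

Lemma pi_half_lt2 : pi / 2 < 2 :> R. Proof. exact: pihalf_lt2. Qed.

Lemma hankel1_small (M : R) : exists2 K : R, 0 <= K & forall z : C,
  0 < Re z -> 0 < Im z -> cabs z <= M ->
  cabs (hankel1 z + 2 * 'i / (pi%:C * z)) <= K.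
Proof.
pose BP := 2 * `|euler_gamma R| + 2.
pose K := (`|M| + (1 + `|M| ^+ 2 + 2 * `|M|)) * (2 * 1 * expR (`|M| ^+ 2)) +
   `|M| * (2 * BP * expR (`|M| ^+ 2)).
have BP0 : 0 <= BP by rewrite /BP addr_ge0// mulr_ge0.
exists K.
  by rewrite /K addr_ge0 ?mulr_ge0 ?addr_ge0 ?mulr_ge0 ?expR_ge0 ?exprn_ge0.
move=> z rz iz zM.
have z0 : z != 0 by apply: contraTneq rz => ->; rewrite ltxx.
have az : 0 < cabs z by rewrite cabs_gt0.
have zM' : cabs z <= `|M| by rewrite (le_trans zM)// ler_norm.
have p0 := pi_gt0 R; have p2 := pi_ge2 R.
have ip1 : cabs (pi%:C : C)^-1 <= 2^-1.
  by rewrite cabsV cabsC gtr0_norm// lef_pV2 ?posrE.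
set q := - z ^+ 2 / 4.
have qM : cabs q <= `|M| ^+ 2.
  rewrite /q cabsM cabsN cabsX cabsV cabs_nat.
  apply: (@le_trans _ _ (cabs z ^+ 2)).
    by rewrite ler_piMr ?exprn_ge0 ?cabs_ge0// invf_le1// ler1n.
  by apply: lerXn2r => //; rewrite nnegrE cabs_ge0.
have [_ hI] := cps_bound (fbound_cI R) q.
have [_ hP] := cps_bound (fbound_cP R) q.
have eM : expR (cabs q) <= expR (`|M| ^+ 2) by rewrite ler_expR.
pose X := cabs (z / 2).
have XE : X = cabs z / 2 by rewrite /X cabsM cabsV cabs_nat.
have X0 : 0 < X by rewrite XE divr_gt0.
have XM : X <= `|M| by rewrite XE; lra.
have hl : X * cabs (clog (z / 2)) <= 1 + `|M| ^+ 2 + 2 * `|M|.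
  apply: (@le_trans _ _ (X * (`|ln X| + 2))).
    apply: ler_wpM2l; first exact: ltW.
    rewrite (le_trans (cabs_le_ReIm _))// lerD2l /=.
    rewrite halfC /carg /= divr_gt0//.
    have h1 := atan_gtNpi2 (Im z / 2 / (Re z / 2)).
    have h2 := atan_ltpi2 (Im z / 2 / (Re z / 2)).
    have h3 := pi_half_lt2.
    by rewrite ler_norml; apply/andP; split; lra.
  rewrite mulrDr (mulrC X 2) lerD//; last by rewrite ler_wpM2l.
  rewrite (le_trans (mulr_ln_le X0))// lerD2l.
  by apply: lerXn2r => //; rewrite nnegrE ltW.
have -> : hankel1 z + 2 * 'i / (pi%:C * z) =
  z / 2 * ((1 + 2 * 'i / pi%:C * clog (z / 2)) * cps (cI R) q - 'i / pi%:C * cps (cP R) q).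
  by rewrite hankel1E -/q; ring.
rewrite mulrBr (le_trans (cabsB _ _))// /K; apply: lerD.
  rewrite mulrA cabsM; apply: ler_pM; rewrite ?cabs_ge0//; last first.
    by rewrite (le_trans hI)// ler_wpM2l// mulr_ge0.
  rewrite mulrDr mulr1 (le_trans (cabsD _ _))//; apply: lerD => //.
  rewrite cabsM -/X cabsM; apply: le_trans hl.
  rewrite mulrCA ler_piMl ?mulr_ge0 ?cabs_ge0 ?(ltW X0)//.
  by rewrite !cabsM cabs_nat cabsi mulr1; have := ip1; lra.
rewrite [X in cabs X <= _]mulrA cabsM; apply: ler_pM; rewrite ?cabs_ge0//; last first.
  by rewrite (le_trans hP)// ler_wpM2l// mulr_ge0.
rewrite cabsM -/X (le_trans _ XM)// ler_piMr ?(ltW X0)//.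
by rewrite cabsM cabsi mul1r (le_trans ip1)// invf_le1// ler1n.
Qed.

Lemma measurable_sqrt : measurable_fun setT (@Num.sqrt R).
Proof. by apply: continuous_measurable_fun; exact: sqrt_continuous. Qed.

Section meas.
Context d (T : measurableType d).
Implicit Types f g : T -> C.

Lemma measurable_carg f : cmeas f -> measurable_fun setT (fun x => carg (f x)).
Proof.
move=> [f1 f2]; rewrite /carg.
have ma : measurable_fun setT (fun x => atan (Im (f x) / Re (f x))).
  apply: (measurableT_comp (f := atan)).
    by apply: continuous_measurable_fun; exact: continuous_atan.
  by apply: measurable_funM => //; exact: measurable_fun_invr.
have m0 : measurable_fun setT (fun _ : T => 0 : R) by exact: measurable_cst.
apply: measurable_fun_ifT => //; first exact: measurable_fun_ltr.
apply: measurable_fun_ifT; first exact: measurable_fun_ltr.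
  apply: measurable_fun_ifT; first exact: measurable_fun_ler.
    by apply: measurable_funD => //; exact: measurable_cst.
  by apply: measurable_funB => //; exact: measurable_cst.
apply: measurable_fun_ifT; [exact: measurable_fun_ltr|exact: measurable_cst|].
by apply: measurable_fun_ifT => //; exact: measurable_fun_ltr.
Qed.

Lemma cmeas_clog f : cmeas f -> cmeas (fun x => clog (f x)).
Proof.
move=> mf; split => /=; last exact: measurable_carg.
apply: (measurableT_comp (f := @ln R)); first exact: measurable_ln.
exact: measurable_cabs.
Qed.

Lemma cmeas_csqrt f : cmeas f -> cmeas (fun x => csqrt (f x)).
Proof.
move=> mf.
have ms : measurable_fun setT (fun x => Num.sqrt (cabs (f x))).
  by apply: (measurableT_comp measurable_sqrt); exact: measurable_cabs.
have mc : measurable_fun setT (fun x => carg (f x) / 2).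
  by apply: measurable_funM; [exact: measurable_carg|exact: measurable_cst].
split => /=; apply: measurable_funM => //.
  apply: (measurableT_comp (f := cos)) => //.
  by apply: continuous_measurable_fun; exact: continuous_cos.
apply: (measurableT_comp (f := sin)) => //.
by apply: continuous_measurable_fun; exact: continuous_sin.
Qed.

Lemma cmeas_hankel1 f : cmeas f -> cmeas (fun x => hankel1 (f x)).
Proof.
move=> mf; under eq_fun do rewrite hankel1E.
have mh : cmeas (fun x => f x / 2) by apply: cmeasM => //; exact: cmeas_cst.
have mq : cmeas (fun x => - f x ^+ 2 / 4).
  by apply: cmeasM; [apply: cmeasN; exact: cmeasX|exact: cmeas_cst].
apply: cmeasD.
  apply: cmeasN; apply: cmeasM; first exact: cmeas_cst.
  by apply: cmeasV; apply: cmeasM => //; exact: cmeas_cst.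
apply: cmeasM => //; apply: cmeasD.
  apply: cmeasM; last exact: (cmeas_cps (fbound_cI R)).
  apply: cmeasD; first exact: cmeas_cst.
  by apply: cmeasM; [exact: cmeas_cst|exact: cmeas_clog].
by apply: cmeasN; apply: cmeasM; [exact: cmeas_cst|exact: (cmeas_cps (fbound_cP R))].
Qed.
End meas.

Section lim.
Context T (F : set_system T) {FF : ProperFilter F}.
Implicit Types f g : T -> C.

Lemma ccvg_near f g l : (\forall x \near F, f x = g x) -> ccvg F f l -> ccvg F g l.
Proof.
move=> fg [h1 h2]; split.
  apply: cvg_trans h1; apply: near_eq_cvg.
  by apply: filterS fg => x ->.
apply: cvg_trans h2; apply: near_eq_cvg.
by apply: filterS fg => x ->.
Qed.

Lemma ccvg_clog f l : 0 < Re l -> ccvg F f l -> ccvg F (fun x => clog (f x)) (clog l).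
Proof.
move=> rl fl; have [f1 f2] := fl.
have l0 : 0 < cabs l.
  by rewrite (lt_le_trans rl)// (le_trans (ler_norm _))// Re_le_cabs.
split => /=.
  apply: (cvg_comp _ (@ln R) (cvg_cabs fl)).
  exact: continuous_ln.
have h : atan (Im (f x) / Re (f x)) @[x --> F] --> carg l.
  rewrite /carg rl.
  apply: (cvg_comp _ (@atan R) _ (@continuous_atan R _)).
  by apply: cvgM => //; apply: cvgV => //; rewrite gt_eqF.
apply: cvg_trans h; apply: near_eq_cvg.
near=> x.
have rx : 0 < Re (f x) by near: x; exact: (cvgr_gt _ f1).
by rewrite /carg rx.
Unshelve. all: by end_near. Qed.

Lemma ccvg_hankel1 f l : 0 < Re l -> ccvg F f l ->
  ccvg F (fun x => hankel1 (f x)) (hankel1 l).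
Proof.
move=> rl fl; rewrite hankel1E.
under eq_fun do rewrite hankel1E.
have l0 : l != 0 by apply: contraTneq rl => ->; rewrite ltxx.
have p0 : (pi%:C : C) != 0 by rewrite eq_complex/= negb_and gt_eqF ?pi_gt0.
have c2 : ccvg F (fun x => f x / 2) (l / 2) by apply: ccvgM => //; exact: ccvg_cst.
have cq : ccvg F (fun x => - f x ^+ 2 / 4) (- l ^+ 2 / 4).
  by apply: ccvgM; [apply: ccvgN; exact: ccvgX|exact: ccvg_cst].
apply: ccvgD.
  apply: ccvgN; apply: ccvgM; first exact: ccvg_cst.
  apply: ccvgV; first by rewrite mulf_neq0.
  by apply: ccvgM => //; exact: ccvg_cst.
apply: ccvgM => //; apply: ccvgD.
  apply: ccvgM; last exact: (ccvg_cps (fbound_cI R)).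
  apply: ccvgD; first exact: ccvg_cst.
  apply: ccvgM; first exact: ccvg_cst.
  by apply: ccvg_clog => //; rewrite halfC /= divr_gt0.
by apply: ccvgN; apply: ccvgM; [exact: ccvg_cst|exact: (ccvg_cps (fbound_cP R))].
Qed.
End lim.

Lemma sin_atan (x : R) : sin (atan x) = x * cos (atan x).
Proof.
have c0 : cos (atan x) != 0.
  by rewrite cos_atan invr_eq0 gt_eqF// sqrtr_gt0 ltr_pwDl// sqr_ge0.
by rewrite -{2}(atanK x) /tan divfK.
Qed.

Lemma carg_polar (q : C) : 0 < Im q ->
  [/\ 0 < carg q < pi, cabs q * cos (carg q) = Re q & cabs q * sin (carg q) = Im q].
Proof.
move=> iq; case: q iq => x y /= y0.
have p0 := pi_gt0 R.
have an0 : cabs (x +i* y) = Num.sqrt (x ^+ 2 + y ^+ 2) by [].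
rewrite /carg /= an0.
have key : x != 0 -> Num.sqrt (x ^+ 2 + y ^+ 2) * cos (atan (y / x)) = `|x|.
  move=> x0; rewrite cos_atan.
  have -> : x ^+ 2 + y ^+ 2 = x ^+ 2 * (1 + (y / x) ^+ 2) by field.
  rewrite sqrtrM ?sqr_ge0// sqrtr_sqr mulfK// gt_eqF// sqrtr_gt0.
  by rewrite ltr_pwDl// sqr_ge0.
have b1 := atan_gtNpi2 (y / x); have b2 := atan_ltpi2 (y / x).
have [x0|x0|x0] := ltrgtP 0 x.
- have xn : x != 0 by rewrite gt_eqF.
  have a0 : 0 < atan (y / x) by rewrite -atan0; apply: lt_atan; rewrite divr_gt0.
  split; first by apply/andP; split => //; lra.
    by rewrite key// gtr0_norm.
  by rewrite sin_atan mulrCA key// gtr0_norm// divfK.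
- have xn : x != 0 by rewrite lt_eqF.
  rewrite (ltW y0).
  have a0 : atan (y / x) < 0.
    by rewrite -atan0; apply: lt_atan; rewrite pmulr_rlt0// invr_lt0.
  split; first by apply/andP; split; lra.
    by rewrite cosDpi mulrN key// ltr0_norm// opprK.
  by rewrite sinDpi mulrN sin_atan mulrCA key// ltr0_norm// mulrN opprK divfK.
- rewrite y0; split; first by apply/andP; split; lra.
    by rewrite cos_pihalf mulr0.
  by rewrite sin_pihalf mulr1 -x0 expr0n add0r sqrtr_sqr gtr0_norm.
Qed.

(** The angle lies in []0, pi[], so halving it puts the root in the open first quadrant, where
    [hankel1_Ei] and [hankel1_small] apply. *)
Lemma csqrtP (q : C) : 0 < Im q ->
  [/\ 0 < Re (csqrt q), 0 < Im (csqrt q), csqrt q ^+ 2 = q & cabs (csqrt q) ^+ 2 = cabs q].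
Proof.
move=> iq; have [/andP[c0 c1] hc hs] := carg_polar iq.
have q0 : 0 < cabs q.
  by rewrite (lt_le_trans iq)// (le_trans (ler_norm _))// Im_le_cabs.
have s0 : 0 < Num.sqrt (cabs q) by rewrite sqrtr_gt0.
have ss : Num.sqrt (cabs q) ^+ 2 = cabs q by rewrite sqr_sqrtr// ltW.
have p0 := pi_gt0 R.
have cc : carg q = carg q / 2 + carg q / 2 by field.
have e : csqrt q ^+ 2 = q.
  apply: ceqP; rewrite expr2 /csqrt ?creM ?cimM /=.
    rewrite -hc [in RHS]cc cosD -[in RHS]ss; ring.
  by rewrite -hs [in RHS]cc sinD -[in RHS]ss; ring.
split => //.
- by rewrite /csqrt /= mulr_gt0// cos_gt0_pihalf//; apply/andP; split; lra.
- by rewrite /csqrt /= mulr_gt0// sin_gt0_pi//; apply/andP; split; lra.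
- by rewrite -cabsX e.
Qed.

(** The half angle formulas avoid [carg], whose case distinction on the sign of [Re q] obscures
    continuity across the imaginary axis; [ccvg_csqrt] rests on them. *)
Lemma csqrtE (q : C) : 0 < Im q ->
  csqrt q = (Num.sqrt ((cabs q + Re q) / 2)) +i* (Num.sqrt ((cabs q - Re q) / 2)).
Proof.
move=> iq; have [r0 i0 e ae] := csqrtP iq.
rewrite cabs2 in ae.
have e1 : Re (csqrt q) ^+ 2 - Im (csqrt q) ^+ 2 = Re q.
  by rewrite -[in RHS]e expr2 creM -!expr2.
apply: ceqP => /=.
  rewrite (_ : (cabs q + Re q) / 2 = Re (csqrt q) ^+ 2); last by rewrite -ae -e1; field.
  by rewrite sqrtr_sqr gtr0_norm.
rewrite (_ : (cabs q - Re q) / 2 = Im (csqrt q) ^+ 2); last by rewrite -ae -e1; field.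
by rewrite sqrtr_sqr gtr0_norm.
Qed.

Lemma ccvg_csqrt T (F : set_system T) {FF : ProperFilter F} (f : T -> C) l :
  0 < Im l -> ccvg F f l -> ccvg F (fun x => csqrt (f x)) (csqrt l).
Proof.
move=> il fl; have [f1 f2] := fl.
apply: (@ccvg_near _ _ _ (fun x => (Num.sqrt ((cabs (f x) + Re (f x)) / 2)) +i*
   (Num.sqrt ((cabs (f x) - Re (f x)) / 2)))).
  near=> x; rewrite csqrtE//.
  by near: x; exact: (cvgr_gt _ f2).
rewrite (csqrtE il); split => /=.
  apply: (cvg_comp _ (@Num.sqrt R)); last exact: sqrt_continuous.
  by apply: cvgMl; apply: cvgD => //; exact: cvg_cabs.
apply: (cvg_comp _ (@Num.sqrt R)); last exact: sqrt_continuous.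
by apply: cvgMl; apply: cvgB => //; exact: cvg_cabs.
Unshelve. all: by end_near. Qed.

End HankelRegularity.

(** * The rotated distance and the size of the kernel *)

Section KernelGeometry.
Variable R : realType.
Local Notation C := R[i].
Variables (a k th : R).
Hypotheses (a0 : 0 < a) (k0 : 0 < k) (th0 : 0 < th) (th1 : th < pi / 2).

(** The Jacobian [dtau] belongs to the kernel, so that [D_theta] integrates it against [psi]
    alone. *)
Definition kerD (t s : R) : C :=
  hker k (tau a th t - a%:C) (a%:C - tau a th s) * dtau a th s.
Definition Qk (t s : R) : C := (tau a th t - a%:C) ^+ 2 + (a%:C - tau a th s) ^+ 2.
Definition rsq (t s : R) : R := (t - a) ^+ 2 + (s - a) ^+ 2.

Lemma cos_th : 0 < cos th.
Proof. by apply: cos_gt0_pihalf; rewrite th1 andbT (lt_trans _ th0)// oppr_lt0 divr_gt0// pi_gt0. Qed.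

Lemma sin_th : 0 < sin th.
Proof. by apply: sin_gt0_pihalf; rewrite th0 th1. Qed.

Lemma cabs_eith : cabs (eith th) = 1.
Proof. by rewrite /cabs /eith /= cos2Dsin2 sqrtr1. Qed.

Lemma tau_gt t : a < t -> tau a th t - a%:C = (t - a)%:C * eith th.
Proof.
move=> ta; rewrite /tau.
have -> : t < - a = false.
  by apply/negbTE; rewrite -leNgt (le_trans _ (ltW ta))// (le_trans _ (ltW a0))// oppr_le0 ltW.
have -> : t <= a = false by apply/negbTE; rewrite -ltNge.
by rewrite addrAC subrr add0r.
Qed.

(* With [al + be = |s - a|] and [0 <= al <= 2 a], the three branches of [tau]
   are treated at once. *)
Lemma tau_decomp s : exists al be : R,
  [/\ 0 <= al, al <= 2 * a, 0 <= be, (al + be) ^+ 2 = (s - a) ^+ 2 &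
      (a%:C - tau a th s) ^+ 2 = (al%:C + be%:C * eith th) ^+ 2].
Proof.
have [sa|sa] := ltP a s.
  exists 0, (s - a); split; rewrite ?add0r//; [by rewrite mulr_ge0// ltW|by rewrite subr_ge0 ltW|].
  by rewrite -tau_gt// -sqrrN opprB.
have [sa'|sa'] := ltP s (- a).
  exists (2 * a), (- (s + a)); split => //; [by rewrite mulr_ge0// ltW|lra|by ring|].
  rewrite /tau sa'; congr (_ ^+ 2).
  by rewrite !rmorphD !rmorphN rmorphD rmorphM /= rmorph_nat; ring.
exists (a - s), 0; split => //; [lra|lra|by rewrite addr0 -sqrrN opprB|].
have -> : tau a th s = s%:C by rewrite /tau ltNge sa' /= sa.
by rewrite mul0r addr0 rmorphB.
Qed.

(** By [tau_decomp], [Q = (al + be e^(i th))^2 + u^2 e^(2 i th)]. The lower bound on [|Q|] is the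
    real part of [e^(-i th) Q], whose terms are all nonnegative. The imaginary part is at least
    [(be^2 + u^2) sin(2 th)], and [be^2 + u^2 >= |Q| / 4] when [|Q| >= 16 a^2], because the
    unrotated length [al] is at most [2 a]. *)
Lemma Qk_facts t s : a < t ->
  [/\ 0 < Im (Qk t s), cos th * rsq t s <= cabs (Qk t s) &
   16 * a ^+ 2 <= cabs (Qk t s) ->
     sin th * cos th / 2 * cabs (Qk t s) <= Im (Qk t s)].
Proof.
move=> ta; have [al [be [al0 al2 be0 abE e]]] := tau_decomp s.
rewrite /Qk e tau_gt// /rsq -abE; set u := t - a.
have u0 : 0 < u by rewrite subr_gt0.
have c0 := cos_th; have s0 := sin_th; have cs := cos2Dsin2 th.
set c := cos th in c0 cs *; set sg := sin th in s0 cs *.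
set Q := _ + _.
have uu : 0 < u ^+ 2 by rewrite exprn_gt0.
have bb : 0 <= be ^+ 2 by exact: sqr_ge0.
have ab : 0 <= al * be by rewrite mulr_ge0.
have sc : 0 < sg * c by rewrite mulr_gt0.
have imQ : Im Q = 2 * (al * be * sg) + (be ^+ 2 + u ^+ 2) * (2 * (sg * c)).
  by rewrite /Q /eith !expr2 ?cimD ?creM ?cimM ?creD ?cimD ?creM ?cimM /= -/c -/sg; ring.
have reQ : Re Q = al ^+ 2 + 2 * (al * be * c) + (be ^+ 2 + u ^+ 2) * (c ^+ 2 - sg ^+ 2).
  by rewrite /Q /eith !expr2 ?creD ?creM ?cimM ?creD ?cimD ?creM ?cimM /= -/c -/sg; ring.
have imQ2 : (be ^+ 2 + u ^+ 2) * (2 * (sg * c)) <= Im Q.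
  by rewrite imQ lerDr mulr_ge0// mulr_ge0// ltW.
split.
- apply: lt_le_trans imQ2; rewrite mulr_gt0//; last by rewrite mulr_gt0.
  by rewrite ltr_wpDl.
- have h : cabs Q = cabs (Q * (c -i* sg)).
    by rewrite cabsM [X in _ * X](_ : _ = 1) ?mulr1// /cabs /= sqrrN cs sqrtr1.
  rewrite h (le_trans _ (Re_le_cabs _))// (le_trans _ (ler_norm _))//.
  have -> : Re (Q * (c -i* sg)) = Re Q * c + Im Q * sg by rewrite creM /= mulrN opprK.
  rewrite imQ reQ.
  have c1 : c <= 1 by rewrite /c cos_le1.
  have -> : (al ^+ 2 + 2 * (al * be * c) + (be ^+ 2 + u ^+ 2) * (c ^+ 2 - sg ^+ 2)) * c +
    (2 * (al * be * sg) + (be ^+ 2 + u ^+ 2) * (2 * (sg * c))) * sg =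
    al ^+ 2 * c + 2 * (al * be) * (c ^+ 2 + sg ^+ 2) + (be ^+ 2 + u ^+ 2) * c * (c ^+ 2 + sg ^+ 2) by ring.
  rewrite cs !mulr1.
  have : 0 <= (1 - c) * (al * be) by rewrite mulr_ge0// subr_ge0.
  by nra.
move=> h16; apply: le_trans imQ2.
have aQ : cabs Q <= 8 * a ^+ 2 + 2 * (be ^+ 2 + u ^+ 2).
  rewrite /Q (le_trans (cabsD _ _))// !cabsX cabsM cabs_eith mulr1 cabsC (gtr0_norm u0).
  have h1 : cabs (al%:C + be%:C * eith th) <= al + be.
    by rewrite (le_trans (cabsD _ _))// cabsM cabs_eith mulr1 !cabsC !ger0_norm.
  have h2 : cabs (al%:C + be%:C * eith th) ^+ 2 <= (al + be) ^+ 2.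
    by apply: lerXn2r => //; rewrite nnegrE ?cabs_ge0// addr_ge0.
  have h3 : al ^+ 2 <= (2 * a) ^+ 2 by apply: lerXn2r => //; rewrite nnegrE// mulr_ge0// ltW.
  have h4 : 0 <= (al - be) ^+ 2 by exact: sqr_ge0.
  by nra.
have h4 : cabs Q / 4 <= be ^+ 2 + u ^+ 2 by lra.
have : 0 <= (be ^+ 2 + u ^+ 2 - cabs Q / 4) * (sg * c).
  by rewrite mulr_ge0 ?(ltW sc)// subr_ge0.
by nra.
Qed.

Definition Rk (t s : R) : C := csqrt (Qk t s).

(** For [R = x + i y], [Im Q = 2 x y] and [x <= |R|] turn the sector containing [Q] into one
    containing [R]; the threshold [16 a^2] becomes [4 a]. *)
Lemma Rk_facts t s : a < t ->
  [/\ 0 < Re (Rk t s), 0 < Im (Rk t s), Rk t s ^+ 2 = Qk t s,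
      cos th * rsq t s <= cabs (Rk t s) ^+ 2 &
      4 * a <= cabs (Rk t s) -> sin th * cos th / 4 * cabs (Rk t s) <= Im (Rk t s)].
Proof.
move=> ta; have [q0 q1 q2] := Qk_facts s ta.
have [r0 i0 e ae] := csqrtP q0.
split => //; first by rewrite ae.
move=> h4.
have h16 : 16 * a ^+ 2 <= cabs (Qk t s).
  rewrite -ae (_ : 16 * a ^+ 2 = (4 * a) ^+ 2); last by ring.
  by apply: lerXn2r => //; rewrite nnegrE ?cabs_ge0// mulr_ge0// ltW.
have := q2 h16; rewrite -ae -[X in _ <= Im X]e -/(Rk t s) [in Im _]expr2 cimM.
set x := Re (Rk t s) in r0 *; set y := Im (Rk t s) in i0 *; set r := cabs (Rk t s) in ae *.
have xr : x <= r by rewrite (le_trans (ler_norm _))// Re_le_cabs.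
have sc : 0 < sin th * cos th by rewrite mulr_gt0 ?sin_th ?cos_th.
set sg := sin th * cos th in sc *.
move=> h; rewrite -(ler_pM2r r0).
have : 0 <= sg * (r * (r - x)) by rewrite (mulr_ge0 (ltW sc))// mulr_ge0 ?subr_ge0 ?cabs_ge0.
by nra.
Qed.

Lemma kDE t s : a < t -> kerD t s =
  ('i * k%:C * ((t - a)%:C * eith th) / 2) * hankel1 (k%:C * Rk t s) / Rk t s * dtau a th s.
Proof. by move=> ta; rewrite /kerD /hker /Rw -/(Qk t s) -/(Rk t s) tau_gt. Qed.

Lemma cabs_dtau s : cabs (dtau a th s) = 1.
Proof. by rewrite /dtau; case: ifP => _; rewrite ?cabs1 ?cabs_eith. Qed.

(** Below [4 a] the pole gives [1/r], beyond it the sector gives [1/r^2]; the bound covers both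
    regimes. *)
Lemma hankel1_Rk : exists2 K : R, 0 <= K & forall t s, a < t ->
  cabs (hankel1 (k%:C * Rk t s)) <= K / (cabs (Rk t s) * (1 + cabs (Rk t s))).
Proof.
have a4 : 0 < 4 * a by rewrite mulr_gt0.
have [K1 K10 h1] := hankel1_small (k * (4 * a)).
pose dl := sin th * cos th / 4.
have dl0 : 0 < dl by rewrite /dl !mulr_gt0 ?sin_th ?cos_th.
pose K2 := (K1 * (4 * a) + k^-1) * (1 + 4 * a).
pose K3 := 16 / dl ^+ 2 / k ^+ 2 * ((4 * a)^-1 + 1).
have K20 : 0 <= K2.
  by rewrite /K2 mulr_ge0 ?addr_ge0 ?mulr_ge0 ?invr_ge0// ltW.
have K30 : 0 <= K3.
  by rewrite /K3 mulr_ge0 ?addr_ge0 ?mulr_ge0 ?invr_ge0 ?exprn_ge0// ltW.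
exists (K2 + K3); first exact: addr_ge0.
move=> t s ta; have [r0 i0 e e1 e2] := Rk_facts s ta.
set r := Rk t s in r0 i0 e2 *.
have rn0 : r != 0 by apply: contraTneq r0 => ->; rewrite ltxx.
have ar : 0 < cabs r by rewrite cabs_gt0.
have kn0 : k%:C != 0 :> C by rewrite eq_complex/= negb_and gt_eqF.
have akr : cabs (k%:C * r) = k * cabs r by rewrite cabsM cabsC gtr0_norm.
have rk0 : 0 < Re (k%:C * r) by rewrite creM /= mul0r subr0 mulr_gt0.
have ik0 : 0 < Im (k%:C * r) by rewrite cimM /= mul0r addr0 mulr_gt0.
have d0 : 0 < cabs r * (1 + cabs r) by rewrite mulr_gt0// ltr_pwDl// ltW.
have [h4|h4] := leP (4 * a) (cabs r).
  apply: (@le_trans _ _ (K3 / (cabs r * (1 + cabs r)))); last first.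
    by apply: ler_wpM2r; [rewrite invr_ge0 ltW|rewrite lerDr].
  have := @hankel1_decay _ (k%:C * r) dl rk0 dl0.
  rewrite mulf_neq0// akr => /(_ isT) h.
  apply: (le_trans (h _)).
    rewrite cimM /= mul0r addr0 mulrCA; apply: ler_wpM2l; first exact: ltW.
    exact: e2.
  rewrite ler_pdivlMr// /K3.
  have rinv : (cabs r)^-1 <= (4 * a)^-1 by rewrite lef_pV2 ?posrE.
  rewrite (_ : 16 / dl ^+ 2 / (k * cabs r) ^+ 2 * (cabs r * (1 + cabs r)) =
    16 / dl ^+ 2 / k ^+ 2 * ((cabs r)^-1 + 1)); last first.
    by field; rewrite !gt_eqF.
  apply: ler_wpM2l; last by rewrite lerD2r.
  by rewrite ?mulr_ge0 ?invr_ge0 ?exprn_ge0// ltW.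
apply: (@le_trans _ _ (K2 / (cabs r * (1 + cabs r)))); last first.
  by apply: ler_wpM2r; [rewrite invr_ge0 ltW|rewrite lerDl].
have kr : cabs (k%:C * r) <= k * (4 * a) by rewrite akr ler_wpM2l ?(ltW k0)// ltW.
have := h1 _ rk0 ik0 kr.
set H := hankel1 _; set X := 2 * 'i / _ => hX.
have aX : cabs X <= k^-1 / cabs r.
  rewrite /X !cabsM cabs_nat cabsi mulr1 cabsV !cabsM !cabsC (gtr0_norm k0) (gtr0_norm (pi_gt0 R)).
  rewrite invfM mulrA invfM ler_piMl ?mulr_ge0 ?invr_ge0 ?(ltW k0) ?cabs_ge0//.
  by rewrite ler_pdivrMr ?pi_gt0// mul1r pi_ge2.
have hH : cabs H <= K1 + k^-1 / cabs r.
  rewrite -[H](addrK X) (le_trans (cabsB _ _))// lerD//.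
rewrite (le_trans hH)// ler_pdivlMr// /K2.
rewrite (_ : (K1 + k^-1 / cabs r) * (cabs r * (1 + cabs r)) =
  (K1 * cabs r + k^-1) * (1 + cabs r)); last by field; rewrite !gt_eqF.
apply: ler_pM.
- by rewrite addr_ge0 ?mulr_ge0 ?invr_ge0 ?cabs_ge0// ltW.
- by rewrite addr_ge0 ?cabs_ge0.
- by rewrite lerD2r ler_wpM2l// ltW.
- by rewrite lerD2l ltW.
Qed.

Lemma rsq_gt0 t s : a < t -> 0 < rsq t s.
Proof. by move=> ta; rewrite /rsq ltr_pwDl ?sqr_ge0// exprn_gt0// subr_gt0. Qed.

Lemma kD_bound : exists2 K : R, 0 <= K & forall t s, a < t ->
  cabs (kerD t s) <= K * ((t - a) / rsq t s / (1 + Num.sqrt (rsq t s))).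
Proof.
have [K1 K10 h] := hankel1_Rk.
have c0 := cos_th; have c1 : cos th <= 1 by exact: cos_le1.
have sc0 : 0 < Num.sqrt (cos th) by rewrite sqrtr_gt0.
have sc1 : Num.sqrt (cos th) <= 1 by rewrite -[leRHS]sqrtr1 ler_sqrt.
exists (k / 2 * K1 / cos th / Num.sqrt (cos th)).
  by rewrite ?mulr_ge0 ?invr_ge0// ltW.
move=> t s ta; have [r0 i0 e e1 e2] := Rk_facts s ta.
have hh := h t s ta; have r2 := rsq_gt0 s ta.
have u0 : 0 < t - a by rewrite subr_gt0.
have rn0 : Rk t s != 0 by apply: contraTneq r0 => ->; rewrite ltxx.
have ar : 0 < cabs (Rk t s) by rewrite cabs_gt0.
rewrite kDE// !cabsM !cabsV cabs_dtau mulr1 cabs_nat cabsi mul1r !cabsC cabs_eith mulr1.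
rewrite (gtr0_norm k0) (gtr0_norm u0).
set r := cabs (Rk t s) in hh e1 ar *.
set q := Num.sqrt (rsq t s).
have q0 : 0 <= q by exact: sqrtr_ge0.
have rq : Num.sqrt (cos th) * q <= r.
  rewrite /q -sqrtrM ?(ltW c0)// -[leRHS]ger0_norm ?(ltW ar)// -sqrtr_sqr.
  by rewrite ler_sqrt// exprn_ge0// ltW.
apply: (@le_trans _ _ (k * (t - a) / 2 * (K1 / (r * (1 + r))) / r)).
  apply: ler_wpM2r; first by rewrite invr_ge0 ltW.
  by apply: ler_wpM2l => //; rewrite !mulr_ge0 ?invr_ge0// ltW.
rewrite (_ : k * (t - a) / 2 * (K1 / (r * (1 + r))) / r =
  (k / 2 * K1 * (t - a)) * ((r ^+ 2)^-1 * (1 + r)^-1)); last first.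
  by field; rewrite !gt_eqF// ltr_pwDl// ltW.
rewrite (_ : _ * ((t - a) / rsq t s / (1 + q)) = (k / 2 * K1 * (t - a)) *
   ((cos th * rsq t s)^-1 * (Num.sqrt (cos th) * (1 + q))^-1)); last first.
  by field; rewrite !gt_eqF// ltr_pwDl.
apply: ler_wpM2l; first by rewrite ?mulr_ge0 ?invr_ge0// ltW.
have q1 : 0 < 1 + q by rewrite ltr_pwDl.
apply: ler_pM; rewrite ?invr_ge0 ?exprn_ge0 ?addr_ge0 ?(ltW ar)//.
  by rewrite lef_pV2 ?posrE ?exprn_gt0 ?mulr_gt0.
rewrite lef_pV2 ?posrE ?mulr_gt0// ?ltr_pwDl ?(ltW ar)//.
by rewrite mulrDr mulr1 lerD.
Qed.

(** For [t, s > a], [R^2 = e^(2 i th) rsq], and the factors [e^(i th)] from [tau] and from [dtau]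
    cancel this rotation exactly. With the pole [-2i / (pi k R)] of [hankel1], the factor [k]
    cancels as well, which leaves [u / (pi rsq)]. *)
Lemma kD_near : exists2 K : R, 0 <= K & forall t s, a < t -> a < s -> rsq t s <= 1 ->
  cabs (kerD t s - ((t - a) / (pi * rsq t s))%:C) <= K.
Proof.
have [K1 K10 h] := hankel1_small k.
have c0 := cos_th; have sc0 : 0 < Num.sqrt (cos th) by rewrite sqrtr_gt0.
exists (k / 2 * K1 / Num.sqrt (cos th)); first by rewrite ?mulr_ge0 ?invr_ge0// ltW.
move=> t s ta sa rr1; have [r0 i0 e e1 e2] := Rk_facts s ta.
have r2 := rsq_gt0 s ta.
have u0 : 0 < t - a by rewrite subr_gt0.
set r := Rk t s in r0 i0 e e1 e2 *.
have rn0 : r != 0 by apply: contraTneq r0 => ->; rewrite ltxx.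
have ar : 0 < cabs r by rewrite cabs_gt0.
have Qe : Qk t s = (rsq t s)%:C * eith th ^+ 2.
  rewrite /Qk tau_gt// -[X in _ + X]sqrrN opprB tau_gt// !exprMn -mulrDl.
  by congr (_ * _); rewrite /rsq -!rmorphXn -rmorphD.
have ar2 : cabs r ^+ 2 = rsq t s.
  by rewrite -cabsX e Qe cabsM cabsX cabs_eith expr1n mulr1 cabsC gtr0_norm.
have akr : cabs (k%:C * r) = k * cabs r by rewrite cabsM cabsC gtr0_norm.
have rk0 : 0 < Re (k%:C * r) by rewrite creM /= mul0r subr0 mulr_gt0.
have ik0 : 0 < Im (k%:C * r) by rewrite cimM /= mul0r addr0 mulr_gt0.
have ar1 : cabs r <= 1 by rewrite -(ler_pXn2r (ltn0Sn 1))// ?nnegrE ?cabs_ge0// ar2 expr1n.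
have kr : cabs (k%:C * r) <= k by rewrite akr ler_piMr// ltW.
have hX := h _ rk0 ik0 kr.
have dE : dtau a th s = eith th.
  by rewrite /dtau leNgt (lt_le_trans sa)// ler_norm.
have en0 : eith th != 0 by rewrite -cabs_gt0 cabs_eith.
have kn0 : k%:C != 0 :> C by rewrite eq_complex/= negb_and gt_eqF.
have p0 : pi%:C != 0 :> C by rewrite eq_complex/= negb_and gt_eqF ?pi_gt0.
have rrE : (rsq t s)%:C = r ^+ 2 / eith th ^+ 2 :> C.
  by rewrite e Qe mulfK// expf_neq0.
have -> : kerD t s - ((t - a) / (pi * rsq t s))%:C =
  ('i * k%:C * ((t - a)%:C * eith th) / 2) *
    (hankel1 (k%:C * r) + 2 * 'i / (pi%:C * (k%:C * r))) / r * eith th.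
  rewrite kDE// -/r dE fmorph_div rmorphM /= rrE.
  have ii : ('i : C) * 'i = -1 by rewrite -expr2 sqr_i.
  move: (hankel1 _) ((t - a)%:C) => H U.
  rewrite mulrDr mulrDl mulrDl; congr (_ + _).
  have -> : 'i * k%:C * (U * eith th) / 2 * (2 * 'i / (pi%:C * (k%:C * r))) / r * eith th =
     'i * 'i * (U * eith th ^+ 2 / (pi%:C * r ^+ 2)).
    clear -rn0 kn0 p0; move: (pi%:C : C) p0 (k%:C : C) kn0 => p p0 k1 k1n0.
    by field; rewrite rn0 k1n0 p0.
  rewrite ii mulN1r; congr (- _).
  clear -rn0 en0 p0; move: (pi%:C : C) p0 => p p0.
  by field; rewrite rn0 p0 en0.
rewrite !cabsM !cabsV cabs_nat cabsi mul1r !cabsC cabs_eith !mulr1 (gtr0_norm k0) (gtr0_norm u0).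
have ur : (t - a) / cabs r <= 1.
  rewrite ler_pdivrMr// mul1r -(ler_pXn2r (ltn0Sn 1)) ?nnegrE ?cabs_ge0 ?(ltW u0)//.
  by rewrite ar2 /rsq lerDl sqr_ge0.
rewrite (_ : _ / cabs r = (k / 2 * cabs (hankel1 (k%:C * r) + 2 * 'i / (pi%:C * (k%:C * r)))) *
  ((t - a) / cabs r)); last by field; rewrite gt_eqF.
apply: (@le_trans _ _ (k / 2 * K1 * 1)).
  apply: ler_pM => //; rewrite ?mulr_ge0 ?invr_ge0 ?cabs_ge0 ?(ltW k0) ?(ltW u0)//.
  by apply: ler_wpM2l => //; rewrite mulr_ge0 ?invr_ge0// ltW.
apply: ler_wpM2l; first by rewrite !mulr_ge0 ?invr_ge0// ltW.
by rewrite invf_ge1// -[leRHS]sqrtr1 ler_sqrt// cos_le1.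
Qed.

End KernelGeometry.

(** * The singular part of the kernel and the bounded remainder *)

Section Kernels.
Variable R : realType.
Local Notation C := R[i].
Variables (a k th : R).
Hypotheses (a0 : 0 < a) (k0 : 0 < k) (th0 : 0 < th) (th1 : th < pi / 2).
Local Notation rr := (rsq a).
Local Notation kD := (kerD a k th).

(* The factor [1 + rr] keeps the singularity at [(a, a)] but makes [kA] decay, so that the
   remainder [kK] is square integrable. *)
Definition kA (t s : R) : R :=
  if (a < t) && (a < s) then (t - a) / (pi * rr t s * (1 + rr t s)) else 0.

(** The kernel is also cut off on [[-a, a]], where elements of [L20] vanish almost everywhere: it is
    singular at [(a, a)] from that side too, and [kK_bound] would fail. *)
Definition kK (t s : R) : C :=
  (if (s < - a) || (a < s) then kD t s else 0) - (kA t s)%:C.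

Lemma kA_ge0 t s : 0 <= kA t s.
Proof.
rewrite /kA; case: ifP => // /andP[ta sa].
have := rsq_gt0 s ta; have := pi_gt0 R; move: (rr t s) => r p0 r0.
have r1 : 0 < 1 + r by rewrite addr_gt0.
by rewrite divr_ge0 ?subr_ge0 ?(ltW ta)// ltW// (mulr_gt0 (mulr_gt0 p0 r0)).
Qed.

Lemma kA_bound t s : a < t -> kA t s <= pi^-1 * ((t - a) / rr t s).
Proof.
move=> ta; have r0 := rsq_gt0 s ta; have p0 := pi_gt0 R.
have u0 : 0 <= t - a by rewrite subr_ge0 ltW.
rewrite /kA; case: ifP => _; last by rewrite !mulr_ge0 ?invr_ge0// ltW.
move: (rr t s) r0 => r r0.
have -> : (t - a) / (pi * r * (1 + r)) = pi^-1 * ((t - a) / r) * (1 + r)^-1.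
  have r1 : 0 < 1 + r by rewrite addr_gt0.
  clear -p0 r0 r1; move: (pi : R) p0 => p p0.
  by field; rewrite ?(lt0r_neq0 p0) ?(lt0r_neq0 r0) ?(lt0r_neq0 r1).
rewrite ler_piMr ?mulr_ge0 ?invr_ge0 ?(ltW r0) ?(ltW p0)//.
by rewrite invf_le1 ?addr_gt0// lerDl ltW.
Qed.

Lemma sqr_u_le t s : (t - a) ^+ 2 <= rr t s.
Proof. by rewrite /rsq lerDl sqr_ge0. Qed.

Lemma u_le t s : a < t -> t - a <= 1 + Num.sqrt (rr t s).
Proof.
move=> ta; rewrite (@le_trans _ _ (Num.sqrt (rr t s)))// ?lerDr//.
rewrite -[leLHS]ger0_norm; last by rewrite subr_ge0 ltW.
by rewrite -sqrtr_sqr ler_sqrt ?sqr_u_le// ltW// rsq_gt0.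
Qed.

Lemma kD_le : exists2 K : R, 0 <= K & forall t s, a < t ->
  cabs (kD t s) <= K * ((t - a) / rr t s) /\ cabs (kD t s) <= K / rr t s.
Proof.
have [K K0 h] := kD_bound a0 k0 th0 th1.
exists K => // t s ta; have r0 := rsq_gt0 s ta.
have q0 : 0 < 1 + Num.sqrt (rr t s) by rewrite ltr_pwDl// sqrtr_ge0.
have u0 : 0 <= t - a by rewrite subr_ge0 ltW.
split; apply: (le_trans (h _ _ ta)); apply: ler_wpM2l => //.
  rewrite ler_piMr ?mulr_ge0 ?invr_ge0 ?(ltW r0)//.
  by rewrite invf_le1// lerDl sqrtr_ge0.
rewrite mulrAC ler_piMl ?invr_ge0 ?(ltW r0)//.
by rewrite ler_pdivrMr// mul1r u_le.
Qed.

(** Integrability and mapping into [L^2] are drawn from this bound, compactness from [kK_bound]. *)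
Lemma kK_adm : exists2 K : R, 0 <= K & forall t s, a < t ->
  cabs (kK t s) <= K * ((t - a) / rr t s).
Proof.
have [K K0 h] := kD_le; have p0 := pi_gt0 R.
exists (K + pi^-1); first by rewrite addr_ge0// invr_ge0 ltW.
move=> t s ta; have [h1 _] := h t s ta; have r0 := rsq_gt0 s ta.
have u0 : 0 <= t - a by rewrite subr_ge0 ltW.
rewrite /kK (le_trans (cabsB _ _))// mulrDl lerD//; last first.
  by rewrite cabsC ger0_norm ?kA_ge0// kA_bound.
by case: ifP => // _; rewrite cabs0 !mulr_ge0 ?invr_ge0// ltW.
Qed.

Lemma kK_bound : exists2 K : R, 0 <= K & forall t s, a < t ->
  cabs (kK t s) <= K / (1 + rr t s).
Proof.
have [K K0 h] := kD_le; have [K' K'0 h'] := kD_near a0 k0 th0 th1.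
have p0 := pi_gt0 R; have p2 := pi_ge2 R.
(* For [s < -a] the distance to [a] is at least [2 a], so [rr >= m] and the kernel is not
   singular. *)
pose m := 4 * a ^+ 2.
have m0 : 0 < m by rewrite mulr_gt0// exprn_gt0.
exists (2 * (K' + 1) + (2 * K + 1) + K * (1 + m^-1)).
  by rewrite !addr_ge0 ?mulr_ge0 ?addr_ge0 ?invr_ge0// ltW.
move=> t s ta; have r0 := rsq_gt0 s ta; have [_ hD] := h t s ta.
have u0 : 0 <= t - a by rewrite subr_ge0 ltW.
set r := rr t s in r0 hD *.
have r1 : 0 < 1 + r by rewrite addr_gt0.
have uu : (t - a) ^+ 2 <= r by exact: sqr_u_le.
have big (M : R) : 0 < M -> M <= r -> K / r <= K * (1 + M^-1) / (1 + r).
  move=> M0 Mr; rewrite -mulrA; apply: ler_wpM2l => //.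
  rewrite ler_pdivlMr// mulrC mulrDl mul1r mulfV ?gt_eqF// addrC lerD2l.
  by rewrite lef_pV2 ?posrE.
have mono (x y : R) : x <= y -> x / (1 + r) <= y / (1 + r).
  by move=> xy; rewrite ler_wpM2r// invr_ge0 ltW.
have c1 : 0 <= 2 * (K' + 1) by rewrite mulr_ge0 ?addr_ge0.
have c2 : 0 <= 2 * K + 1 by rewrite addr_ge0 ?mulr_ge0.
have c3 : 0 <= K * (1 + m^-1) by rewrite mulr_ge0 ?addr_ge0 ?invr_ge0// ltW.
rewrite /kK /kA ta /=; have [sa|sa] := ltP a s; last first.
  rewrite orbF subr0; case: ifP => [sa'|_]; last first.
    by rewrite cabs0 divr_ge0 ?(ltW r1)// (addr_ge0 (addr_ge0 c1 c2)).
  rewrite (le_trans hD)// (le_trans (big m _ _))//.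
    rewrite /r /rsq /m -[leLHS]add0r lerD ?sqr_ge0//.
    have := a0; nra.
  by apply: mono; rewrite lerDr addr_ge0.
rewrite orbT; have [rl|rl] := leP r 1.
  rewrite -/r.
  (* Near [(a, a)] the singularities cancel: [u / (pi r) - u / (pi r (1 + r)) = u / (pi (1 +
     r))]. *)
  have -> : kD t s - ((t - a) / (pi * r * (1 + r)))%:C =
     (kD t s - ((t - a) / (pi * r))%:C) + ((t - a) / (pi * (1 + r)))%:C.
    rewrite -addrA; congr (_ + _); rewrite -rmorphN -rmorphN -rmorphD; congr (_%:C).
    clear -p0 r0 r1; move: (pi : R) p0 r r0 r1 => p p0 r r0 r1.
    by field; rewrite ?(lt0r_neq0 p0) ?(lt0r_neq0 r0) ?(lt0r_neq0 r1).
  rewrite (le_trans (cabsD _ _))// (@le_trans _ _ (2 * (K' + 1) / (1 + r)))//; last first.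
    by apply: mono; rewrite -addrA lerDl addr_ge0.
  apply: (@le_trans _ _ (K' + 1)); last first.
    by rewrite ler_pdivlMr// mulrC ler_wpM2r ?addr_ge0//; lra.
  rewrite lerD ?h'// cabsC ger0_norm; last by rewrite divr_ge0// (mulr_ge0 (ltW p0) (ltW r1)).
  have u1 : t - a <= 1.
    by rewrite -(ler_pXn2r (ltn0Sn 1)) ?nnegrE// expr1n (le_trans uu).
  rewrite ler_pdivrMr ?mulr_gt0// mul1r (le_trans u1)// -[leLHS]mulr1.
  by apply: ler_pM => //; [lra|rewrite lerDl ltW].
rewrite (le_trans (cabsB _ _))//.
apply: (@le_trans _ _ (2 * K / (1 + r) + (1 + r)^-1)); last first.
  rewrite -[X in _ + X]mul1r -mulrDl; apply: mono.
  by rewrite (@le_trans _ _ (2 * (K' + 1) + (2 * K + 1)))// ?lerDr// lerDl.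
apply: lerD.
  rewrite (le_trans hD)// (le_trans (big 1 _ (ltW rl)))// invr1.
  by rewrite (mulrC 2 K).
have ur : t - a <= r.
  rewrite -(ler_pXn2r (ltn0Sn 1)) ?nnegrE ?(ltW r0)// (le_trans uu)//.
  by rewrite expr2 ler_peMl ?(ltW r0)// ltW.
rewrite -/r cabsC ger0_norm; last first.
  by rewrite divr_ge0// (mulr_ge0 (mulr_ge0 (ltW p0) (ltW r0)) (ltW r1)).
rewrite invfM mulrA ler_piMl ?invr_ge0 ?(ltW r1)//.
rewrite ler_pdivrMr ?mulr_gt0// mul1r (le_trans ur)// ler_peMl ?(ltW r0)//; lra.
Qed.

Section measurability.
Context d (T : measurableType d).

Lemma cmeas_tau (f : T -> R) : measurable_fun setT f -> cmeas (fun x => tau a th (f x)).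
Proof.
move=> mf; rewrite /tau.
have mc (c : R) : measurable_fun setT (fun _ : T => c) by exact: measurable_cst.
apply: cmeas_if; first exact: measurable_fun_ltr.
  apply: cmeasD; first exact: cmeas_cst.
  apply: cmeasM; last exact: cmeas_cst.
  by apply: cmeasC; exact: measurable_funD.
apply: cmeas_if; [exact: measurable_fun_ler|exact: cmeasC|].
apply: cmeasD; first exact: cmeas_cst.
apply: cmeasM; last exact: cmeas_cst.
by apply: cmeasC; apply: measurable_funB.
Qed.

Lemma cmeas_dtau (f : T -> R) : measurable_fun setT f -> cmeas (fun x => dtau a th (f x)).
Proof.
move=> mf; rewrite /dtau.
apply: cmeas_if; [|exact: cmeas_cst|exact: cmeas_cst].
apply: measurable_fun_ler; last exact: measurable_cst.
by apply: measurableT_comp => //; exact: normr_measurable.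
Qed.

Lemma cmeas_kD (f g : T -> R) : measurable_fun setT f -> measurable_fun setT g ->
  cmeas (fun x => kD (f x) (g x)).
Proof.
move=> mf mg; rewrite /kerD /hker.
have m1 : cmeas (fun x => tau a th (f x) - a%:C).
  by apply: cmeasD; [exact: cmeas_tau|exact: cmeas_cst].
have m2 : cmeas (fun x => a%:C - tau a th (g x)).
  by apply: cmeasD; [exact: cmeas_cst|apply: cmeasN; exact: cmeas_tau].
have m3 : cmeas (fun x => Rw (tau a th (f x) - a%:C) (a%:C - tau a th (g x))).
  by apply: cmeas_csqrt; apply: cmeasD; exact: cmeasX.
apply: cmeasM; last exact: cmeas_dtau.
apply: cmeasM; last exact: cmeasV.
apply: cmeasM.
  apply: cmeasM; last exact: cmeas_cst.
  by apply: cmeasM => //; exact: cmeas_cst.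
by apply: cmeas_hankel1; apply: cmeasM => //; exact: cmeas_cst.
Qed.

Lemma measurable_rr (f g : T -> R) : measurable_fun setT f -> measurable_fun setT g ->
  measurable_fun setT (fun x => rr (f x) (g x)).
Proof.
move=> mf mg; apply: measurable_funD; apply: measurable_funX;
  by apply: measurable_funB => //; exact: measurable_cst.
Qed.

Lemma measurable_kA (f g : T -> R) : measurable_fun setT f -> measurable_fun setT g ->
  measurable_fun setT (fun x => kA (f x) (g x)).
Proof.
move=> mf mg; rewrite /kA.
have mc (c : R) : measurable_fun setT (fun _ : T => c) by exact: measurable_cst.
apply: measurable_fun_ifT => //.
  by apply: measurable_and; apply: measurable_fun_ltr.
apply: measurable_funM; first by apply: measurable_funB.
apply: measurable_fun_invr; apply: measurable_funM.
  by apply: measurable_funM => //; exact: measurable_rr.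
by apply: measurable_funD => //; exact: measurable_rr.
Qed.

Lemma cmeas_kK (f g : T -> R) : measurable_fun setT f -> measurable_fun setT g ->
  cmeas (fun x => kK (f x) (g x)).
Proof.
move=> mf mg; apply: cmeasD; last by apply: cmeasN; apply: cmeasC; exact: measurable_kA.
have mc (c : R) : measurable_fun setT (fun _ : T => c) by exact: measurable_cst.
apply: cmeas_if; [|exact: cmeas_kD|exact: cmeas_cst].
by apply: measurable_or; exact: measurable_fun_ltr.
Qed.

End measurability.

(** Since [t > a], [Im Q > 0] and [Re R > 0], so neither the square root nor the logarithm meets its
    cut. The compactness proof uses this together with [kK_bound] and [kK_adm]. *)
Lemma kK_cvg (t s : R) : a < t -> ccvg (nbhs t) (fun t' => kK t' s) (kK t s).
Proof.
move=> ta.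
have near_a : \forall t' \near nbhs t, a < t' by exact: lt_nbhsr.
have [q0 _ _] := Qk_facts a0 th0 th1 s ta.
have [r0 i0 e _ _] := Rk_facts a0 th0 th1 s ta.
have idc : (x : R) @[x --> nbhs t] --> t by exact: cvg_id.
have idB : (x - a : R) @[x --> nbhs t] --> t - a by apply: cvgB => //; exact: cvg_cst.
have rn0 : Rk a th t s != 0 by apply: contraTneq r0 => ->; rewrite ltxx.
have m1 : ccvg (nbhs t) (fun x => tau a th x - a%:C) (tau a th t - a%:C).
  apply: (@ccvg_near _ _ _ _ (fun x => (x - a)%:C * eith th)).
    by apply: filterS near_a => x xa; rewrite tau_gt.
  rewrite tau_gt//; apply: ccvgM; last exact: ccvg_cst.
  by apply: ccvgC.
have m3 : ccvg (nbhs t) (fun x => Rk a th x s) (Rk a th t s).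
  apply: ccvg_csqrt => //; apply: ccvgD; last exact: ccvg_cst.
  exact: ccvgX.
apply: ccvgD.
  case: ifP => _; last exact: ccvg_cst.
  apply: ccvgM; last exact: ccvg_cst.
  apply: ccvgM; last exact: ccvgV.
  apply: ccvgM.
    apply: ccvgM; last exact: ccvg_cst.
    by apply: ccvgM => //; exact: ccvg_cst.
  apply: ccvg_hankel1; last by apply: ccvgM => //; exact: ccvg_cst.
  by rewrite creM /= mul0r subr0 mulr_gt0.
apply: ccvgN; apply: ccvgC.
have p0 := pi_gt0 R; have rs0 := rsq_gt0 s ta.
have c1 : rr x s @[x --> nbhs t] --> rr t s.
  apply: cvgD; last exact: cvg_cst.
  by rewrite expr2; under eq_fun do rewrite expr2; exact: cvgM.
rewrite /kA ta /=.
apply: cvg_trans; first apply: (@near_eq_cvg _ _ _ _ (fun x => if a < s then (x - a) / (pi * rr x s * (1 + rr x s)) else 0)).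
  by apply: filterS near_a => x ->.
case: ifP => _; last exact: cvg_cst.
apply: cvgM => //; apply: cvgV; first by rewrite gt_eqF// !mulr_gt0// addr_gt0.
apply: cvgM; first by apply: cvgM => //; exact: cvg_cst.
by apply: cvgD => //; exact: cvg_cst.
Qed.

End Kernels.

(** * Schur's test and the integral behind its constant *)

Section Schur.
Variable R : realType.
Local Notation C := R[i].
Local Notation mu := (@lebesgue_measure R).

(** Bounds on the primitive replace its limits at the ends: the integral over each exhausting
    segment is at most [M - m], and monotone convergence passes this on to [D], even when [f] is
    unbounded near an end. *)
Lemma ge0_FTC_bigcup_le (f F : R -> R) (D : set R) (al be : nat -> R) (m M : R) :
  (forall n, al n < be n) -> nondecreasing_seq (fun n => `[al n, be n]%classic) ->
  D = \bigcup_n `[al n, be n]%classic ->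
  measurable_fun setT f ->
  (forall x, D x -> 0 <= f x) ->
  (forall x, D x -> {for x, continuous f}) ->
  (forall x : R, D x -> has_der F x (f x)) ->
  (forall x, D x -> m <= F x <= M) ->
  (\int[mu]_(x in D) (f x)%:E <= (M - m)%:E)%E.
Proof.
move=> ab nd DE mf f0 cf dF mM.
have inD n x : al n <= x <= be n -> D x by move=> h; rewrite DE; exists n => //=; rewrite in_itv.
have h n : (\int[mu]_(x in `[al n, be n]) (f x)%:E <= (M - m)%:E)%E.
  have Da : D (al n) by apply: (inD n); rewrite lexx ltW.
  have Db : D (be n) by apply: (inD n); rewrite lexx ltW.
  rewrite (@continuous_FTC2 _ f F (al n) (be n))//.
  - rewrite -EFinB lee_fin; have /andP[h1 h2] := mM _ Da; have /andP[h3 h4] := mM _ Db.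
    by rewrite lerB.
  - apply: continuous_in_subspaceT => x /[!inE]/=; rewrite in_itv/= => xab.
    by apply: cf; exact: inD xab.
  - split.
    + move=> x; rewrite in_itv/= => /andP[x1 x2].
      by have [] : has_der F x (f x) by apply/dF/(inD n); rewrite !ltW.
    + by apply: cvg_at_right_filter; exact: (der_continuous (dF _ Da)).
    + by apply: cvg_at_left_filter; exact: (der_continuous (dF _ Db)).
  - move=> x; rewrite in_itv/= => /andP[x1 x2].
    have h0 : is_derive x (1 : R) F (f x) by apply/dF/(inD n); rewrite !ltW.
    by rewrite derive1E derive_val.
have c := @ge0_nondecreasing_set_cvg_integral _ (measurableTypeR R) R (fun n => `[al n, be n]%classic)
   (fun x => (f x)%:E) mu nd.
have cD : (\int[mu]_(x in `[al i, be i]) (f x)%:E)%E @[i --> \oo] -->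
    (\int[mu]_(x in D) (f x)%:E)%E.
  rewrite DE; apply: c.
  - by move=> i; exact: measurable_itv.
  - by move=> i; apply/measurable_EFinP; exact: measurable_funTS.
  - by move=> i x /=; rewrite in_itv/= => xi; rewrite lee_fin f0//; exact: inD xi.
rewrite -(cvg_lim _ cD)//.
by apply: lime_le; [apply/cvg_ex; eexists; exact: cD|exact: nearW].
Qed.

Lemma ge0_FTC_oy_le (f F : R -> R) (c m M : R) :
  measurable_fun setT f -> (forall x, c < x -> 0 <= f x) ->
  (forall x, c < x -> {for x, continuous f}) ->
  (forall x : R, c < x -> has_der F x (f x)) ->
  (forall x, c < x -> m <= F x <= M) ->
  (\int[mu]_(x in `]c, +oo[) (f x)%:E <= (M - m)%:E)%E.
Proof.
move=> mf f0 cf dF mM.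
have inD x : `]c, +oo[%classic x = (c < x) by rewrite /= in_itv/= andbT.
apply: (@ge0_FTC_bigcup_le f F _ (fun n => c + n.+1%:R^-1) (fun n => c + n.+2%:R)) => //.
- move=> n; rewrite ltrD2l (@le_lt_trans _ _ 1)//; last by rewrite ltr1n.
  by rewrite invf_le1// ler1n.
- move=> i j ij; rewrite subsetEset => x /=; rewrite !in_itv/= => /andP[h1 h2].
  apply/andP; split.
    by apply: le_trans h1; rewrite lerD2l lef_pV2 ?posrE// ler_nat.
  by apply: (le_trans h2); rewrite lerD2l ler_nat.
- apply/seteqP; split => x.
    rewrite inD => cx.
    have [n1 h1] : exists n : nat, (x - c)^-1 <= n%:R.
      by exists (Num.truncn (x - c)^-1).+1; apply/ltW/truncnS_gt.
    have [n2 h2] : exists n : nat, (x - c) <= n%:R.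
      by exists (Num.truncn (x - c)).+1; apply/ltW/truncnS_gt.
    exists (n1 + n2)%N => //=; rewrite in_itv/=; apply/andP; split.
      rewrite -lerBrDl invf_ple ?posrE ?subr_gt0//.
      by rewrite (le_trans h1)// ler_nat -addnS leq_addr.
    by rewrite -lerBlDl (le_trans h2)// ler_nat -2!addnS -addSnnS -addSnnS leq_addl.
  move=> [n _] /=; rewrite !in_itv/= andbT => /andP[h _].
  by apply: lt_le_trans h; rewrite ltrDl.
- by move=> x; rewrite inD; exact: f0.
- by move=> x; rewrite inD; exact: cf.
- by move=> x; rewrite inD; exact: dF.
- by move=> x; rewrite inD; exact: mM.
Qed.

Lemma ge0_FTC_yo_le (f F : R -> R) (c m M : R) :
  measurable_fun setT f -> (forall x, x < c -> 0 <= f x) ->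
  (forall x, x < c -> {for x, continuous f}) ->
  (forall x : R, x < c -> has_der F x (f x)) ->
  (forall x, x < c -> m <= F x <= M) ->
  (\int[mu]_(x in `]-oo, c[) (f x)%:E <= (M - m)%:E)%E.
Proof.
move=> mf f0 cf dF mM.
have inD x : `]-oo, c[%classic x = (x < c) by rewrite /= in_itv/=.
apply: (@ge0_FTC_bigcup_le f F _ (fun n => c - n.+2%:R) (fun n => c - n.+1%:R^-1)) => //.
- move=> n; rewrite ltrD2l ltrN2 (@le_lt_trans _ _ 1)//; last by rewrite ltr1n.
  by rewrite invf_le1// ler1n.
- move=> i j ij; rewrite subsetEset => x /=; rewrite !in_itv/= => /andP[h1 h2].
  apply/andP; split.
    by apply: le_trans h1; rewrite lerD2l lerN2 ler_nat.
  by apply: (le_trans h2); rewrite lerD2l lerN2 lef_pV2 ?posrE// ler_nat.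
- apply/seteqP; split => x.
    rewrite inD => cx.
    have [n1 h1] : exists n : nat, (c - x)^-1 <= n%:R.
      by exists (Num.truncn (c - x)^-1).+1; apply/ltW/truncnS_gt.
    have [n2 h2] : exists n : nat, (c - x) <= n%:R.
      by exists (Num.truncn (c - x)).+1; apply/ltW/truncnS_gt.
    exists (n1 + n2)%N => //=; rewrite in_itv/=; apply/andP; split.
      rewrite lerBlDr -lerBlDl (le_trans h2)// ler_nat -2!addnS -addSnnS -addSnnS leq_addl//.
    rewrite lerBrDr -lerBrDl invf_ple ?posrE ?subr_gt0//.
    by rewrite (le_trans h1)// ler_nat -addnS leq_addr.
  move=> [n _] /=; rewrite !in_itv/= => /andP[_ h].
  by apply: (le_lt_trans h); rewrite ltrBlDr ltrDl.
Qed.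

Local Notation q2 := (Num.sqrt (2 : R)).

Lemma q2sq : q2 * q2 = 2. Proof. by rewrite -expr2 sqr_sqrtr. Qed.
Lemma q2_gt0 : 0 < q2. Proof. by rewrite sqrtr_gt0. Qed.

(** Primitive of [y^2 / (1 + y^4)], by partial fractions from [1 + y^4 = (y^2 + q2 y + 1) (y^2 - q2
    y + 1)]. *)
Definition quart_prim (y : R) : R :=
  (2 * q2)^-1 * (atan (q2 * y + 1) + atan (q2 * y - 1)) -
  (4 * q2)^-1 * (ln (y ^+ 2 + q2 * y + 1) - ln (y ^+ 2 - q2 * y + 1)).

Lemma quartP_gt0 (y : R) : 0 < y ^+ 2 + q2 * y + 1 /\ 0 < y ^+ 2 - q2 * y + 1.
Proof.
have h := q2sq.
have h1 : 0 <= (y + q2 / 2) ^+ 2 by exact: sqr_ge0.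
have h2 : 0 <= (y - q2 / 2) ^+ 2 by exact: sqr_ge0.
by move: h h1 h2; move: (q2) => q h h1 h2; split; nra.
Qed.

Lemma quart_prim_der (y : R) : has_der quart_prim y (y ^+ 2 / (1 + y ^+ 4)).
Proof.
have [P0 M0] := quartP_gt0 y.
apply: has_der_eq.
  by rewrite /quart_prim; der.
have h := q2sq; have h0 := q2_gt0.
move: h h0 P0 M0; move: (q2) => q h h0 P0 M0.
have -> : 1 + (q * y + 1) ^+ 2 = 2 * (y ^+ 2 + q * y + 1) by ring: h.
have -> : 1 + (q * y + - 1) ^+ 2 = 2 * (y ^+ 2 - q * y + 1) by ring: h.
have -> : 1 + y ^+ 4 = (y ^+ 2 + q * y + 1) * (y ^+ 2 - q * y + 1) by ring: h.
have Pn := lt0r_neq0 P0; have Mn := lt0r_neq0 M0; have qn := lt0r_neq0 h0.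
clear h h0 P0 M0.
by field; rewrite Pn Mn qn.
Qed.

Lemma quart_prim_ndecr (x y : R) : x <= y -> quart_prim x <= quart_prim y.
Proof.
move=> xy; rewrite -subr_ge0.
have := @der_le R (fun=> 0) quart_prim (fun=> 0) (fun y => y ^+ 2 / (1 + y ^+ 4)) x y xy.
rewrite subrr; apply=> z _; [exact: der_cst|exact: quart_prim_der|].
by rewrite divr_ge0 ?sqr_ge0// addr_ge0// exprn_even_ge0.
Qed.

Lemma quart_prim0 : quart_prim 0 = 0.
Proof.
rewrite /quart_prim !mulr0 expr0n /= !(add0r, subr0, addr0, oppr0).
by rewrite atanN !subrr !mulr0 subrr.
Qed.

Lemma quart_prim_bound (y : R) : 0 <= y -> 0 <= quart_prim y <= pi / (2 * q2).
Proof.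
move=> y0; apply/andP; split; first by rewrite -quart_prim0 quart_prim_ndecr.
have [P0 M0] := quartP_gt0 y; have h0 := q2_gt0.
rewrite /quart_prim lerBlDr ler_wpDr//.
  rewrite mulr_ge0 ?invr_ge0 ?mulr_ge0 ?(ltW h0)// subr_ge0 ler_ln ?posrE//.
  by rewrite lerD2r lerD2l -subr_ge0 opprK addr_ge0// mulr_ge0 // ltW.
rewrite mulrC; apply: ler_wpM2r; first by rewrite invr_ge0 mulr_ge0 ?(ltW h0).
have h1 := atan_ltpi2 (q2 * y + 1); have h2 := atan_ltpi2 (q2 * y - 1).
by move: h1 h2; move: (atan _) (atan _) (pi : R) => ? ? ?; lra.
Qed.

(** Primitive of [sqrt z / (1 + z^2)]; its total increase on []0, +oo[] is [pi / sqrt 2], the Schur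
    constant of the homogeneous kernel. *)
Definition Phi (z : R) : R := 2 * quart_prim (Num.sqrt z).

Lemma Phi_bound (z : R) : 0 <= Phi z <= pi / q2.
Proof.
have /andP[h1 h2] := quart_prim_bound (sqrtr_ge0 z).
rewrite /Phi mulr_ge0//=.
have -> : pi / q2 = 2 * (pi / (2 * q2)) by field; rewrite lt0r_neq0// q2_gt0.
by rewrite ler_wpM2l.
Qed.

Lemma Phi_der (z : R) : 0 < z -> has_der Phi z (Num.sqrt z / (1 + z ^+ 2)).
Proof.
move=> z0; have s0 : 0 < Num.sqrt z by rewrite sqrtr_gt0.
apply: has_der_eq.
  apply: der_M; first exact: der_cst.
  apply: (der_comp (h := quart_prim) (g := @Num.sqrt R)); first exact: quart_prim_der.
  exact: is_derive1_sqrt.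
have -> : 1 + z ^+ 2 = 1 + Num.sqrt z ^+ 4 by rewrite -(sqr_sqrtr (ltW z0)) -exprM sqrtr_sqr (gtr0_norm s0).
rewrite mul0r add0r; move: (Num.sqrt z) s0 => s s0.
have d0 : 0 < 1 + s ^+ 4 by rewrite addr_gt0// exprn_gt0.
by field; rewrite !lt0r_neq0.
Qed.

(* Cauchy-Schwarz, from the optimal choice of the parameter in AM-GM. *)
Lemma amgm_opt (I B : \bar R) (A : R) : (0 <= I)%E -> (0 <= B)%E -> 0 < A ->
  (forall l : R, 0 < l -> (I + I <= (l * A)%:E + (l^-1)%:E * B)%E) -> (I * I <= A%:E * B)%E.
Proof.
move=> I0 B0 A0 h.
case: B B0 h => [b| |]// b0 h; last by rewrite gt0_muley ?lte_fin// leey.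
rewrite lee_fin in b0.
case: I I0 h => [i| |]// i0 h; last by have := h 1 ltr01.
rewrite lee_fin in i0; rewrite -!EFinM lee_fin.
have [->|in0] := eqVneq i 0; first by rewrite mul0r mulr_ge0// ltW.
have ip : 0 < i by rewrite lt_neqAle eq_sym in0.
have := h (i / A) (divr_gt0 ip A0).
rewrite -!EFinM -!EFinD lee_fin invf_div divfK ?gt_eqF// lerD2l mulrAC ler_pdivlMr//.
Qed.

Lemma measurable_int_section (h : R -> R -> R) : (forall t s, 0 <= h t s) ->
  measurable_fun setT (fun z : R * R => h z.1 z.2) ->
  measurable_fun setT (fun t => \int[mu]_s (h t s)%:E)%E.
Proof.
move=> h0 mh.
apply: (@measurable_fun_fubini_tonelli_F _ _ _ _ R mu (fun z : R * R => (h z.1 z.2)%:E)).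
  exact/measurable_EFinP.
by move=> z; rewrite lee_fin.
Qed.

(** Cauchy-Schwarz for [p f = sqrt(p w) sqrt(p f^2 / w)] gives
    [(int p f)^2 <= al q int (p f^2 / w)]; Tonelli and the second weighted bound conclude. The
    weights may vanish where [p] does, and the square is written as a product because the integrals
    are extended reals. *)
Lemma schur (p : R -> R -> R) (w q f : R -> R) (al be : R) : 0 < al -> 0 <= be ->
  measurable_fun setT (fun z : R * R => p z.1 z.2) -> measurable_fun setT w ->
  measurable_fun setT q -> measurable_fun setT f ->
  (forall t s, 0 <= p t s) -> (forall s, 0 <= w s) -> (forall t, 0 <= q t) ->
  (forall s, 0 <= f s) ->
  (forall t s, p t s != 0 -> 0 < w s /\ 0 < q t) ->
  (forall t, (\int[mu]_s (p t s * w s)%:E <= (al * q t)%:E)%E) ->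
  (forall s, (\int[mu]_t (q t * p t s)%:E <= (be * w s)%:E)%E) ->
  (\int[mu]_t ((\int[mu]_s (p t s * f s)%:E) * (\int[mu]_s (p t s * f s)%:E)) <=
    (al * be)%:E * \int[mu]_s (f s ^+ 2)%:E)%E.
Proof.
move=> al0 be0 mp mw mq mf p0 w0 q0 f0 pw H1 H2.
have mpt t : measurable_fun setT (p t).
  exact: (measurableT_comp mp (pair1_measurable t)).
have mps s : measurable_fun setT (p^~ s).
  exact: (measurableT_comp mp (pair2_measurable s)).
have mwV : measurable_fun setT (fun s => (w s)^-1) by exact: measurable_fun_invr.
have mf2 : measurable_fun setT (fun s => f s ^+ 2 / w s).
  by apply: measurable_funM => //; exact: measurable_funX.
pose g t s := p t s * (f s ^+ 2 / w s).
have g0 t s : 0 <= g t s by rewrite mulr_ge0// divr_ge0// sqr_ge0.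
have mg2 : measurable_fun setT (fun z : R * R => g z.1 z.2).
  apply: measurable_funM => //.
  exact: (measurableT_comp mf2 measurable_snd).
have mg t : measurable_fun setT (g t).
  exact: (measurableT_comp mg2 (pair1_measurable t)).
have CS t : ((\int[mu]_s (p t s * f s)%:E) * (\int[mu]_s (p t s * f s)%:E) <=
   (al * q t)%:E * \int[mu]_s (g t s)%:E)%E.
  (* Where [q t = 0] the whole section [p t] vanishes, hence so does the left side; elsewhere
     [al * q t] is positive, as [amgm_opt] requires. *)
  have [qt|qt] := eqVneq (q t) 0.
    have pt s : p t s = 0.
      by apply/eqP; apply: contraTT isT => /pw[_]; rewrite qt ltxx.
    rewrite integral0_eq ?mul0e; last by move=> s _; rewrite pt mul0r.
    by rewrite mule_ge0// ?lee_fin ?mulr_ge0 ?(ltW al0)//; apply: integral_ge0 => s _; rewrite lee_fin.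
  have qp : 0 < q t by rewrite lt_neqAle eq_sym qt q0.
  apply: amgm_opt.
  - by apply: integral_ge0 => s _; rewrite lee_fin mulr_ge0.
  - by apply: integral_ge0 => s _; rewrite lee_fin.
  - by rewrite mulr_gt0.
  move=> l l0.
  have mpf : measurable_fun setT (fun s => (p t s * f s)%:E).
    by apply/measurable_EFinP; exact: measurable_funM.
  have mpw : measurable_fun setT (fun s => (p t s * w s)%:E).
    by apply/measurable_EFinP; exact: measurable_funM.
  have mgE : measurable_fun setT (fun s => (g t s)%:E) by exact/measurable_EFinP.
  rewrite -ge0_integralD//; try by move=> s _; rewrite lee_fin mulr_ge0.
  apply: (@le_trans _ _ (\int[mu]_s (l%:E * (p t s * w s)%:E + (l^-1)%:E * (g t s)%:E))%E).
    apply: ge0_le_integral => //.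
    - by move=> s _; rewrite -EFinD lee_fin addr_ge0// mulr_ge0.
    - exact: emeasurable_funD.
    - by apply: emeasurable_funD; apply: measurable_funeM.
    - move=> s _; rewrite -!EFinM -!EFinD lee_fin /g.
      have [pz|/pw[wp _]] := eqVneq (p t s) 0; first by rewrite pz !mul0r !mulr0 addr0.
      rewrite -subr_ge0 (_ : _ - _ = p t s / (l * w s) * (l * w s - f s) ^+ 2).
        by rewrite mulr_ge0 ?sqr_ge0// divr_ge0// mulr_ge0// ltW.
      have ln := lt0r_neq0 l0; have wn := lt0r_neq0 wp.
      move: (p t s) (f s) (w s) wn => ? ? ? wn; clear -ln wn.
      by field; rewrite ln wn.
  rewrite ge0_integralD//=; last 4 first.
  - by move=> s _; rewrite lee_fin mulr_ge0 ?(ltW l0)// mulr_ge0.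
  - exact: measurable_funeM.
  - by move=> s _; rewrite lee_fin mulr_ge0 ?invr_ge0 ?(ltW l0).
  - exact: measurable_funeM.
  rewrite !ge0_integralZl//=.
  - rewrite EFinM leeD2r// lee_wpmul2l// ?lee_fin ?(ltW l0)//.
  - by move=> s _; rewrite lee_fin.
  - by rewrite lee_fin invr_ge0 ltW.
  - by move=> s _; rewrite lee_fin mulr_ge0.
  - by rewrite lee_fin ltW.
have mI := measurable_int_section.
have mpf2 : measurable_fun setT (fun z : R * R => p z.1 z.2 * f z.2).
  by apply: measurable_funM => //; exact: (measurableT_comp mf measurable_snd).
have mpfI : measurable_fun setT (fun t => \int[mu]_s (p t s * f s)%:E)%E.
  by apply: (mI (fun t s => p t s * f s)) => // t s; rewrite mulr_ge0.
have mgI : measurable_fun setT (fun t => \int[mu]_s (g t s)%:E)%E by exact: mI.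
apply: (@le_trans _ _ (\int[mu]_t ((al * q t)%:E * \int[mu]_s (g t s)%:E))%E).
  apply: ge0_le_integral => //.
  - by move=> t _; rewrite mule_ge0//; apply: integral_ge0 => s _; rewrite lee_fin mulr_ge0.
  - exact: emeasurable_funM.
  - apply: emeasurable_funM => //; apply/measurable_EFinP.
    by apply: measurable_funM => //; exact: measurable_cst.
have ZI t : (\int[mu]_s (q t * g t s)%:E = (q t)%:E * \int[mu]_s (g t s)%:E)%E.
  have mgE : measurable_fun setT (fun s => (g t s)%:E) by exact/measurable_EFinP.
  rewrite -(@ge0_integralZl _ _ R mu setT _ (fun s => (g t s)%:E))//; [by move=> s _; rewrite lee_fin|by rewrite lee_fin].
apply: (@le_trans _ _ (al%:E * \int[mu]_t \int[mu]_s (q t * g t s)%:E)%E).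
  rewrite le_eqVlt; apply/orP; left; apply/eqP.
  under eq_integral => t _ do rewrite [(al * q t)%:E]EFinM -muleA -ZI.
  apply: ge0_integralZl => //.
  - apply: (mI (fun t s => q t * g t s)); first by move=> t s; rewrite mulr_ge0.
    by apply: measurable_funM => //; exact: (measurableT_comp mq measurable_fst).
  - by move=> t _; apply: integral_ge0 => s _; rewrite lee_fin mulr_ge0.
  - by rewrite lee_fin ltW.
rewrite EFinM -muleA lee_wpmul2l// ?lee_fin ?(ltW al0)//.
rewrite (@fubini_tonelli _ _ _ _ R mu mu (fun z : R * R => (q z.1 * g z.1 z.2)%:E))/=; last 2 first.
- apply/measurable_EFinP; apply: measurable_funM => //.
  exact: (measurableT_comp mq measurable_fst).
- by move=> z; rewrite lee_fin mulr_ge0.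
have mfE : measurable_fun setT (fun s => (f s ^+ 2)%:E).
  by apply/measurable_EFinP; exact: measurable_funX.
rewrite -(@ge0_integralZl _ _ R mu setT measurableT _ mfE be%:E)//; last first.
  by move=> s _; rewrite lee_fin sqr_ge0.
apply: ge0_le_integral => //.
- by move=> s _; apply: integral_ge0 => t _; rewrite lee_fin mulr_ge0.
- apply: (@measurable_fun_fubini_tonelli_G _ _ _ _ R mu (fun z : R * R => (q z.1 * g z.1 z.2)%:E)).
    apply/measurable_EFinP; apply: measurable_funM => //.
    exact: (measurableT_comp mq measurable_fst).
  by move=> z; rewrite lee_fin mulr_ge0.
- exact: measurable_funeM.
- move=> s _.
  apply: (@le_trans _ _ ((f s ^+ 2 / w s)%:E * \int[mu]_t (q t * p t s)%:E)%E).
    have mqp : measurable_fun setT (fun t => (q t * p t s)%:E).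
      by apply/measurable_EFinP; exact: measurable_funM.
    rewrite -(@ge0_integralZl _ _ R mu setT measurableT _ mqp)//; last 2 first.
    - by move=> t _; rewrite lee_fin mulr_ge0.
    - by rewrite lee_fin divr_ge0// sqr_ge0.
    apply: ge0_le_integral => //.
    - by move=> t _; rewrite lee_fin mulr_ge0.
    - apply/measurable_EFinP; apply: measurable_funM => //.
      exact: (measurableT_comp mg2 (pair2_measurable s)).
    - exact: measurable_funeM.
    - by move=> t _; rewrite -EFinM lee_fin /g mulrA mulrC.
  apply: (@le_trans _ _ ((f s ^+ 2 / w s)%:E * (be * w s)%:E)%E).
    by rewrite lee_wpmul2l// lee_fin divr_ge0// sqr_ge0.
  rewrite -!EFinM lee_fin.
  have [->|wn] := eqVneq (w s) 0; first by rewrite !mulr0 mulr_ge0// sqr_ge0.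
  by rewrite mulrCA divfK.
Qed.

End Schur.

(** * The homogeneous kernel u / (u^2 + v^2) *)

Section HomogeneousKernel.
Variable R : realType.
Local Notation C := R[i].
Local Notation mu := (@lebesgue_measure R).
Variables (a : R).
Local Notation rr := (rsq a).
Local Notation c2 := (pi / Num.sqrt (2 : R)).

(* At [s = a] the weight [wt] has the junk value [0]; this is why [pF] vanishes there. *)
Definition wt (s : R) : R := (Num.sqrt `|s - a|)^-1.
Definition qt (t : R) : R := if a < t then (Num.sqrt (t - a))^-1 else 0.
(** [pH] carries the sharp bound, for data on [s > a]. [pF] sees both sides of [a], which doubles
    one of the two Schur constants but is enough for continuity on all of [L^2]. *)
Definition pH (t s : R) : R := if (a < t) && (a < s) then (t - a) / rr t s else 0.
Definition pF (t s : R) : R := if (a < t) && (s != a) then (t - a) / rr t s else 0.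

Lemma c2_gt0 : 0 < c2 :> R. Proof. by rewrite divr_gt0 ?pi_gt0 ?sqrtr_gt0. Qed.

Lemma wt_ge0 s : 0 <= wt s. Proof. by rewrite invr_ge0 sqrtr_ge0. Qed.
Lemma wt_gt0 s : s != a -> 0 < wt s.
Proof. by move=> sa; rewrite invr_gt0 sqrtr_gt0 normr_gt0 subr_eq0. Qed.
Lemma qt_ge0 t : 0 <= qt t.
Proof. by rewrite /qt; case: ifP => // _; rewrite invr_ge0 sqrtr_ge0. Qed.
Lemma qt_gt0 t : a < t -> 0 < qt t.
Proof. by move=> h; rewrite /qt h invr_gt0 sqrtr_gt0 subr_gt0. Qed.
Lemma hk_ge0 t s : a < t -> 0 <= (t - a) / rr t s.
Proof. by move=> h; rewrite divr_ge0 ?subr_ge0 ?(ltW h)// ltW// rsq_gt0. Qed.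
Lemma pH_ge0 t s : 0 <= pH t s.
Proof. by rewrite /pH; case: ifP => // /andP[? _]; exact: hk_ge0. Qed.
Lemma pF_ge0 t s : 0 <= pF t s.
Proof. by rewrite /pF; case: ifP => // /andP[? _]; exact: hk_ge0. Qed.

Lemma measurable_wt : measurable_fun setT wt.
Proof.
apply: measurable_fun_invr; apply: (measurableT_comp (@measurable_sqrt R)).
by apply: measurableT_comp => //; apply: measurable_funB => //; exact: measurable_cst.
Qed.

Lemma measurable_qt : measurable_fun setT qt.
Proof.
apply: measurable_fun_ifT; [|apply: measurable_fun_invr|exact: measurable_cst].
  by apply: measurable_fun_ltr => //; exact: measurable_cst.
apply: (measurableT_comp (@measurable_sqrt R)).
by apply: measurable_funB => //; exact: measurable_cst.
Qed.

Lemma measurable_hk d (T : measurableType d) (f g : T -> R) :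
  measurable_fun setT f -> measurable_fun setT g ->
  measurable_fun setT (fun x => (f x - a) / rr (f x) (g x)).
Proof.
move=> mf mg; apply: measurable_funM; last exact/measurable_fun_invr/measurable_rr.
by apply: measurable_funB => //; exact: measurable_cst.
Qed.

Lemma measurable_pH : measurable_fun setT (fun z : R * R => pH z.1 z.2).
Proof.
have m1 : measurable_fun setT (fun z : R * R => z.1) by exact: measurable_fst.
have m2 : measurable_fun setT (fun z : R * R => z.2) by exact: measurable_snd.
have mc : measurable_fun setT (fun z : R * R => a) by exact: measurable_cst.
apply: measurable_fun_ifT; [|exact: measurable_hk|exact: measurable_cst].
by apply: measurable_and; exact: measurable_fun_ltr.
Qed.

Lemma measurable_pF : measurable_fun setT (fun z : R * R => pF z.1 z.2).
Proof.
have m1 : measurable_fun setT (fun z : R * R => z.1) by exact: measurable_fst.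
have m2 : measurable_fun setT (fun z : R * R => z.2) by exact: measurable_snd.
have mc : measurable_fun setT (fun z : R * R => a) by exact: measurable_cst.
apply: measurable_fun_ifT; [|exact: measurable_hk|exact: measurable_cst].
apply: measurable_and; first exact: measurable_fun_ltr.
by apply: measurable_neg; exact: measurable_fun_eqr.
Qed.

Lemma hk_cvg (t s : R) (T : Type) (F : set_system T) {FF : Filter F} (f g : T -> R) : a < t ->
  f x @[x --> F] --> t -> g x @[x --> F] --> s ->
  ((f x - a) / rr (f x) (g x)) @[x --> F] --> (t - a) / rr t s.
Proof.
move=> ta ft gs.
have fa : (f x - a) @[x --> F] --> t - a by apply: cvgB => //; exact: cvg_cst.
have ga : (g x - a) @[x --> F] --> s - a by apply: cvgB => //; exact: cvg_cst.
apply: cvgM => //; apply: cvgV; first by rewrite gt_eqF// rsq_gt0.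
rewrite /rsq !expr2; under eq_fun do rewrite !expr2.
by apply: cvgD; exact: cvgM.
Qed.

Lemma sqrtV_cvg (t : R) (T : Type) (F : set_system T) {FF : Filter F} (f : T -> R) : 0 < t ->
  f x @[x --> F] --> t -> (Num.sqrt (f x))^-1 @[x --> F] --> (Num.sqrt t)^-1.
Proof.
move=> t0 ft; apply: cvgV; first by rewrite gt_eqF// sqrtr_gt0.
by apply: (cvg_comp _ (@Num.sqrt R) ft); exact: sqrt_continuous.
Qed.

(** In the variable [z = (t - a) / (s - a)] the integrand becomes that of [Phi]. The exponent [-1/2]
    in the weights gives the same constant here and in [int_qt_hk]. *)
Lemma int_hk_wtR (t : R) : a < t ->
  (\int[mu]_(s in `]a, +oo[) ((t - a) / rr t s * wt s)%:E <= (c2 * qt t)%:E)%E.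
Proof.
move=> ta; have u0 : 0 < t - a by rewrite subr_gt0.
have U0 : 0 < Num.sqrt (t - a) by rewrite sqrtr_gt0.
have -> : c2 * qt t = 0 - - ((Num.sqrt (t - a))^-1 * c2) by rewrite /qt ta sub0r opprK mulrC.
apply: (@ge0_FTC_oy_le _ _ (fun s => - ((Num.sqrt (t - a))^-1 * Phi ((t - a) / (s - a))))).
- by apply: measurable_funM; [apply: measurable_hk => //; exact: measurable_cst|exact: measurable_wt].
- by move=> s _; rewrite mulr_ge0 ?wt_ge0// hk_ge0.
- move=> s sa; apply: cvgM; first by apply: hk_cvg => //; try exact: cvg_cst; exact: cvg_id.
  apply: sqrtV_cvg; first by rewrite normr_gt0 subr_eq0 gt_eqF.
  by apply: cvg_norm; apply: cvgB; [exact: cvg_id|exact: cvg_cst].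
- move=> s sa; have v0 : 0 < s - a by rewrite subr_gt0.
  have vn : s - a != 0 by rewrite gt_eqF.
  apply: has_der_eq.
    apply: der_N; apply: der_M; first exact: der_cst.
    apply: (der_comp (h := @Phi R) (g := fun s => (t - a) / (s - a))).
      by apply: Phi_der; rewrite divr_gt0.
    by der.
  rewrite /wt (gtr0_norm v0) sqrtrM ?(ltW u0)// sqrtrV ?(ltW v0)//.
  rewrite /rsq; have V0 : 0 < Num.sqrt (s - a) by rewrite sqrtr_gt0.
  have := sqr_sqrtr (ltW u0); have := sqr_sqrtr (ltW v0).
  move: (Num.sqrt (t - a)) (Num.sqrt (s - a)) U0 V0 => U V U0 V0 eV eU.
  rewrite -eU -eV.
  have d1 : 0 < U ^+ 4 + V ^+ 4 by rewrite addr_gt0// exprn_gt0.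
  have Un := lt0r_neq0 U0; have Vn := lt0r_neq0 V0.
  have dn := lt0r_neq0 d1; have dn' : V ^+ 4 + U ^+ 4 != 0 by rewrite addrC.
  clear -Un Vn dn dn'.
  field; rewrite ?Un ?Vn ?andbT/=.
  by rewrite -?exprM ?dn ?dn'.
- move=> s sa; have /andP[h1 h2] := Phi_bound ((t - a) / (s - a)).
  rewrite oppr_le0 mulr_ge0 ?invr_ge0 ?(ltW U0)// andbT lerN2.
  by rewrite ler_wpM2l// invr_ge0 ltW.
Qed.

Lemma int_hk_wtL (t : R) : a < t ->
  (\int[mu]_(s in `]-oo, a[) ((t - a) / rr t s * wt s)%:E <= (c2 * qt t)%:E)%E.
Proof.
move=> ta; have u0 : 0 < t - a by rewrite subr_gt0.
have U0 : 0 < Num.sqrt (t - a) by rewrite sqrtr_gt0.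
have -> : c2 * qt t = (Num.sqrt (t - a))^-1 * c2 - 0 by rewrite /qt ta subr0 mulrC.
apply: (@ge0_FTC_yo_le _ _ (fun s => (Num.sqrt (t - a))^-1 * Phi ((t - a) / (a - s)))).
- by apply: measurable_funM; [apply: measurable_hk => //; exact: measurable_cst|exact: measurable_wt].
- by move=> s _; rewrite mulr_ge0 ?wt_ge0// hk_ge0.
- move=> s sa; apply: cvgM; first by apply: hk_cvg => //; try exact: cvg_cst; exact: cvg_id.
  apply: sqrtV_cvg; first by rewrite normr_gt0 subr_eq0 lt_eqF.
  by apply: cvg_norm; apply: cvgB; [exact: cvg_id|exact: cvg_cst].
- move=> s sa; have v0 : 0 < a - s by rewrite subr_gt0.
  have vn : a - s != 0 by rewrite gt_eqF.
  apply: has_der_eq.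
    apply: der_M; first exact: der_cst.
    apply: (der_comp (h := @Phi R) (g := fun s => (t - a) / (a - s))).
      by apply: Phi_der; rewrite divr_gt0.
    by der.
  rewrite /wt distrC (gtr0_norm v0) sqrtrM ?(ltW u0)// sqrtrV ?(ltW v0)//.
  rewrite /rsq -(sqrrN (s - a)) opprB; have V0 : 0 < Num.sqrt (a - s) by rewrite sqrtr_gt0.
  have := sqr_sqrtr (ltW u0); have := sqr_sqrtr (ltW v0).
  move: (Num.sqrt (t - a)) (Num.sqrt (a - s)) U0 V0 => U V U0 V0 eV eU.
  rewrite -eU -eV.
  have d1 : 0 < U ^+ 4 + V ^+ 4 by rewrite addr_gt0// exprn_gt0.
  have Un := lt0r_neq0 U0; have Vn := lt0r_neq0 V0.
  have dn := lt0r_neq0 d1; have dn' : V ^+ 4 + U ^+ 4 != 0 by rewrite addrC.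
  clear -Un Vn dn dn'.
  field; rewrite ?Un ?Vn ?andbT/=.
  by rewrite -?exprM ?dn ?dn'.
- move=> s sa; have /andP[h1 h2] := Phi_bound ((t - a) / (a - s)).
  rewrite mulr_ge0 ?invr_ge0 ?(ltW U0)//=.
  by rewrite ler_wpM2l// invr_ge0 ltW.
Qed.

Lemma int_qt_hk (s : R) : s != a ->
  (\int[mu]_(t in `]a, +oo[) (qt t * ((t - a) / rr t s))%:E <= (c2 * wt s)%:E)%E.
Proof.
move=> sa; have b0 : 0 < `|s - a| by rewrite normr_gt0 subr_eq0.
have B0 : 0 < Num.sqrt `|s - a| by rewrite sqrtr_gt0.
have -> : c2 * wt s = wt s * c2 - 0 by rewrite subr0 mulrC.
apply: (@ge0_FTC_oy_le _ _ (fun t => wt s * Phi ((t - a) / `|s - a|))).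
- by apply: measurable_funM; [exact: measurable_qt|apply: measurable_hk => //; exact: measurable_cst].
- by move=> t ta; rewrite mulr_ge0 ?qt_ge0// hk_ge0.
- move=> t ta; apply: cvgM; last by apply: hk_cvg => //; try exact: cvg_cst; exact: cvg_id.
  rewrite /qt ta.
  apply: cvg_trans; first apply: (@near_eq_cvg _ _ _ _ (fun t => (Num.sqrt (t - a))^-1)).
    by near do rewrite ifT//; exact: lt_nbhsr.
  apply: sqrtV_cvg; first by rewrite subr_gt0.
  by apply: cvgB; [exact: cvg_id|exact: cvg_cst].
- move=> t ta; have u0 : 0 < t - a by rewrite subr_gt0.
  apply: has_der_eq.
    apply: der_M; first exact: der_cst.
    apply: (der_comp (h := @Phi R) (g := fun t => (t - a) / `|s - a|)).
      by apply: Phi_der; rewrite divr_gt0.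
    by der; rewrite gt_eqF.
  rewrite /qt ta /wt sqrtrM ?(ltW u0)// sqrtrV ?(ltW b0)//.
  rewrite /rsq -(real_normK (num_real (s - a))).
  have U0 : 0 < Num.sqrt (t - a) by rewrite sqrtr_gt0.
  have := sqr_sqrtr (ltW u0); have := sqr_sqrtr (ltW b0).
  move: (Num.sqrt (t - a)) (Num.sqrt `|s - a|) U0 B0 => U V U0 V0 eV eU.
  rewrite -eU -eV.
  have d1 : 0 < U ^+ 4 + V ^+ 4 by rewrite addr_gt0// exprn_gt0.
  have Un := lt0r_neq0 U0; have Vn := lt0r_neq0 V0.
  have dn := lt0r_neq0 d1; have dn' : V ^+ 4 + U ^+ 4 != 0 by rewrite addrC.
  clear -Un Vn dn dn'.
  field; rewrite ?Un ?Vn ?andbT/=.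
  by rewrite -?exprM ?dn ?dn'.
- move=> t ta; have /andP[h1 h2] := Phi_bound ((t - a) / `|s - a|).
  by rewrite mulr_ge0 ?wt_ge0//= ler_wpM2l// wt_ge0.
Unshelve. all: by end_near.
Qed.

Lemma int_pH_wt t : (\int[mu]_s (pH t s * wt s)%:E <= (c2 * qt t)%:E)%E.
Proof.
have [ta|ta] := ltP a t; last first.
  rewrite integral0_eq; first by rewrite lee_fin mulr_ge0 ?qt_ge0 ?(ltW c2_gt0).
  by move=> s _; rewrite /pH ltNge ta mul0r.
apply: le_trans (int_hk_wtR ta); rewrite [leRHS]integral_mkcond.
rewrite le_eqVlt; apply/orP; left; apply/eqP; apply: eq_integral => s _.
by rewrite patchE /pH ta/= mem_setE in_itv/= andbT; case: ifPn => sa //; rewrite mul0r.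
Qed.

Lemma int_pF_wt t : (\int[mu]_s (pF t s * wt s)%:E <= (2 * c2 * qt t)%:E)%E.
Proof.
have [ta|ta] := ltP a t; last first.
  rewrite integral0_eq; first by rewrite lee_fin (mulr_ge0 _ (qt_ge0 t))// (mulr_ge0 _ (ltW c2_gt0)).
  by move=> s _; rewrite /pF ltNge ta mul0r.
have -> : 2 * c2 * qt t = c2 * qt t + c2 * qt t by ring.
have mh : measurable_fun setT (fun s => ((t - a) / rr t s * wt s)%:E).
  apply/measurable_EFinP; apply: measurable_funM; last exact: measurable_wt.
  by apply: measurable_hk => //; exact: measurable_cst.
rewrite EFinD; apply: le_trans (leeD (int_hk_wtR ta) (int_hk_wtL ta)).
rewrite [X in (_ <= X + _)%E]integral_mkcond [X in (_ <= _ + X)%E]integral_mkcond.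
rewrite -ge0_integralD//; last 4 first.
- by move=> s _; rewrite patchE; case: ifPn => // _; rewrite lee_fin mulr_ge0 ?wt_ge0// hk_ge0.
- by apply/(measurable_restrictT _ _).1 => //; exact: measurable_funTS.
- by move=> s _; rewrite patchE; case: ifPn => // _; rewrite lee_fin mulr_ge0 ?wt_ge0// hk_ge0.
- by apply/(measurable_restrictT _ _).1 => //; exact: measurable_funTS.
rewrite le_eqVlt; apply/orP; left; apply/eqP; apply: eq_integral => s _.
rewrite !patchE /pF ta/= !mem_setE !in_itv/= andbT.
by case: ltgtP => //= _; rewrite ?adde0 ?add0e// mul0r.
Qed.

(** A general [p] serves both [pH] and [pF]. Integration in [t] only meets the side [t > a], hence
    no doubling here. *)
Lemma int_qt_p (p : R -> R -> R) s : (forall t s, a < t -> p t s = 0 \/ (s != a /\ p t s = (t - a) / rr t s)) ->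
  (forall t s, t <= a -> p t s = 0) -> measurable_fun setT (fun z : R * R => p z.1 z.2) ->
  (\int[mu]_t (qt t * p t s)%:E <= (c2 * wt s)%:E)%E.
Proof.
move=> hp hp0 mp.
have mps : measurable_fun setT (p^~ s).
  exact: (measurableT_comp mp (pair2_measurable s)).
have [sa|sa] := eqVneq s a.
  rewrite integral0_eq; first by rewrite lee_fin mulr_ge0 ?wt_ge0 ?(ltW c2_gt0).
  move=> t _; have [ta|ta] := ltP a t; last by rewrite hp0// mulr0.
  by have [->|[]] := hp t s ta; rewrite ?mulr0// sa eqxx.
apply: le_trans (int_qt_hk sa); rewrite [leRHS]integral_mkcond.
apply: ge0_le_integral => //.
- move=> t _; rewrite lee_fin mulr_ge0 ?qt_ge0//.
  have [ta|ta] := ltP a t; last by rewrite hp0.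
  by have [->//|[_ ->]] := hp t s ta; exact: hk_ge0.
- by apply/measurable_EFinP; apply: measurable_funM => //; exact: measurable_qt.
- apply/(measurable_restrictT _ _).1 => //; apply: measurable_funTS.
  apply/measurable_EFinP; apply: measurable_funM; first exact: measurable_qt.
  by apply: measurable_hk => //; exact: measurable_cst.
- move=> t _; rewrite patchE; have [ta|ta] := ltP a t; last first.
    by rewrite hp0// mulr0; case: ifPn => // _; rewrite lee_fin /qt ltNge ta mul0r.
  rewrite ifT; last by rewrite inE /= in_itv/= ta.
  have [->|[_ ->]//] := hp t s ta.
  by rewrite mulr0 lee_fin mulr_ge0 ?qt_ge0// hk_ge0.
Qed.

Lemma schurH (f : R -> R) : measurable_fun setT f -> (forall s, 0 <= f s) ->
  (\int[mu]_t ((\int[mu]_s (pH t s * f s)%:E) * (\int[mu]_s (pH t s * f s)%:E)) <=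
    (c2 * c2)%:E * \int[mu]_s (f s ^+ 2)%:E)%E.
Proof.
move=> mf f0; apply: (@schur _ pH wt qt).
- exact: c2_gt0.
- exact/ltW/c2_gt0.
- exact: measurable_pH.
- exact: measurable_wt.
- exact: measurable_qt.
- exact: mf.
- exact: pH_ge0.
- exact: wt_ge0.
- exact: qt_ge0.
- exact: f0.
- move=> t s; rewrite /pH; case: ifP => [/andP[ta sa] _|]; last by rewrite eqxx.
  by rewrite wt_gt0 ?gt_eqF// qt_gt0.
- exact: int_pH_wt.
- move=> s; apply: int_qt_p; last exact: measurable_pH.
    move=> t s' ta; rewrite /pH ta /=; case: ifP => [sa|_]; [right|by left].
    by rewrite gt_eqF.
  by move=> t s' ta; rewrite /pH ltNge ta.
Qed.

Lemma schurF (f : R -> R) : measurable_fun setT f -> (forall s, 0 <= f s) ->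
  (\int[mu]_t ((\int[mu]_s (pF t s * f s)%:E) * (\int[mu]_s (pF t s * f s)%:E)) <=
    (2 * c2 * c2)%:E * \int[mu]_s (f s ^+ 2)%:E)%E.
Proof.
move=> mf f0; apply: (@schur _ pF wt qt).
- by rewrite mulr_gt0// c2_gt0.
- exact/ltW/c2_gt0.
- exact: measurable_pF.
- exact: measurable_wt.
- exact: measurable_qt.
- exact: mf.
- exact: pF_ge0.
- exact: wt_ge0.
- exact: qt_ge0.
- exact: f0.
- move=> t s; rewrite /pF; case: ifP => [/andP[ta sa] _|]; last by rewrite eqxx.
  by rewrite wt_gt0// qt_gt0.
- exact: int_pF_wt.
- move=> s; apply: int_qt_p; last exact: measurable_pF.
    by move=> t s' ta; rewrite /pF ta /=; case: ifP => [sa|_]; [right|left].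
  by move=> t s' ta; rewrite /pF ltNge ta.
Qed.

End HomogeneousKernel.

(** * Complex integrals and square integrable functions *)

Section ComplexIntegral.
Variable R : realType.
Local Notation C := R[i].
Local Notation mu := (@lebesgue_measure R).
Implicit Types (f g : R -> C).

Lemma ae_imp (P Q : R -> Prop) : (forall x, P x -> Q x) ->
  {ae mu, forall x, P x} -> {ae mu, forall x, Q x}.
Proof.
by move=> h [A [mA A0 PA]]; exists A; split => // x nQ; apply: PA => /h.
Qed.

Lemma ae_and (P Q : R -> Prop) : {ae mu, forall x, P x} -> {ae mu, forall x, Q x} ->
  {ae mu, forall x, P x /\ Q x}.
Proof.
move=> hP hQ; apply: negligibleS (negligibleU hP hQ) => x /= nPQ.
have [Px|nP] := pselect (P x); last by left.
by right => Qx; apply: nPQ.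
Qed.

Lemma ae_neq (c : R) : {ae mu, forall x, x != c}.
Proof.
exists [set c]; split => //; first exact: lebesgue_measure_set1.
by move=> x /= /negP; rewrite negbK => /eqP.
Qed.

Lemma cintegrable_cmeas f : cintegrable f -> cmeas f.
Proof. by case. Qed.

Lemma cintegrable_re f : cintegrable f -> mu.-integrable setT (EFin \o (fun x => Re (f x))).
Proof.
move=> [f1 f2 fi]; apply/integrableP; split; first exact/measurable_EFinP.
apply: le_lt_trans fi; apply: ge0_le_integral => //.
- by apply/measurable_EFinP; apply: measurableT_comp.
- by apply/measurable_EFinP; apply: measurable_cabs.
- by move=> x _ /=; rewrite lee_fin Re_le_cabs.
Qed.

Lemma cintegrable_im f : cintegrable f -> mu.-integrable setT (EFin \o (fun x => Im (f x))).
Proof.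
move=> [f1 f2 fi]; apply/integrableP; split; first exact/measurable_EFinP.
apply: le_lt_trans fi; apply: ge0_le_integral => //.
- by apply/measurable_EFinP; apply: measurableT_comp.
- by apply/measurable_EFinP; apply: measurable_cabs.
- by move=> x _ /=; rewrite lee_fin Im_le_cabs.
Qed.

Lemma le_cintegrable f (g : R -> R) : cmeas f -> measurable_fun setT g -> (forall x, 0 <= g x) ->
  {ae mu, forall x, cabs (f x) <= g x} -> (\int[mu]_x (g x)%:E < +oo)%E -> cintegrable f.
Proof.
move=> mf mg g0 fg gi; have [f1 f2] := mf; split => //.
apply: le_lt_trans gi; apply: ae_ge0_le_integral => //.
- by move=> x _; rewrite lee_fin cabs_ge0.
- by apply/measurable_EFinP; exact: measurable_cabs.
- by move=> x _; rewrite lee_fin.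
- exact/measurable_EFinP.
- by apply: ae_imp fg => x h _; rewrite lee_fin.
Qed.

Lemma cintD f g : cintegrable f -> cintegrable g ->
  cint (fun x => f x + g x) = cint f + cint g.
Proof.
move=> fi gi; apply: ceqP; rewrite /cint /=.
  under eq_Rintegral do rewrite creD.
  by rewrite RintegralD//; exact: cintegrable_re.
under eq_Rintegral do rewrite cimD.
by rewrite RintegralD//; exact: cintegrable_im.
Qed.

Lemma cintZ (c : C) f : cintegrable f -> cint (fun x => c * f x) = c * cint f.
Proof.
move=> fi; have f1 := cintegrable_re fi; have f2 := cintegrable_im fi.
have Zi (r : R) (h : R -> R) : mu.-integrable setT (EFin \o h) ->
    mu.-integrable setT (EFin \o (fun x => r * h x)).
  by move=> hi; apply: eq_integrable (integrableZl measurableT r hi).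
apply: ceqP; rewrite /cint ?creM ?cimM /=.
  under eq_Rintegral do rewrite creM.
  by rewrite RintegralB// ?RintegralZl//; exact: Zi.
under eq_Rintegral do rewrite cimM.
by rewrite RintegralD// ?RintegralZl//; exact: Zi.
Qed.

Lemma cintegrableZ (c : C) f : cintegrable f -> cintegrable (fun x => c * f x).
Proof.
move=> fi; have mf := cintegrable_cmeas fi.
have [m1 m2] : cmeas (fun x => c * f x) by apply: cmeasM => //; exact: cmeas_cst.
split => //; under eq_integral do rewrite cabsM EFinM.
have [_ _ fin] := fi.
rewrite ge0_integralZl//.
- by apply: lte_mul_pinfty => //; rewrite ?lee_fin ?cabs_ge0.
- by apply/measurable_EFinP; exact: measurable_cabs.
- by move=> x _; rewrite lee_fin cabs_ge0.
- by rewrite lee_fin cabs_ge0.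
Qed.

Lemma cint_ae f g : cmeas f -> cmeas g -> {ae mu, forall x, f x = g x} -> cint f = cint g.
Proof.
move=> [f1 f2] [g1 g2] fg; apply: ceqP; rewrite /cint /= /Rintegral; congr fine.
  apply: ae_eq_integral => //; try exact/measurable_EFinP.
  by apply: ae_imp fg => x -> _.
apply: ae_eq_integral => //; try exact/measurable_EFinP.
by apply: ae_imp fg => x -> _.
Qed.

(** The unimodular [c], conjugate to the phase of [cint f], rotates the integral onto the positive
    axis, where only the real part of [c f] counts. This keeps the constant [1], which a
    componentwise estimate would lose. *)
Lemma cabs_cint f : cintegrable f -> ((cabs (cint f))%:E <= \int[mu]_x (cabs (f x))%:E)%E.
Proof.
move=> fi; have mf := cintegrable_cmeas fi.
set X := cint f; have [X0|X0] := eqVneq X 0.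
  by rewrite X0 cabs0; apply: integral_ge0 => x _; rewrite lee_fin cabs_ge0.
have N0 : 0 < cabs X by rewrite cabs_gt0.
pose c : C := (Re X / cabs X) -i* (Im X / cabs X).
have N2 := cabs2 X.
have c1 : cabs c = 1.
  rewrite /cabs /c /= sqrrN !exprMn -mulrDl -N2 exprVn divff ?sqrtr1//.
  by rewrite expf_neq0// gt_eqF.
have -> : cabs X = Re (cint (fun x => c * f x)).
  rewrite cintZ// -/X creM /c [Re (_ -i* _)]/= [Im (_ -i* _)]/= mulNr opprK.
  have -> : Re X / cabs X * Re X + Im X / cabs X * Im X = (Re X ^+ 2 + Im X ^+ 2) / cabs X.
    by field; rewrite gt_eqF.
  by rewrite -N2 expr2 mulfK// gt_eqF.
have ci := cintegrableZ c fi; have ri := cintegrable_re ci.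
rewrite /cint /= /Rintegral fineK; last exact: integrable_fin_num.
have mr : measurable_fun setT (fun x => (Re (c * f x))%:E).
  by apply/measurable_EFinP; have [] := cintegrable_cmeas ci.
apply: (le_trans (lee_abs _)).
apply: (le_trans (le_abse_integral mu measurableT mr)).
apply: ge0_le_integral => //.
- by apply: measurableT_comp.
- by apply/measurable_EFinP; exact: measurable_cabs.
- move=> x _; rewrite /= lee_fin (le_trans (Re_le_cabs _))//.
  by rewrite cabsM c1 mul1r.
Qed.

(** Positive and negative parts are treated apart, so that Tonelli applies without integrability of
    the sections. *)
Lemma measurable_Rint_section (h : R -> R -> R) :
  measurable_fun setT (fun z : R * R => h z.1 z.2) ->
  measurable_fun setT (fun t => Rintegral mu setT (h t)).
Proof.
move=> mh; apply: (measurableT_comp (f := fine)); first exact: fine_measurable.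
under eq_fun do rewrite integralE.
have pos_section (h' : R -> R -> R) : measurable_fun setT (fun z : R * R => h' z.1 z.2) ->
    measurable_fun setT (fun t => \int[mu]_s (Num.max (h' t s) 0)%:E)%E.
  move=> mh'; apply: measurable_int_section.
    by move=> t s; rewrite le_max lexx orbT.
  by apply: measurable_maxr => //; exact: measurable_cst.
apply: emeasurable_funB.
  apply: eq_measurable_fun (pos_section _ mh) => t _.
  by apply: eq_integral => s _; rewrite funeposE /= -EFin_max.
have mN : measurable_fun setT (fun z : R * R => (fun t s => - h t s) z.1 z.2).
  exact: measurableT_comp.
apply: eq_measurable_fun (pos_section _ mN) => t _.
by apply: eq_integral => s _; rewrite funenegE /= -EFin_max.
Qed.

Lemma cmeas_cint_section (h : R -> R -> C) : cmeas (fun z : R * R => h z.1 z.2) ->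
  cmeas (fun t => cint (h t)).
Proof.
move=> [h1 h2]; split => /=.
  exact: (measurable_Rint_section (h := fun t s => Re (h t s))).
exact: (measurable_Rint_section (h := fun t s => Im (h t s))).
Qed.

(** With extended real values it can be estimated before membership in [L2] is known, whereas
    [l2norm] turns an infinite integral into [0]. *)
Definition sqn f : \bar R := (\int[mu]_x (cabs (f x) ^+ 2)%:E)%E.

Lemma sqn_ge0 f : (0 <= sqn f)%E.
Proof. by apply: integral_ge0 => x _; rewrite lee_fin sqr_ge0. Qed.

Lemma L2P f : L2 f <-> cmeas f /\ (sqn f < +oo)%E.
Proof. by split=> [[? ? ?]|[[? ?] ?]]; split. Qed.

Lemma measurable_cabs2 d (T : measurableType d) (f : T -> C) : cmeas f ->
  measurable_fun setT (fun x => cabs (f x) ^+ 2).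
Proof. by move=> mf; apply: measurable_funX; exact: measurable_cabs. Qed.

Lemma sqnE f : L2 f -> sqn f = (l2norm f ^+ 2)%:E.
Proof.
move=> /L2P[mf fi]; rewrite /l2norm sqr_sqrtr.
  by rewrite /Rintegral fineK// ge0_fin_numE ?sqn_ge0.
by apply: Rintegral_ge0 => x _; exact: sqr_ge0.
Qed.

Lemma cabsD2 (x y : C) : cabs (x + y) ^+ 2 <= 2 * cabs x ^+ 2 + 2 * cabs y ^+ 2.
Proof.
have h := cabsD x y; have h1 := cabs_ge0 x; have h2 := cabs_ge0 y; have h3 := cabs_ge0 (x + y).
move: (cabs x) (cabs y) (cabs (x + y)) h h1 h2 h3 => X Y Z h h1 h2 h3.
have : 0 <= (X - Y) ^+ 2 by exact: sqr_ge0.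
have : Z ^+ 2 <= (X + Y) ^+ 2 by rewrite ler_pXn2r ?nnegrE// addr_ge0.
by move=> ? ?; nra.
Qed.

Lemma sqnD_le f g : cmeas f -> cmeas g ->
  (sqn (fun x => (f x + g x)%R) <= 2%:E * sqn f + 2%:E * sqn g)%E.
Proof.
move=> mf mg; have mf2 := measurable_cabs2 mf; have mg2 := measurable_cabs2 mg.
apply: (@le_trans _ _ (\int[mu]_x (2%:E * (cabs (f x) ^+ 2)%:E + 2%:E * (cabs (g x) ^+ 2)%:E))%E).
  apply: ge0_le_integral => //.
  - by move=> x _; rewrite lee_fin sqr_ge0.
  - by apply/measurable_EFinP; apply: measurable_cabs2; exact: cmeasD.
  - by apply: emeasurable_funD; apply: measurable_funeM; exact/measurable_EFinP.
  - by move=> x _; rewrite -!EFinM -EFinD lee_fin cabsD2.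
rewrite ge0_integralD//; last 4 first.
- by move=> x _; rewrite lee_fin mulr_ge0// sqr_ge0.
- by apply: measurable_funeM; exact/measurable_EFinP.
- by move=> x _; rewrite lee_fin mulr_ge0// sqr_ge0.
- by apply: measurable_funeM; exact/measurable_EFinP.
by rewrite !ge0_integralZl//; try exact/measurable_EFinP;
  try by move=> x _; rewrite lee_fin sqr_ge0.
Qed.

Lemma L2D f g : L2 f -> L2 g -> L2 (fun x => f x + g x).
Proof.
move=> /L2P[mf fi] /L2P[mg gi]; apply/L2P; split; first exact: cmeasD.
apply: (le_lt_trans (sqnD_le mf mg)).
by apply: lte_add_pinfty; apply: lte_mul_pinfty.
Qed.

Lemma L2Z (c : C) f : L2 f -> L2 (fun x => c * f x).
Proof.
move=> /L2P[mf fi]; apply/L2P; split; first by apply: cmeasM => //; exact: cmeas_cst.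
rewrite /sqn; under eq_integral do rewrite cabsM exprMn EFinM.
rewrite ge0_integralZl//.
- by apply: lte_mul_pinfty => //; rewrite ?lee_fin ?sqr_ge0.
- by apply/measurable_EFinP; exact: measurable_cabs2.
- by move=> x _; rewrite lee_fin sqr_ge0.
- by rewrite lee_fin sqr_ge0.
Qed.

Lemma L2B f g : L2 f -> L2 g -> L2 (fun x => f x - g x).
Proof.
move=> fi gi; have := L2D fi (L2Z (-1) gi).
by under eq_fun do rewrite mulN1r.
Qed.

Lemma measurable_oppT : measurable_fun setT (-%R : R -> R).
Proof. exact: oppr_measurable. Qed.

Lemma ge0_integral_opp (h : R -> \bar R) : measurable_fun setT h -> (forall x, (0 <= h x)%E) ->
  (\int[mu]_x h (- x)%R = \int[mu]_x h x)%E.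
Proof.
move=> mh h0.
have := @ge0_integral_pushforward _ _ (measurableTypeR R) (measurableTypeR R) R (-%R : _ -> measurableTypeR R) measurable_oppT mu
  setT h measurableT mh (fun x _ => h0 x).
rewrite preimage_setT => <-.
by apply: eq_measure_integral => //= A mA AS; exact: lebesgue_measureN.
Qed.

Lemma ae_opp (P : R -> Prop) : {ae mu, forall x, P x} -> {ae mu, forall x, P (- x)}.
Proof.
move=> [A [mA A0 PA]].
exists ((-%R : _ -> measurableTypeR R) @^-1` A); split.
- by rewrite -[X in measurable X]setTI; exact: measurable_oppT.
- by have := @lebesgue_measureN R A mA; rewrite /pushforward A0.
- by move=> x /= h; apply: PA.
Qed.

Lemma cmeas_Sop f : cmeas f -> cmeas (Sop f).
Proof.
move=> [f1 f2]; split.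
  exact: (measurableT_comp f1 measurable_oppT).
exact: (measurableT_comp f2 measurable_oppT).
Qed.

Lemma sqn_Sop f : cmeas f -> sqn (Sop f) = sqn f.
Proof.
move=> mf; apply: (@ge0_integral_opp (fun x => (cabs (f x) ^+ 2)%:E)).
  by apply/measurable_EFinP; exact: measurable_cabs2.
by move=> x; rewrite lee_fin sqr_ge0.
Qed.

Lemma L2_Sop f : L2 f -> L2 (Sop f).
Proof. by move=> /L2P[mf fi]; apply/L2P; split; [exact: cmeas_Sop|rewrite sqn_Sop]. Qed.

End ComplexIntegral.

(** * Integral operators with kernels dominated by the homogeneous one *)

Section Operators.
Variable R : realType.
Local Notation C := R[i].
Local Notation mu := (@lebesgue_measure R).
Variables (a : R).
Local Notation rr := (rsq a).
Local Notation c2 := (pi / Num.sqrt (2 : R)).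
Implicit Types (kr : R -> R -> C) (psi : R -> C).

Definition Tk kr psi (t : R) : C := if a < t then cint (fun s => kr t s * psi s) else 0.

(** One condition for [kerD], [kAC] and [kK], under which [schurF] gives boundedness on [L^2]. *)
Definition adm kr (K : R) := [/\ 0 <= K, cmeas (fun z : R * R => kr z.1 z.2) &
  forall t s, a < t -> cabs (kr t s) <= K * ((t - a) / rr t s)].

Lemma cmeas_section kr t : cmeas (fun z : R * R => kr z.1 z.2) -> cmeas (kr t).
Proof.
move=> [h1 h2]; split.
  exact: (measurableT_comp h1 (pair1_measurable t)).
exact: (measurableT_comp h2 (pair1_measurable t)).
Qed.

Lemma cmeas_snd psi : cmeas psi -> cmeas (fun z : R * R => psi z.2).
Proof.
move=> [h1 h2]; split.
  exact: (measurableT_comp h1 measurable_snd).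
exact: (measurableT_comp h2 measurable_snd).
Qed.

Lemma cmeas_Tk kr psi : cmeas (fun z : R * R => kr z.1 z.2) -> cmeas psi -> cmeas (Tk kr psi).
Proof.
move=> mk mp; apply: cmeas_if; [|apply: cmeas_cint_section|exact: cmeas_cst].
  by apply: measurable_fun_ltr => //; exact: measurable_cst.
by apply: cmeasM => //; exact: cmeas_snd.
Qed.

(** Weighted AM-GM, with [p / wt <= 1/u + 1] from [sqrt|v| <= 1 + |v|]. Both terms are integrable in
    [s], so the integral defining the operator converges for every [t > a] and not only for almost
    every one. *)
Lemma pF_mul_le t s (f : R) : a < t -> 0 <= f ->
  pF a t s * f <= pF a t s * wt a s + ((t - a)^-1 + 1) * f ^+ 2.
Proof.
move=> ta f0; have u0 : 0 < t - a by rewrite subr_gt0.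
have i0 : 0 <= (t - a)^-1 by rewrite invr_ge0 ltW.
rewrite /pF ta /=; case: ifPn => [sa|_]; last first.
  by rewrite !mul0r add0r mulr_ge0 ?sqr_ge0// addr_ge0.
have w0 := wt_gt0 sa; have r0 := rsq_gt0 s ta.
set p := (t - a) / rr t s; have p0 : 0 <= p by exact: hk_ge0.
have pw : p / wt a s <= (t - a)^-1 + 1.
  have h1 : Num.sqrt `|s - a| <= 1 + `|s - a|.
    have := sqr_sqrtr (normr_ge0 (s - a)); move: (Num.sqrt _) (sqrtr_ge0 `|s - a|) => x x0 <-.
    by have : 0 <= (x - 1) ^+ 2 by [exact: sqr_ge0]; move=> ?; nra.
  rewrite /wt invrK (le_trans (ler_wpM2l p0 h1))// mulrDr mulr1 lerD//.
    rewrite /p ler_pdivrMr// ler_pdivlMl// -expr2; exact: sqr_u_le.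
  rewrite /p mulrAC ler_pdivrMr// mul1r /rsq -(real_normK (num_real (s - a))).
  move: (t - a) `|s - a| => x y; have : 0 <= (x - y) ^+ 2 by exact: sqr_ge0.
  have := sqr_ge0 x; have := sqr_ge0 y; move=> ? ? ?; nra.
apply: (@le_trans _ _ (p * wt a s + p / wt a s * f ^+ 2)); last first.
  by rewrite lerD2l ler_wpM2r// sqr_ge0.
have -> : p * wt a s + p / wt a s * f ^+ 2 = p / wt a s * (wt a s ^+ 2 + f ^+ 2).
  by field; rewrite gt_eqF.
rewrite -[leLHS]mulr1 -(divff (lt0r_neq0 w0)) (_ : p * f * (wt a s / wt a s) = p / wt a s * (wt a s * f)); last by ring.
apply: ler_wpM2l; first by rewrite divr_ge0// ltW.
by have : 0 <= (wt a s - f) ^+ 2 by [exact: sqr_ge0]; have := sqr_ge0 (wt a s); have := sqr_ge0 f; move=> ? ? ?; nra.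
Qed.

Lemma pF_int_lty t psi : a < t -> L2 psi -> (\int[mu]_s (pF a t s * cabs (psi s))%:E < +oo)%E.
Proof.
move=> ta /L2P[mp ip].
have mpF : measurable_fun setT (pF a t).
  exact: (measurableT_comp (measurable_pF a) (pair1_measurable t)).
have mc := measurable_cabs mp; have mc2 := measurable_cabs2 mp.
have mpw : measurable_fun setT (fun s => (pF a t s * wt a s)%:E).
  by apply/measurable_EFinP; apply: measurable_funM => //; exact: measurable_wt.
have u0 : 0 < t - a by rewrite subr_gt0.
have i0 : 0 <= (t - a)^-1 + 1 by rewrite addr_ge0// invr_ge0 ltW.
apply: (@le_lt_trans _ _ (\int[mu]_s ((pF a t s * wt a s)%:E + ((t - a)^-1 + 1)%:E * (cabs (psi s) ^+ 2)%:E))%E).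
  apply: ge0_le_integral => //.
  - by move=> s _; rewrite lee_fin mulr_ge0 ?cabs_ge0// pF_ge0.
  - by apply/measurable_EFinP; exact: measurable_funM.
  - by apply: emeasurable_funD => //; apply: measurable_funeM; exact/measurable_EFinP.
  - by move=> s _; rewrite -!EFinM -EFinD lee_fin pF_mul_le// cabs_ge0.
rewrite ge0_integralD//; last 3 first.
- by move=> s _; rewrite lee_fin mulr_ge0 ?pF_ge0// wt_ge0.
- by move=> s _; rewrite mule_ge0// lee_fin sqr_ge0.
- by apply: measurable_funeM; exact/measurable_EFinP.
apply: lte_add_pinfty; first by apply: le_lt_trans (int_pF_wt a t) _; rewrite ltry.
rewrite ge0_integralZl//.
- by apply: lte_mul_pinfty.
- exact/measurable_EFinP.
- by move=> s _; rewrite lee_fin sqr_ge0.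
Qed.

Lemma adm_cintegrable kr K psi t : adm kr K -> L2 psi -> a < t ->
  cintegrable (fun s => kr t s * psi s).
Proof.
move=> [K0 mk hk] Lp ta; have [mp _] := (L2P psi).1 Lp.
have mpF : measurable_fun setT (pF a t).
  exact: (measurableT_comp (measurable_pF a) (pair1_measurable t)).
have mpc : measurable_fun setT (fun s => pF a t s * cabs (psi s)).
  by apply: measurable_funM => //; exact: measurable_cabs.
apply: (@le_cintegrable _ _ (fun s => K * (pF a t s * cabs (psi s)))).
- by apply: cmeasM => //; exact: cmeas_section.
- by apply: measurable_funM => //; exact: measurable_cst.
- by move=> s; rewrite !mulr_ge0 ?cabs_ge0// pF_ge0.
- apply: ae_imp (ae_neq a) => s sa; rewrite cabsM mulrA; apply: ler_wpM2r; first exact: cabs_ge0.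
  by rewrite /pF ta sa hk.
- under eq_integral do rewrite EFinM.
  rewrite ge0_integralZl//.
  + by apply: lte_mul_pinfty => //; exact: pF_int_lty.
  + exact/measurable_EFinP.
  + by move=> s _; rewrite lee_fin mulr_ge0 ?cabs_ge0// pF_ge0.
Qed.

(** The majorant [p t s * f s] is separate from the kernel and the data: for [kAC], [f] is [|psi|]
    cut off to [s > a], which records the part of the data that is used. The null set [s = a] is
    left out because [pF] vanishes there. *)
Lemma Tk_sqn kr psi (K c : R) (p : R -> R -> R) (f : R -> R) : 0 <= K ->
  cmeas (fun z : R * R => kr z.1 z.2) -> cmeas psi ->
  (forall t, a < t -> cintegrable (fun s => kr t s * psi s)) ->
  measurable_fun setT f -> (forall s, 0 <= f s) -> (forall t s, 0 <= p t s) ->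
  measurable_fun setT (fun z : R * R => p z.1 z.2) ->
  (forall t s, a < t -> s != a -> cabs (kr t s * psi s) <= K * (p t s * f s)) ->
  (\int[mu]_t ((\int[mu]_s (p t s * f s)%:E) * (\int[mu]_s (p t s * f s)%:E)) <=
    c%:E * \int[mu]_s (f s ^+ 2)%:E)%E ->
  (sqn (Tk kr psi) <= (K ^+ 2 * c)%:E * \int[mu]_s (f s ^+ 2)%:E)%E.
Proof.
move=> K0 mk mp ik mf f0 p0 mpk hk hc.
have mpf2 : measurable_fun setT (fun z : R * R => p z.1 z.2 * f z.2).
  by apply: measurable_funM => //; exact: (measurableT_comp mf measurable_snd).
have pf0 t s : 0 <= p t s * f s by rewrite mulr_ge0.
have mI : measurable_fun setT (fun t => \int[mu]_s (p t s * f s)%:E)%E.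
  exact: (measurable_int_section (h := fun t s => p t s * f s)).
have mpf t : measurable_fun setT (fun s => p t s * f s).
  exact: (measurableT_comp mpf2 (pair1_measurable t)).
have I0 t : (0 <= \int[mu]_s (p t s * f s)%:E)%E.
  by apply: integral_ge0 => s _; rewrite lee_fin.
have mII : measurable_fun setT (fun t => (\int[mu]_s (p t s * f s)%:E) * (\int[mu]_s (p t s * f s)%:E))%E.
  exact: emeasurable_funM.
apply: (@le_trans _ _ (\int[mu]_t ((K ^+ 2)%:E * ((\int[mu]_s (p t s * f s)%:E) * (\int[mu]_s (p t s * f s)%:E))))%E); last first.
  rewrite ge0_integralZl//; last 2 first.
  - by move=> t _; rewrite mule_ge0.
  - by rewrite lee_fin sqr_ge0.
  by rewrite [(K ^+ 2 * c)%:E]EFinM -muleA lee_wpmul2l// lee_fin sqr_ge0.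
apply: ge0_le_integral => //.
- by move=> t _; rewrite lee_fin sqr_ge0.
- by apply/measurable_EFinP; apply: measurable_cabs2; exact: cmeas_Tk.
- exact: measurable_funeM.
move=> t _; rewrite /Tk; case: ifPn => ta; last first.
  by rewrite cabs0 expr0n /= mule_ge0// ?mule_ge0// lee_fin sqr_ge0.
have h : ((cabs (cint (fun s => kr t s * psi s)))%:E <= K%:E * \int[mu]_s (p t s * f s)%:E)%E.
  apply: (le_trans (cabs_cint (ik t ta))).
  have mpfE : measurable_fun setT (fun s => (p t s * f s)%:E) by exact/measurable_EFinP.
  rewrite -(@ge0_integralZl _ _ R mu setT measurableT _ mpfE K%:E)//.
    apply: ae_ge0_le_integral => //.
    - by move=> s _; rewrite lee_fin cabs_ge0.
    - apply/measurable_EFinP; apply: measurable_cabs; apply: cmeasM => //; exact: cmeas_section.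
    - by move=> s _; rewrite lee_fin mulr_ge0.
    - exact: measurable_funeM.
    - by apply: ae_imp (ae_neq a) => s sa _; rewrite -EFinM lee_fin hk.
  by move=> s _; rewrite lee_fin.
have -> : ((cabs (cint (fun s => kr t s * psi s)) ^+ 2)%:E =
   (cabs (cint (fun s => kr t s * psi s)))%:E * (cabs (cint (fun s => kr t s * psi s)))%:E)%E.
  by rewrite -EFinM expr2.
rewrite expr2 EFinM muleACA; apply: lee_pmul => //; by rewrite lee_fin cabs_ge0.
Qed.

Lemma adm_sqn kr K psi : adm kr K -> L2 psi ->
  (sqn (Tk kr psi) <= (K ^+ 2 * (2 * c2 * c2))%:E * sqn psi)%E.
Proof.
move=> ad Lp; have [K0 mk hk] := ad; have [mp _] := (L2P psi).1 Lp.
apply: (@Tk_sqn kr psi K _ (pF a)) => //.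
- by move=> t ta; exact: adm_cintegrable ad Lp ta.
- exact: measurable_cabs.
- by move=> s; exact: cabs_ge0.
- exact: pF_ge0.
- exact: measurable_pF.
- move=> t s ta sa; rewrite cabsM mulrA; apply: ler_wpM2r; first exact: cabs_ge0.
  by rewrite /pF ta sa hk.
- by apply: schurF; [exact: measurable_cabs|move=> s; exact: cabs_ge0].
Qed.

Lemma Tk_L2 kr K psi : adm kr K -> L2 psi -> L2 (Tk kr psi).
Proof.
move=> ad Lp; have [K0 mk hk] := ad; have [mp ip] := (L2P psi).1 Lp.
apply/L2P; split; first exact: cmeas_Tk.
apply: (le_lt_trans (adm_sqn ad Lp)); apply: lte_mul_pinfty => //.
rewrite lee_fin mulr_ge0 ?sqr_ge0// mulr_ge0 ?(ltW (c2_gt0 R))//.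
by rewrite mulr_ge0 ?(ltW (c2_gt0 R)).
Qed.

Lemma Tk_lin kr K (c : C) psi phi t : adm kr K -> L2 psi -> L2 phi ->
  Tk kr (fun s => c * psi s + phi s) t = c * Tk kr psi t + Tk kr phi t.
Proof.
move=> ad Lp Lq; rewrite /Tk; case: ifP => ta; last by rewrite mulr0 addr0.
have ip := adm_cintegrable ad Lp ta; have iq := adm_cintegrable ad Lq ta.
rewrite -cintZ// -cintD//; last exact: cintegrableZ.
by congr cint; apply/funext => s; rewrite mulrDr mulrCA.
Qed.

Lemma Tk_ae kr psi phi t : cmeas (fun z : R * R => kr z.1 z.2) -> cmeas psi -> cmeas phi ->
  {ae mu, forall s, psi s = phi s} -> Tk kr psi t = Tk kr phi t.
Proof.
move=> mk mp mq pq; rewrite /Tk; case: ifP => // ta; apply: cint_ae.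
- by apply: cmeasM => //; exact: cmeas_section.
- by apply: cmeasM => //; exact: cmeas_section.
- by apply: ae_imp pq => s ->.
Qed.

End Operators.

(** * Diagonal extraction *)

Section Diagonal.
Variable R : realType.

Lemma ball_dist (x y e : R) : ball x e y -> `|y - x| < e.
Proof. by rewrite -ball_normE /= distrC. Qed.

Lemma nbhs_prod_dist (I : countType) (f : prod_topology (fun _ : I => R : topologicalType))
  (e : R) i : 0 < e -> nbhs f [set g : I -> R | `|g i - f i| < e].
Proof.
move=> e0.
have bN : nbhs (f i) (ball (f i : R) e) by exact: nbhsx_ballx.
have pc := @proj_continuous I (fun=> R : topologicalType) i f _ bN.
apply: (@filterS _ (nbhs f) (nbhs_filter f) _ _ _ pc) => g gb.
exact: (ball_dist gb).
Qed.

(* The limit is a cluster point in the product of the segments [-B, B], compact by Tychonoff. *)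
Lemma bounded_pointwise_subseq (I : countType) (x : nat -> I -> R) (B : R) :
  (forall n i, `|x n i| <= B) ->
  exists (phi : nat -> nat) (l : I -> R),
    {homo phi : m n / (m < n)%N >-> (m < n)%N} /\
    forall i, x (phi n) i @[n --> \oo] --> l i.
Proof.
move=> xB.
have cK := @tychonoff I (fun=> R : topologicalType) (fun=> `[- B, B]%classic)
  (fun=> @segment_compact R (- B) B).
have [|f [_ clf]] := cK (x @ \oo) _ _.
  by exists 0%N => // n _ i; rewrite /= in_itv/= -ler_norml.
(* Stage [N] controls only the finitely many coordinates of code at most [N], which is what a
   neighbourhood in the product topology can do. *)
have step N m : exists n, (m < n)%N /\
    forall i, (pickle i <= N)%N -> `|x n i - f i| < N.+1%:R^-1.
  have e0 : 0 < N.+1%:R^-1 :> R by [].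
  pose P (k : 'I_N.+1) := [set g : I -> R |
    if unpickle k is Some i then `|g i - f i| < N.+1%:R^-1 else true].
  have nb : nbhs f [set g | forall k, P k g].
    apply: (@filter_forall _ _ P (nbhs f) (nbhs_filter f)).
    move=> k; rewrite /P; case: (unpickle k) => [i|]; last exact: nearW.
    exact: nbhs_prod_dist.
  have [|g [[n mn ->] hg]] := clf [set g | exists2 n, (m < n)%N & g = x n] _ _ nb.
    by exists m.+1 => // n /= mn; exists n.
  exists n; split => // i iN.
  by have := hg (Ordinal (iN : (pickle i < N.+1)%N)); rewrite /P /= pickleK.
have [st hst] := choice (fun p : nat * nat => step p.1 p.2).
pose phi := fix phi n := if n is k.+1 then st (k.+1, phi k) else st (0, 0)%N.
exists phi, f; split.
  by apply: homo_ltn => [? ? ?|n]; [exact: ltn_trans|exact: (hst (n.+1, phi n)).1].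
move=> i.
have h n : (pickle i <= n)%N -> `|x (phi n) i - f i| < n.+1%:R^-1.
  by case: n => [|n] ni; [exact: (hst (0, 0)%N).2|exact: (hst (n.+1, phi n)).2].
apply/cvgrPdist_lt => e e0; near=> n.
have ni : (pickle i <= n)%N by near: n; exists (pickle i).
rewrite distrC (lt_trans (h n ni))//.
rewrite invf_plt ?posrE// (@lt_le_trans _ _ n%:R)//; last by rewrite ler_nat.
by near: n; exact: nbhs_infty_gtr.
Unshelve. all: by end_near.
Qed.

End Diagonal.

(** * From pointwise convergence to convergence in L^2 *)

Section Compactness.
Variable R : realType.
Local Notation C := R[i].
Local Notation mu := (@lebesgue_measure R).
Implicit Types (psi : R -> C).

(** A positive bound [A] on the kernel section is the form in which [amgm_opt] applies; the value
    [l = 1] of its parameter gives integrability. *)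
Lemma cs_cint (kap psi : R -> C) (A : R) : cmeas kap -> L2 psi -> 0 < A ->
  (sqn kap <= A%:E)%E ->
  cintegrable (fun s => kap s * psi s) /\
  ((cabs (cint (fun s => kap s * psi s)) ^+ 2)%:E <= A%:E * sqn psi)%E.
Proof.
move=> mk /L2P[mp ip] A0 kA.
have mk1 := measurable_cabs mk; have mk2 := measurable_cabs2 mk.
have mp1 := measurable_cabs mp; have mp2 := measurable_cabs2 mp.
have mkp : cmeas (fun s => kap s * psi s) by exact: cmeasM.
set I := (\int[mu]_s (cabs (kap s * psi s))%:E)%E.
have I0 : (0 <= I)%E by apply: integral_ge0 => s _; rewrite lee_fin cabs_ge0.
have mI : measurable_fun setT (fun s => (cabs (kap s * psi s))%:E).
  by apply/measurable_EFinP; exact: measurable_cabs.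
have mk2E : measurable_fun setT (fun s => (cabs (kap s) ^+ 2)%:E) by exact/measurable_EFinP.
have mp2E : measurable_fun setT (fun s => (cabs (psi s) ^+ 2)%:E) by exact/measurable_EFinP.
have main (l : R) : 0 < l -> (I + I <= (l * A)%:E + (l^-1)%:E * sqn psi)%E.
  move=> l0; have li0 : 0 <= l^-1 by rewrite invr_ge0 ltW.
  rewrite /I -ge0_integralD//; try by move=> s _; rewrite lee_fin cabs_ge0.
  apply: (@le_trans _ _ (\int[mu]_s (l%:E * (cabs (kap s) ^+ 2)%:E + (l^-1)%:E * (cabs (psi s) ^+ 2)%:E))%E).
    apply: ge0_le_integral => //.
    - by move=> s _; rewrite -EFinD lee_fin addr_ge0// cabs_ge0.
    - exact: emeasurable_funD.
    - by apply: emeasurable_funD; exact: measurable_funeM.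
    - move=> s _; rewrite -!EFinM -!EFinD lee_fin cabsM.
      rewrite -subr_ge0 (_ : _ - _ = l^-1 * (l * cabs (kap s) - cabs (psi s)) ^+ 2).
        by rewrite mulr_ge0 ?sqr_ge0.
      by move: (cabs (kap s)) (cabs (psi s)) => ? ?; field; rewrite gt_eqF.
  rewrite ge0_integralD//; last 4 first.
  - by move=> s _; rewrite mule_ge0// lee_fin ?(ltW l0)// sqr_ge0.
  - exact: measurable_funeM.
  - by move=> s _; rewrite mule_ge0// lee_fin sqr_ge0.
  - exact: measurable_funeM.
  rewrite !ge0_integralZl//; try by move=> s _; rewrite lee_fin sqr_ge0.
    by rewrite EFinM leeD2r// lee_wpmul2l// lee_fin ltW.
  by rewrite lee_fin ltW.
have Ifin : (I < +oo)%E.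
  apply: (@le_lt_trans _ _ (I + I)%E); first by rewrite leeDl.
  apply: (le_lt_trans (main 1 ltr01)); rewrite invr1 mul1e.
  by apply: lte_add_pinfty => //; rewrite ltry.
have ci : cintegrable (fun s => kap s * psi s) by case: mkp => m1 m2; split.
split => //; apply: le_trans (amgm_opt I0 (sqn_ge0 psi) A0 main).
rewrite expr2 EFinM; apply: lee_pmul; rewrite ?lee_fin ?cabs_ge0//; exact: cabs_cint.
Qed.

Lemma cvg_cabs2 (u : nat -> C) l : ccvg \oo u l ->
  cabs (u n) ^+ 2 @[n --> \oo] --> cabs l ^+ 2.
Proof.
move=> ul; have h : cabs (u n) @[n --> \oo] --> cabs l by exact: cvg_cabs.
by rewrite expr2; under eq_fun do rewrite expr2; exact: cvgM.
Qed.

Lemma cvg_cabs2_sub (u : nat -> C) l : ccvg \oo u l ->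
  (cabs (u n - l) ^+ 2)%:E @[n --> \oo] --> 0%E.
Proof.
move=> ul; have h1 : ccvg \oo (fun n => u n - l) (l - l).
  by apply: ccvgD => //; exact: ccvg_cst.
have := cvg_cabs2 h1; rewrite subrr cabs0 expr0n /= => h.
by apply/cvg_EFin; first exact: nearW.
Qed.

Variables (a : R) (kr : R -> R -> C) (K : R).
Local Notation rr := (rsq a).
Hypotheses (K0 : 0 < K) (mk : cmeas (fun z : R * R => kr z.1 z.2))
  (hb : forall t s, a < t -> cabs (kr t s) <= K / (1 + rr t s))
  (hc : forall t s, a < t -> ccvg (nbhs t) (fun t' => kr t' s) (kr t s)).
Local Notation T := (Tk a kr).

(** Since [(1 + x + y)^2 >= (1 + x) (1 + y)], [kr_sqr_le] bounds [|kr t s|^2] by the product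
    [K^2 W t W s]. Thus [W] dominates the sections in [s] as well as the images in [t]. *)
Definition W (s : R) : R := (1 + (s - a) ^+ 2)^-1.

Lemma W_gt0 s : 0 < W s.
Proof. by rewrite invr_gt0 ltr_pwDl// sqr_ge0. Qed.
Lemma W_le1 s : W s <= 1.
Proof. by rewrite invf_le1 ?lerDl ?sqr_ge0// ltr_pwDl// sqr_ge0. Qed.

Lemma measurable_W : measurable_fun setT W.
Proof.
apply: measurable_fun_invr; apply: measurable_funD; first exact: measurable_cst.
by apply: measurable_funX; apply: measurable_funB => //; exact: measurable_cst.
Qed.

Lemma int_W : (\int[mu]_s (W s)%:E <= pi%:E)%E.
Proof.
have -> : pi = pi / 2 - - (pi / 2) :> R by rewrite opprK -splitr.
apply: (@ge0_FTC_bigcup_le R W (fun s => atan (s - a)) _ (fun n => - n.+1%:R) (fun n => n.+1%:R)).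
- by move=> n; rewrite gtrN.
- move=> i j ij; rewrite subsetEset => x /=; rewrite !in_itv/= => /andP[h1 h2].
  by rewrite (le_trans _ h1) ?lerN2 ?ler_nat// (le_trans h2)// ler_nat.
- apply/seteqP; split => // x _.
  exists (Num.truncn `|x|) => //=; rewrite in_itv/= -ler_norml; exact/ltW/truncnS_gt.
- exact: measurable_W.
- by move=> x _; exact/ltW/W_gt0.
- move=> x _; apply: cvgV; first by rewrite gt_eqF// ltr_pwDl// sqr_ge0.
  apply: cvgD; first exact: cvg_cst.
  have h : (s - a) @[s --> x] --> x - a by apply: cvgB; [exact: cvg_id|exact: cvg_cst].
  by rewrite expr2; under eq_fun do rewrite expr2; exact: cvgM.
- move=> x _; apply: has_der_eq; first by der.
  by rewrite /W addr0 mulr1.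
- by move=> x _; rewrite !ltW ?atan_gtNpi2 ?atan_ltpi2.
Qed.

Lemma integrable_W (c : R) : 0 <= c -> mu.-integrable setT (fun s => (c * W s)%:E).
Proof.
move=> c0; have mWE : measurable_fun setT (fun s => (W s)%:E).
  by apply/measurable_EFinP; exact: measurable_W.
apply/integrableP; split.
  by apply/measurable_EFinP; apply: measurable_funM; [exact: measurable_cst|exact: measurable_W].
apply: (@le_lt_trans _ _ (\int[mu]_s (c%:E * (W s)%:E))%E).
  rewrite le_eqVlt; apply/orP; left; apply/eqP; apply: eq_integral => s _.
  by rewrite gee0_abs ?EFinM// lee_fin mulr_ge0// ltW// W_gt0.
rewrite ge0_integralZl//.
- by apply: lte_mul_pinfty => //; apply: (le_lt_trans int_W); rewrite ltry.
- by move=> s _; rewrite lee_fin; exact/ltW/W_gt0.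
Qed.

Lemma kr_sqr_le t s : a < t -> cabs (kr t s) ^+ 2 <= K ^+ 2 * (W t * W s).
Proof.
move=> ta; apply: (@le_trans _ _ ((K / (1 + rr t s)) ^+ 2)).
  by apply: lerXn2r; rewrite ?nnegrE ?cabs_ge0 ?hb// divr_ge0 ?(ltW K0)// addr_ge0// ltW// rsq_gt0.
rewrite exprMn; apply: ler_wpM2l; first exact: sqr_ge0.
rewrite /W -invfM exprVn lef_pV2 ?posrE; first last.
- by rewrite mulr_gt0// ltr_pwDl// sqr_ge0.
- by rewrite exprn_gt0// addr_gt0// rsq_gt0.
rewrite /rsq; have := sqr_ge0 (t - a); have := sqr_ge0 (s - a).
by move: ((t - a) ^+ 2) ((s - a) ^+ 2) => x y x0 y0; nra.
Qed.

Lemma kr_sqn t : a < t -> (sqn (kr t) <= (K ^+ 2 * pi * W t)%:E)%E.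
Proof.
move=> ta; have mWE : measurable_fun setT (fun s => (W s)%:E).
  by apply/measurable_EFinP; exact: measurable_W.
apply: (@le_trans _ _ (\int[mu]_s ((K ^+ 2 * W t)%:E * (W s)%:E))%E).
  apply: ge0_le_integral => //.
  - by move=> s _; rewrite lee_fin sqr_ge0.
  - by apply/measurable_EFinP; apply: measurable_cabs2; exact: cmeas_section.
  - exact: measurable_funeM.
  - by move=> s _; rewrite -EFinM lee_fin -mulrA kr_sqr_le.
rewrite ge0_integralZl//.
- rewrite (mulrAC _ pi) [X in (_ <= X)%E]EFinM lee_wpmul2l ?int_W// lee_fin mulr_ge0 ?sqr_ge0//.
  exact/ltW/W_gt0.
- by move=> s _; rewrite lee_fin; exact/ltW/W_gt0.
- by rewrite lee_fin mulr_ge0 ?sqr_ge0//; exact/ltW/W_gt0.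
Qed.

Lemma Tk_le psi (M t : R) : a < t -> L2 psi -> (sqn psi <= M%:E)%E ->
  cabs (T psi t) ^+ 2 <= K ^+ 2 * pi * M * W t.
Proof.
move=> ta Lp pM; have A0 : 0 < K ^+ 2 * pi * W t.
  by rewrite !mulr_gt0 ?W_gt0 ?pi_gt0.
have [_ h] := cs_cint (cmeas_section t mk) Lp A0 (kr_sqn ta).
rewrite -lee_fin /Tk ta; apply: (le_trans h).
rewrite (mulrAC _ M) [X in (_ <= X)%E]EFinM lee_wpmul2l// lee_fin ltW//.
Qed.

Lemma Tk_ge psi t : t <= a -> T psi t = 0.
Proof. by move=> ta; rewrite /Tk ltNge ta. Qed.

(** Dominated convergence; the majorant [4 K^2 W] bounds the square of the difference of two
    sections. *)
Lemma kr_L2cvg (t0 : R) (q : nat -> R) : a < t0 -> (forall n, a < q n) ->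
  q n @[n --> \oo] --> t0 ->
  sqn (fun s => kr (q n) s - kr t0 s) @[n --> \oo] --> 0%E.
Proof.
move=> t0a qa qt.
have mKs t : cmeas (kr t) by exact: cmeas_section.
have md n : cmeas (fun s => kr (q n) s - kr t0 s) by apply: cmeasD => //; exact: cmeasN.
have mWE : measurable_fun setT (fun s => (4 * K ^+ 2 * W s)%:E).
  by apply/measurable_EFinP; apply: measurable_funM; [exact: measurable_cst|exact: measurable_W].
have [|||||_ _] := @dominated_convergence _ _ R mu setT measurableT
  (fun n s => (cabs (kr (q n) s - kr t0 s) ^+ 2)%:E) (fun=> 0%E) (fun s => (4 * K ^+ 2 * W s)%:E).
- by move=> n; apply/measurable_EFinP; exact: (measurable_cabs2 (md n)).
- exact: measurable_cst.
- apply: nearW => s _.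
  apply: cvg_cabs2_sub; have [c1 c2] := hc s t0a; split.
    exact: (cvg_comp _ (fun t => Re (kr t s)) qt c1).
  exact: (cvg_comp _ (fun t => Im (kr t s)) qt c2).
- by apply: integrable_W; rewrite mulr_ge0// sqr_ge0.
- apply: nearW => s n _; rewrite gee0_abs ?lee_fin ?sqr_ge0//.
  have h t : a < t -> cabs (kr t s) ^+ 2 <= K ^+ 2 * W s.
    move=> ta; rewrite (le_trans (kr_sqr_le s ta))// ler_wpM2l ?sqr_ge0//.
    by rewrite ler_piMl ?W_le1// ltW// W_gt0.
  rewrite (le_trans (cabsD2 _ _))// cabsN.
  have := h _ t0a; have := h _ (qa n).
  by rewrite -(mulrA 4); move: (cabs _ ^+ 2) (cabs _ ^+ 2) (K ^+ 2 * W s) => x y z ? ?; lra.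
by rewrite integral0.
Qed.

(** By [kr_L2cvg] and Cauchy-Schwarz, the value at [t0] is close to that at a nearby rational,
    uniformly in [n]; convergence there makes the values at [t0] a Cauchy sequence. [Pr] stands for
    [Re] or [Im]. *)
Lemma Tk_cvg (psi : nat -> R -> C) (M t0 : R) (Pr : C -> R) :
  (forall z w : C, `|Pr z - Pr w| <= cabs (z - w)) ->
  (forall n, L2 (psi n)) -> 0 <= M -> (forall n, (sqn (psi n) <= M%:E)%E) -> a < t0 ->
  (forall q : rat, exists l : R, Pr (T (psi n) (ratr q)) @[n --> \oo] --> l) ->
  exists l : R, Pr (T (psi n) t0) @[n --> \oo] --> l.
Proof.
move=> hPr Lp M0 pM t0a hq; apply/cvg_ex; apply: cauchy_cvg; apply: cauchy_exP => e e0.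
(* Chosen so that [A * M <= (e/4)^2]; the [+ 1] allows [M = 0]. *)
pose A := e ^+ 2 / (16 * (M + 1)).
have M1 : 0 < 16 * (M + 1) by rewrite mulr_gt0// ltr_wpDl.
have A0 : 0 < A by rewrite divr_gt0// exprn_gt0.
have /choice[q hqq] : forall n : nat, exists q : rat, t0 < ratr q < t0 + n.+1%:R^-1.
  move=> n; have [|q] := @rat_in_itvoo R t0 (t0 + n.+1%:R^-1); first by rewrite ltrDl.
  by rewrite in_itv/=; exists q.
have qa n : a < ratr (q n) by have /andP[h _] := hqq n; exact: lt_trans h.
have qt : ratr (q n) @[n --> \oo] --> t0.
  apply: (@squeeze_cvgr _ _ _ _ (fun=> t0) (fun n => t0 + n.+1%:R^-1)).
  - by apply: nearW => n; have /andP[h1 h2] := hqq n; rewrite !ltW.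
  - exact: cvg_cst.
  - rewrite -[X in _ --> X]addr0; apply: cvgD; first exact: cvg_cst.
    exact: cvg_harmonic.
have cvgk := kr_L2cvg t0a qa qt.
pose D m s : C := kr (ratr (q m)) s - kr t0 s.
have [m hm] : exists m, (sqn (D m) <= A%:E)%E.
  have : \forall m \near \oo, (sqn (D m) < A%:E)%E.
    have /fine_cvgP[fn fc] := cvgk.
    near=> m; have Dm : sqn (D m) \is a fin_num by near: m; exact: fn.
    rewrite -(fineK Dm) lte_fin; near: m; exact: (cvgr_lt _ fc).
  by move=> /filter_ex[m hm]; exists m; exact: ltW.
have dT n : cabs (T (psi n) (ratr (q m)) - T (psi n) t0) <= e / 4.
  have md : cmeas (fun s => kr (ratr (q m)) s - kr t0 s).
    by apply: cmeasD; [exact: cmeas_section|apply: cmeasN; exact: cmeas_section].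
  have [i1 _] := cs_cint (cmeas_section (ratr (q m)) mk) (Lp n)
    (mulr_gt0 (mulr_gt0 (exprn_gt0 2 K0) (pi_gt0 R)) (W_gt0 _)) (kr_sqn (qa m)).
  have [i2 _] := cs_cint (cmeas_section t0 mk) (Lp n)
    (mulr_gt0 (mulr_gt0 (exprn_gt0 2 K0) (pi_gt0 R)) (W_gt0 _)) (kr_sqn t0a).
  have [_ h] := cs_cint md (Lp n) A0 hm.
  have E : cint (fun s => (kr (ratr (q m)) s - kr t0 s) * psi n s) =
      T (psi n) (ratr (q m)) - T (psi n) t0.
    rewrite /Tk (qa m) t0a -mulN1r -cintZ// -cintD//; last exact: cintegrableZ.
    by congr cint; apply/funext => s; rewrite mulrBl mulN1r.
  rewrite E in h.
  have {h} : cabs (T (psi n) (ratr (q m)) - T (psi n) t0) ^+ 2 <= A * M.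
    by rewrite -lee_fin (le_trans h)// [(A * M)%:E]EFinM lee_wpmul2l// lee_fin ltW.
  move=> h; rewrite -(ler_pXn2r (ltn0Sn 1)) ?nnegrE ?cabs_ge0 ?divr_ge0 ?(ltW e0)//.
  rewrite (le_trans h)// /A -mulrA exprMn; apply: ler_wpM2l; first exact: sqr_ge0.
  rewrite ler_pdivrMl//; lra.
have [y hy] := hq (q m); exists y.
have /cvgrPdist_lt /(_ (e / 2)) hy2 := hy.
have e2 : 0 < e / 2 by rewrite divr_gt0.
apply: filterS (hy2 e2) => n; rewrite /ball /= => h.
rewrite -[y - _](subrKA (Pr (T (psi n) (ratr (q m))))) (le_lt_trans (ler_normD _ _))//.
have h2 := le_trans (hPr (T (psi n) (ratr (q m))) (T (psi n) t0)) (dT n).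
by move: h h2; move: `|_| `|_| => x1 x2; lra.
Unshelve. all: by end_near.
Qed.

(** [Tk_le] dominates all images by one multiple of [W], so the pointwise limit is a limit in
    [L^2]. *)
Lemma Tk_L2cvg (psi : nat -> R -> C) (f : R -> C) (M : R) :
  (forall n, L2 (psi n)) -> 0 <= M -> (forall n, (sqn (psi n) <= M%:E)%E) ->
  (forall t, t <= a -> f t = 0) ->
  (forall t, a < t -> ccvg \oo (fun n => T (psi n) t) (f t)) ->
  L2 f /\ sqn (fun t => T (psi n) t - f t) @[n --> \oo] --> 0%E.
Proof.
move=> Lp M0 pM f0 cf.
have p0 := pi_gt0 R.
have cfT t : ccvg \oo (fun n => T (psi n) t) (f t).
  have [ta|ta] := ltP a t; first exact: cf.
  by under eq_fun do rewrite Tk_ge//; rewrite f0//; exact: ccvg_cst.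
have mT n : cmeas (T (psi n)) by apply: cmeas_Tk => //; have /L2P[] := Lp n.
have mf : cmeas f.
  split.
    apply: (@measurable_fun_cvg _ _ R setT (fun n t => Re (T (psi n) t))).
      by move=> n; have [] := mT n.
    by move=> t _; have [] := cfT t.
  apply: (@measurable_fun_cvg _ _ R setT (fun n t => Im (T (psi n) t))).
    by move=> n; have [] := mT n.
  by move=> t _; have [] := cfT t.
pose Cst := K ^+ 2 * pi * M.
have C0 : 0 <= Cst by rewrite (mulr_ge0 (mulr_ge0 (sqr_ge0 K) (ltW p0)) M0).
have Tb n t : cabs (T (psi n) t) ^+ 2 <= Cst * W t.
  have [ta|ta] := ltP a t; first exact: Tk_le.
  by rewrite Tk_ge// cabs0 expr0n /= mulr_ge0// ltW// W_gt0.
have c2 t : cabs (T (psi n) t) ^+ 2 @[n --> \oo] --> cabs (f t) ^+ 2.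
  exact: cvg_cabs2.
have fb t : cabs (f t) ^+ 2 <= Cst * W t.
  rewrite -(cvg_lim _ (c2 t))//; apply: limr_le; first by apply/cvg_ex; eexists; exact: c2.
  exact: nearW.
have mWE : measurable_fun setT (fun t => (Cst * W t)%:E).
  by have /integrableP[] := integrable_W C0.
have md n : cmeas (fun t => T (psi n) t - f t) by apply: cmeasD => //; exact: cmeasN.
split.
  apply/L2P; split => //; have /integrableP[_] := integrable_W C0; apply: le_lt_trans; apply: ge0_le_integral => //.
  - by move=> t _; rewrite lee_fin sqr_ge0.
  - by apply/measurable_EFinP; exact: measurable_cabs2.
  - exact: measurableT_comp mWE.
  - by move=> t _; rewrite (le_trans _ (lee_abs _))// lee_fin.
have C4 : 0 <= 4 * Cst by rewrite mulr_ge0.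
have [|||||_ _] := @dominated_convergence _ _ R mu setT measurableT
  (fun n t => (cabs (T (psi n) t - f t) ^+ 2)%:E) (fun=> 0%E) (fun t => (4 * Cst * W t)%:E).
- by move=> n; apply/measurable_EFinP; exact: (measurable_cabs2 (md n)).
- exact: measurable_cst.
- apply: nearW => t _.
  exact: cvg_cabs2_sub.
- exact: integrable_W.
- apply: nearW => t n _; rewrite gee0_abs ?lee_fin ?sqr_ge0//.
  rewrite (le_trans (cabsD2 _ _))// cabsN.
  have := fb t; have := Tb n t.
  by rewrite -(mulrA 4); move: (cabs _ ^+ 2) (cabs _ ^+ 2) (Cst * W t) => x y z ? ?; lra.
by rewrite integral0.
Qed.

End Compactness.

(** * Operators on four components *)

Lemma prev4K : cancel prev4 next4.
Proof. by case=> [[|[|[|[|]]]]]// i; exact/val_inj. Qed.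

Lemma next4K : cancel next4 prev4.
Proof. by case=> [[|[|[|[|]]]]]// i; exact/val_inj. Qed.

Section VectorOperators.
Variable R : realType.
Local Notation C := R[i].
Local Notation mu := (@lebesgue_measure R).
Local Notation c2 := (pi / Num.sqrt (2 : R)).
Implicit Types (psi : R -> C) (F G : vec R).

Lemma l2normD_le (f g : R -> C) : L2 f -> L2 g ->
  l2norm (fun x => f x + g x) ^+ 2 <= 2 * l2norm f ^+ 2 + 2 * l2norm g ^+ 2.
Proof.
move=> Lf Lg; have [mf _] := (L2P f).1 Lf; have [mg _] := (L2P g).1 Lg.
rewrite -lee_fin -sqnE; last exact: L2D.
by rewrite (le_trans (sqnD_le mf mg))// (sqnE Lf) (sqnE Lg) -!EFinM -EFinD.
Qed.

Lemma l2norm_Sop (f : R -> C) : L2 f -> l2norm (Sop f) ^+ 2 = l2norm f ^+ 2.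
Proof.
move=> Lf; have [mf _] := (L2P f).1 Lf; apply: EFin_inj.
by rewrite -(sqnE Lf) -sqn_Sop// sqnE//; exact: L2_Sop.
Qed.

Lemma cvg_sum4 (h : 'I_4 -> nat -> R) : (forall j, h j n @[n --> \oo] --> (0 : R)) ->
  \sum_(j < 4) h j n @[n --> \oo] --> (0 : R).
Proof.
move=> hh; have H : (h ord0 n + (h (lift ord0 ord0) n + (h (lift ord0 (lift ord0 ord0)) n +
    h (lift ord0 (lift ord0 (lift ord0 ord0))) n))) @[n --> \oo] --> (0 + (0 + (0 + 0)) : R).
  by do 3 (apply: cvgD; first exact: hh); exact: hh.
rewrite !addr0 in H; apply: cvg_trans H; apply: near_eq_cvg; apply: nearW => n /=.
by rewrite !big_ord_recl big_ord0 addr0.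
Qed.

Lemma vnorm_ge0 F : 0 <= vnorm F. Proof. exact: sqrtr_ge0. Qed.

Lemma vnorm2 F : vnorm F ^+ 2 = \sum_(j < 4) l2norm (F j) ^+ 2.
Proof. by rewrite sqr_sqrtr// sumr_ge0// => j _; exact: sqr_ge0. Qed.

Lemma vnorm2E F : vL2 F -> ((vnorm F ^+ 2)%:E = \sum_(j < 4) sqn (F j))%E.
Proof. by move=> LF; rewrite vnorm2 -sumEFin; apply: eq_bigr => j _; rewrite sqnE. Qed.

Lemma vnorm_le F G (c : R) : 0 <= c -> vL2 F -> vL2 G ->
  (\sum_(j < 4) sqn (F j) <= (c ^+ 2)%:E * \sum_(j < 4) sqn (G j))%E -> vnorm F <= c * vnorm G.
Proof.
move=> c0 LF LG; rewrite -!vnorm2E// -EFinM lee_fin -exprMn.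
by rewrite ler_pXn2r// nnegrE ?mulr_ge0 ?vnorm_ge0.
Qed.

Lemma sum_prev4 (h : 'I_4 -> \bar R) : (\sum_(j < 4) h (prev4 j) = \sum_(j < 4) h j)%E.
Proof. by rewrite [RHS](reindex_inj (can_inj prev4K)). Qed.

Lemma sum_next4 (h : 'I_4 -> \bar R) : (\sum_(j < 4) h (next4 j) = \sum_(j < 4) h j)%E.
Proof. by rewrite [RHS](reindex_inj (can_inj next4K)). Qed.

Variable a : R.
Hypothesis a0 : 0 < a.
Implicit Types (kr : R -> R -> C).

(** [DD] for a general kernel, so that the full operator, its part of norm at most [1 / sqrt 2] and
    its compact part are instances of one construction. *)
Definition VT kr F : vec R :=
  fun j t => Sop (Tk a kr (F (prev4 j))) t + Tk a kr (Sop (F (next4 j))) t.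

Lemma vL20_vL2 F : vL20 a F -> vL2 F.
Proof. by move=> LF j; have [] := LF j. Qed.

Lemma L20_Sop psi : L20 a psi -> L20 a (Sop psi).
Proof.
move=> [Lp z]; split; first exact: L2_Sop.
apply: ae_imp (ae_opp z) => t h /andP[t1 t2]; apply: h.
by rewrite ltrN2 t2 ltrNl t1.
Qed.

Lemma VT_L20 kr K F : adm a kr K -> vL2 F -> vL20 a (VT kr F).
Proof.
move=> ad LF j; split.
  apply: L2D; first by apply: L2_Sop; exact: Tk_L2 ad (LF _).
  by apply: Tk_L2 ad _; apply: L2_Sop; exact: LF.
apply: nearW => t /andP[t1 t2]; rewrite /VT /Sop /Tk.
by rewrite ltNge lerNl (ltW t1) /= ltNge (ltW t2) /= addr0.
Qed.

(** The reflected term lives on [t < -a] and the other on [t > a], so the squared norms add without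
    a cross term. *)
Lemma sqn_VT kr F j : cmeas (fun z : R * R => kr z.1 z.2) -> vL2 F ->
  (sqn (VT kr F j) = sqn (Tk a kr (F (prev4 j))) + sqn (Tk a kr (Sop (F (next4 j)))))%E.
Proof.
move=> mk LF.
have m1 : cmeas (Tk a kr (F (prev4 j))).
  by apply: cmeas_Tk => //; have /L2P[] := LF (prev4 j).
have m2 : cmeas (Tk a kr (Sop (F (next4 j)))).
  by apply: cmeas_Tk => //; apply: cmeas_Sop; have /L2P[] := LF (next4 j).
rewrite -(sqn_Sop m1) /sqn -ge0_integralD//.
- apply: eq_integral => t _; rewrite -EFinD; congr EFin.
  rewrite /VT; have [ta|ta] := ltP a t.
    have -> : Sop (Tk a kr (F (prev4 j))) t = 0.
      by rewrite /Sop Tk_ge// lerNl (le_trans _ (ltW ta))// ge0_cp// ltW.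
    by rewrite add0r cabs0 expr0n add0r.
  by rewrite [Tk _ _ (Sop _) t]Tk_ge// cabs0 expr0n !addr0.
- by move=> t _; rewrite lee_fin sqr_ge0.
- by apply/measurable_EFinP; apply: measurable_cabs2; exact: cmeas_Sop.
- by move=> t _; rewrite lee_fin sqr_ge0.
- by apply/measurable_EFinP; exact: measurable_cabs2.
Qed.

Lemma VT_bound kr K F : adm a kr K -> vL2 F ->
  vnorm (VT kr F) <= 2 * K * c2 * vnorm F.
Proof.
move=> ad LF; have [K0 mk _] := ad; have c0 := c2_gt0 R.
have cc : 0 <= K ^+ 2 * (2 * c2 * c2).
  by rewrite mulr_ge0 ?sqr_ge0// mulr_ge0 ?(ltW c0)// mulr_ge0 ?(ltW c0).
apply: vnorm_le => //.
- by rewrite mulr_ge0 ?(ltW c0)// mulr_ge0.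
- by move=> j; have [] := VT_L20 ad LF j.
under eq_bigr => j _ do rewrite (sqn_VT _ mk LF).
apply: (@le_trans _ _ (\sum_(j < 4) ((K ^+ 2 * (2 * c2 * c2))%:E * sqn (F (prev4 j)) +
   (K ^+ 2 * (2 * c2 * c2))%:E * sqn (F (next4 j))))%E).
  apply: lee_sum => j _; apply: leeD; first exact: adm_sqn ad (LF _).
  have [mF _] := (L2P _).1 (LF (next4 j)).
  by rewrite -[X in (_ <= _ * X)%E](sqn_Sop mF); apply: adm_sqn ad _; exact: L2_Sop.
have sF j : (0 <= sqn (F j))%E by exact: sqn_ge0.
(* Both shifts permute the components, so each [sqn (F j)] is counted twice, and [2 * (2 K^2 c2^2)]
   is the square of [2 K c2]. *)
rewrite big_split /= -!ge0_sume_distrr// (sum_prev4 (fun j => sqn (F j))) (sum_next4 (fun j => sqn (F j))).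
rewrite -ge0_muleDl ?lee_fin// -EFinD lee_wpmul2r ?sume_ge0// lee_fin.
rewrite le_eqVlt; apply/orP; left; apply/eqP.
by move: (c2) => x; ring.
Qed.

Lemma VT_lin kr K (c : C) F G j t : adm a kr K -> vL2 F -> vL2 G ->
  VT kr (vadd (vscale c F) G) j t = vadd (vscale c (VT kr F)) (VT kr G) j t.
Proof.
move=> ad LF LG; rewrite /VT /vadd /vscale /Sop.
rewrite (Tk_lin c (- t) ad (LF _) (LG _)).
rewrite (@Tk_lin _ _ _ _ c (Sop (F (next4 j))) (Sop (G (next4 j))) t ad (L2_Sop (LF _)) (L2_Sop (LG _))).
by rewrite mulrDr addrACA.
Qed.

Lemma VT_sub kr K F G : adm a kr K -> vL2 F -> vL2 G ->
  vsub (VT kr G) (VT kr F) = VT kr (vsub G F).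
Proof.
move=> ad LF LG; apply/funext => j; apply/funext => t.
have -> : vsub G F = vadd (vscale (-1) F) G.
  by apply/funext => i; apply/funext => s; rewrite /vsub /vadd /vscale mulN1r addrC.
by rewrite (VT_lin _ _ _ ad)// /vsub /vadd /vscale mulN1r addrC.
Qed.

Lemma VT_op kr K : adm a kr K -> opL20 a (VT kr).
Proof.
move=> ad; have [K0 mk _] := ad; split.
- by move=> F /vL20_vL2; exact: VT_L20 ad.
- move=> F G LF LG FG j; apply: nearW => t; rewrite /VT /Sop.
  have mF i : cmeas (F i) by have [/L2P[]] := LF i.
  have mG i : cmeas (G i) by have [/L2P[]] := LG i.
  congr (_ + _); first exact: (Tk_ae _ _ mk (mF _) (mG _) (FG _)).
  exact: (Tk_ae _ _ mk (cmeas_Sop (mF _)) (cmeas_Sop (mG _)) (ae_opp (FG _))).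
- move=> c F G LF LG j; apply: nearW => t.
  by apply: VT_lin ad _ _; exact: vL20_vL2.
Qed.

(** The part of the data that [kA] sees; for [Sop psi] it comes from [psi] on [s < -a]. *)
Definition posn psi : \bar R := (\int[mu]_s ((if a < s then cabs (psi s) else 0) ^+ 2)%:E)%E.

Lemma measurable_pos psi : cmeas psi -> measurable_fun setT (fun s => if a < s then cabs (psi s) else 0).
Proof.
move=> mp; apply: measurable_fun_ifT; [|exact: measurable_cabs|exact: measurable_cst].
by apply: measurable_fun_ltr => //; exact: measurable_cst.
Qed.

Lemma posn_ge0 psi : (0 <= posn psi)%E.
Proof. by apply: integral_ge0 => s _; rewrite lee_fin sqr_ge0. Qed.

Lemma posn_Sop psi : cmeas psi -> (posn psi + posn (Sop psi) <= sqn psi)%E.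
Proof.
move=> mp; have mq := cmeas_Sop mp.
have m1 : measurable_fun setT (fun s => ((if a < s then cabs (psi s) else 0) ^+ 2)%:E).
  by apply/measurable_EFinP; apply: measurable_funX; exact: measurable_pos.
have m2' : measurable_fun setT (fun s => ((if a < s then cabs (Sop psi s) else 0) ^+ 2)%:E).
  by apply/measurable_EFinP; apply: measurable_funX; exact: measurable_pos.
have m2 : measurable_fun setT (fun s : R => ((if a < - s then cabs (psi s) else 0) ^+ 2)%:E).
  have := measurableT_comp m2' (@measurable_oppT R).
  by apply: eq_measurable_fun => s _ /=; rewrite /Sop opprK.
have -> : posn (Sop psi) = (\int[mu]_s ((if a < - s then cabs (psi s) else 0) ^+ 2)%:E)%E.
  rewrite /posn -[LHS](@ge0_integral_opp _ (fun s => ((if a < s then cabs (Sop psi s) else 0) ^+ 2)%:E))//.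
    by apply: eq_integral => s _; rewrite /Sop opprK.
  by move=> s; rewrite lee_fin sqr_ge0.
rewrite /posn -ge0_integralD//; try by move=> s _; rewrite lee_fin sqr_ge0.
apply: ge0_le_integral => //.
- by move=> s _; rewrite -EFinD lee_fin addr_ge0// sqr_ge0.
- exact: emeasurable_funD.
- by apply/measurable_EFinP; exact: measurable_cabs2.
- move=> s _; rewrite -EFinD lee_fin; have [sa|sa] := ltP a s.
    have -> : a < - s = false by apply/negbTE; rewrite -leNgt lerNl (le_trans _ (ltW sa))// ge0_cp// ltW.
    by rewrite expr0n addr0.
  by rewrite expr0n add0r; case: ifP => // _; rewrite expr0n sqr_ge0.
Qed.

Definition kAC (t s : R) : C := (kA a t s)%:C.

Lemma cmeas_kAC : cmeas (fun z : R * R => kAC z.1 z.2).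
Proof.
by apply: cmeasC; apply: (measurable_kA a (f := fst) (g := snd));
  [exact: measurable_fst|exact: measurable_snd].
Qed.

Lemma adm_kAC : adm a kAC pi^-1.
Proof.
split; [by rewrite invr_ge0 ltW// pi_gt0|exact: cmeas_kAC|].
by move=> t s ta; rewrite cabsC ger0_norm ?kA_ge0// kA_bound.
Qed.

Lemma sqn_kAC psi : L2 psi -> (sqn (Tk a kAC psi) <= (2^-1)%:E * posn psi)%E.
Proof.
move=> Lp; have [mp _] := (L2P psi).1 Lp; have p0 := pi_gt0 R.
have -> : 2^-1 = pi^-1 ^+ 2 * (c2 * c2) :> R.
  have -> : c2 * c2 = pi ^+ 2 / 2 :> R by rewrite -expr2 exprMn exprVn sqr_sqrtr.
  by rewrite mulrA -exprMn mulVf ?gt_eqF// expr1n mul1r.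
apply: (@Tk_sqn _ a kAC psi pi^-1 _ (pH a) (fun s => if a < s then cabs (psi s) else 0)) => //.
- by rewrite invr_ge0 ltW.
- exact: cmeas_kAC.
- by move=> t ta; exact: adm_cintegrable adm_kAC Lp ta.
- exact: measurable_pos.
- by move=> s; case: ifP => // _; exact: cabs_ge0.
- exact: pH_ge0.
- exact: measurable_pH.
- move=> t s ta sa; rewrite cabsM cabsC ger0_norm ?kA_ge0//.
  have [as'|as'] := ltP a s; last by rewrite /kA (le_gtF as') andbF mul0r !mulr0.
  rewrite mulrA; apply: ler_wpM2r; first exact: cabs_ge0.
  by rewrite /pH ta as' /=; exact: kA_bound.
- apply: schurH; first exact: measurable_pos.
  by move=> s; case: ifP => // _; exact: cabs_ge0.
Qed.

(** Each component enters twice, by its part on [s > a] and, reflected, by its part on [s < -a]. By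
    [posn_Sop] the two shares add up to at most its squared norm, so the second shift costs no
    factor. *)
Lemma VT_kAC F : vL2 F -> vnorm (VT kAC F) <= vnorm F / Num.sqrt 2.
Proof.
move=> LF; rewrite mulrC; apply: vnorm_le => //.
- by move=> j; have [] := VT_L20 adm_kAC LF j.
under eq_bigr => j _ do rewrite (sqn_VT _ cmeas_kAC LF).
apply: (@le_trans _ _ (\sum_(j < 4) ((2^-1)%:E * posn (F (prev4 j)) + (2^-1)%:E * posn (Sop (F (next4 j)))))%E).
  by apply: lee_sum => j _; apply: leeD; apply: sqn_kAC => //; exact: L2_Sop.
rewrite big_split /= -!ge0_sume_distrr//; try by move=> j _; exact: posn_ge0.
rewrite (sum_prev4 (fun j => posn (F j))) (sum_next4 (fun j => posn (Sop (F j)))).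
rewrite -ge0_muleDr; try by apply: sume_ge0 => j _; exact: posn_ge0.
rewrite exprVn sqr_sqrtr// lee_wpmul2l ?lee_fin ?invr_ge0// -big_split /=.
by apply: lee_sum => j _; apply: posn_Sop; have /L2P[] := LF j.
Qed.

Lemma VT_compact kr K K' : 0 < K -> (forall t s, a < t -> cabs (kr t s) <= K / (1 + rsq a t s)) ->
  (forall t s, a < t -> ccvg (nbhs t) (fun t' => kr t' s) (kr t s)) -> adm a kr K' ->
  compact_op a (VT kr).
Proof.
move=> K0 hb hc ad u Lu [M uM]; have [_ mk _] := ad.
have Lu2 n j : L2 (u n j) by have [] := Lu n j.
(* The flag [b] marks reflection, as [VT] applies the kernel to [F] and to [Sop F]. *)
pose fam n b j : R -> C := if b then Sop (u n j) else u n j.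
have Lf n b j : L2 (fam n b j) by rewrite /fam; case: b => //; exact: L2_Sop.
have Mf n b j : (sqn (fam n b j) <= (M ^+ 2)%:E)%E.
  have -> : sqn (fam n b j) = sqn (u n j).
    by rewrite /fam; case: b => //; rewrite sqn_Sop//; have /L2P[] := Lu2 n j.
  have M0 : 0 <= M by rewrite (le_trans (vnorm_ge0 (u n))).
  apply: (@le_trans _ _ (vnorm (u n) ^+ 2)%:E); last first.
    by rewrite lee_fin ler_pXn2r ?nnegrE ?vnorm_ge0.
  rewrite vnorm2E; last by move=> i; exact: Lu2.
  by rewrite (bigD1 j)//= leeDl// sume_ge0// => i _; exact: sqn_ge0.
pose Pr (c : bool) : C -> R := if c then @complex.Re R else @complex.Im R.
have hPr c (z w : C) : `|Pr c z - Pr c w| <= cabs (z - w).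
  by rewrite /Pr; case: c; rewrite -?creB -?cimB ?Re_le_cabs ?Im_le_cabs.
have M20 : 0 <= M ^+ 2 by exact: sqr_ge0.
pose B := K ^+ 2 * pi * M ^+ 2.
have B0 : 0 <= B by rewrite /B (mulr_ge0 (mulr_ge0 (sqr_ge0 K) (ltW (pi_gt0 R)))).
have Tb psi t : L2 psi -> (sqn psi <= (M ^+ 2)%:E)%E -> cabs (Tk a kr psi t) <= B + 1.
  move=> Lp pM; have h : cabs (Tk a kr psi t) ^+ 2 <= B.
    have [ta|ta] := ltP a t; last by rewrite Tk_ge// cabs0 expr0n.
    rewrite (le_trans (Tk_le K0 mk hb ta Lp pM))// -/B.
    by rewrite ler_piMr// W_le1.
  have : 0 <= (cabs (Tk a kr psi t) - 1) ^+ 2 by exact: sqr_ge0.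
  by move: (cabs _) (cabs_ge0 (Tk a kr psi t)) h => x x0 h; nra.
(* Rational point, component, reflection and choice of real or imaginary part form one countable
   index set, so a single extraction serves them all. *)
pose x n (i : rat * ('I_4 * (bool * bool))) : R :=
  Pr i.2.2.2 (Tk a kr (fam n i.2.2.1 i.2.1) (ratr i.1)).
have xB n i : `|x n i| <= B + 1.
  rewrite -[x n i]subr0 [X in `|_ - X|](_ : 0 = Pr i.2.2.2 0); last by rewrite /Pr; case: ifP.
  by rewrite (le_trans (hPr _ _ _))// subr0 Tb.
have [phi [l [phi_inc xl]]] := bounded_pointwise_subseq xB.
have cvgP b j c t : a < t ->
    exists l : R, Pr c (Tk a kr (fam (phi n) b j) t) @[n --> \oo] --> l.
  move=> ta; apply: (Tk_cvg K0 mk hb hc (hPr c) (fun n => Lf _ _ _) M20 (fun n => Mf _ _ _) ta).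
  by move=> q; exists (l (q, (j, (b, c)))); exact: (xl (q, (j, (b, c)))).
pose f b j t : C := if a < t then
   (limn (fun n => Re (Tk a kr (fam (phi n) b j) t))) +i*
   (limn (fun n => Im (Tk a kr (fam (phi n) b j) t))) else 0.
have f0 b j t : t <= a -> f b j t = 0 by move=> ta; rewrite /f ltNge ta.
have fc b j t : a < t -> ccvg \oo (fun n => Tk a kr (fam (phi n) b j) t) (f b j t).
  move=> ta; rewrite /f ta; split => /=.
    by apply/cvg_ex; exact: (cvgP b j true t ta).
  by apply/cvg_ex; exact: (cvgP b j false t ta).
have main b j : L2 (f b j) /\
    sqn (fun t => Tk a kr (fam (phi n) b j) t - f b j t) @[n --> \oo] --> 0%E.
  exact: (Tk_L2cvg K0 mk hb (fun n => Lf _ _ _) M20 (fun n => Mf _ _ _) (f0 b j) (fc b j)).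
pose G : vec R := fun j t => Sop (f false (prev4 j)) t + f true (next4 j) t.
exists phi, G; split => //.
  move=> j; split.
    apply: L2D; first by apply: L2_Sop; have [] := main false (prev4 j).
    by have [] := main true (next4 j).
  apply: nearW => t /andP[t1 t2]; rewrite /G /Sop !f0 ?addr0//; first exact: ltW.
  by rewrite lerNl ltW.
pose d b j n : R -> C := fun t => Tk a kr (fam (phi n) b j) t - f b j t.
have Ld b j n : L2 (d b j n).
  by apply: L2B; [exact: Tk_L2 ad (Lf _ _ _)|have [] := main b j].
have dc b j : l2norm (d b j n) ^+ 2 @[n --> \oo] --> (0 : R).
  have [_ /fine_cvgP[_]] := main b j; apply: cvg_trans; apply: near_eq_cvg.
  by apply: nearW => n /=; rewrite -/(d b j n) sqnE.
have E n j : vsub (VT kr (u (phi n))) G j =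
    (fun t => Sop (d false (prev4 j) n) t + d true (next4 j) n t).
  by apply/funext => t; rewrite /vsub /VT /G /Sop /d /fam opprD addrACA.
clearbody d.
have hle n j : l2norm (vsub (VT kr (u (phi n))) G j) ^+ 2 <=
    2 * l2norm (d false (prev4 j) n) ^+ 2 + 2 * l2norm (d true (next4 j) n) ^+ 2.
  rewrite E (le_trans (l2normD_le (L2_Sop (Ld _ _ _)) (Ld _ _ _)))//.
  by rewrite (l2norm_Sop (Ld _ _ _)).
have hc0 j : l2norm (vsub (VT kr (u (phi n))) G j) ^+ 2 @[n --> \oo] --> (0 : R).
  apply: (@squeeze_cvgr _ _ _ _ (fun=> 0) (fun n => 2 * l2norm (d false (prev4 j) n) ^+ 2 +
      2 * l2norm (d true (next4 j) n) ^+ 2)).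
  - by apply: nearW => n; rewrite sqr_ge0 hle.
  - exact: cvg_cst.
  - rewrite -[X in _ --> X](_ : 2 * 0 + 2 * 0 = 0 :> R); last by rewrite mulr0 addr0.
    by apply: cvgD; apply: cvgM => //; exact: cvg_cst.
have hsum : \sum_(j < 4) l2norm (vsub (VT kr (u (phi n))) G j) ^+ 2 @[n --> \oo] --> (0 : R).
  exact: (cvg_sum4 (h := fun j n => l2norm (vsub (VT kr (u (phi n))) G j) ^+ 2)).
have sq : Num.sqrt x @[x --> (0 : R)] --> (0 : R).
  by have := @sqrt_continuous R 0; rewrite /continuous_at sqrtr0.
exact: (cvg_comp _ _ hsum sq).
Qed.

End VectorOperators.

(** * Decomposition of the operator and conclusion *)

Section MainTheorem.
Variable R : realType.
Local Notation C := R[i].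
Local Notation mu := (@lebesgue_measure R).
Variables (a k th : R).
Hypotheses (a0 : 0 < a) (k0 : 0 < k) (th0 : 0 < th) (th1 : th < pi / 2).

Lemma Dintegrand_kD psi t : Dintegrand a k th psi t = (fun s => kerD a k th t s * psi s).
Proof. by apply/funext => s; rewrite /Dintegrand /kerD mulrAC. Qed.

Lemma DD_VT F : DD a k th F = VT a (kerD a k th) F.
Proof.
have h psi : Dop a k th psi = Tk a (kerD a k th) psi.
  by apply/funext => t; rewrite /Dop /Tk Dintegrand_kD.
by rewrite /DD /VT; apply/funext => j; apply/funext => t; rewrite !h.
Qed.

Lemma adm_kD : exists K, adm a (kerD a k th) K.
Proof.
have [K K0 h] := kD_le a0 k0 th0 th1; exists K; split => //.
  by apply: cmeas_kD; [exact: measurable_fst|exact: measurable_snd].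
by move=> t s ta; have [] := h t s ta.
Qed.

Lemma adm_kK : exists K, adm a (kK a k th) K.
Proof.
have [K K0 h] := kK_adm a0 k0 th0 th1; exists K; split => //.
by apply: cmeas_kK; [exact: measurable_fst|exact: measurable_snd].
Qed.

(** [kA + kK] differs from [kerD] only for [-a <= s <= a], where an element of [L20] vanishes up to
    a null set, to which the points [-a] and [a] are added. *)
Lemma Tk_split psi t : L20 a psi ->
  Tk a (kerD a k th) psi t = Tk a (kAC a) psi t + Tk a (kK a k th) psi t.
Proof.
move=> [Lp z]; have [mp _] := (L2P psi).1 Lp.
have [K1 ad1] := adm_kD; have [K2 ad2] := adm_kK.
have [_ m1 _] := ad1; have [_ m2 _] := ad2.
rewrite /Tk; case: ifP => ta; last by rewrite addr0.
have i1 := adm_cintegrable (adm_kAC a) Lp ta; have i2 := adm_cintegrable ad2 Lp ta.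
rewrite -cintD//; apply: cint_ae.
- by apply: cmeasM => //; exact: cmeas_section.
- by apply: cmeasD; apply: cmeasM => //; apply: cmeas_section => //; exact: cmeas_kAC.
apply: ae_imp (ae_and (ae_and (ae_neq a) (ae_neq (- a))) z) => s [[sa sa'] h].
have [s1|s1] := boolP ((s < - a) || (a < s)).
  by rewrite -mulrDl /kK s1 /kAC addrC subrK.
rewrite h ?mulr0 ?addr0//; move: s1; rewrite negb_or -!leNgt => /andP[s1 s2].
by rewrite !lt_neqAle s1 s2 sa eq_sym sa'.
Qed.

End MainTheorem.

Theorem theorem3p7 (R : realType) (a k th : R) :
  0 < a -> 0 < k -> 0 < th -> th < pi / 2 ->
  (* (i) D_theta is a well-defined continuous operator on (L^2)^4 with range in (L^2_0)^4 *)
  [/\ (forall psi : R -> R[i], L2 psi ->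
         {ae (@lebesgue_measure R), forall t, a < t -> cintegrable (Dintegrand a k th psi t)}),
      (forall F : vec R, vL2 F -> vL20 a (DD a k th F)),
      (forall F : vec R, vL2 F -> forall e : R, 0 < e ->
         exists2 d : R, 0 < d & forall G : vec R, vL2 G -> vnorm (vsub G F) < d ->
           vnorm (vsub (DD a k th G) (DD a k th F)) < e)
  & (* (ii) on (L^2_0)^4, D_theta = A + K with ||A|| <= 1/sqrt 2 and K compact *)
    exists A K : vec R -> vec R,
      [/\ opL20 a A, opL20 a K,
          (forall F, vL20 a F -> vnorm (A F) <= vnorm F / Num.sqrt 2),
          compact_op a K &
          (forall F, vL20 a F -> vae (DD a k th F) (vadd (A F) (K F)))]].
Proof.
move=> a0 k0 th0 th1.
have [K1 ad1] := adm_kD a0 k0 th0 th1; have [K2 ad2] := adm_kK a0 k0 th0 th1.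
have [K10 _ _] := ad1.
have [K3 K30 h3] := kK_bound a0 k0 th0 th1.
split.
- move=> psi Lp; apply: nearW => t ta; rewrite Dintegrand_kD.
  exact: adm_cintegrable ad1 Lp ta.
- by move=> F LF; rewrite DD_VT; exact: VT_L20 ad1 LF.
- move=> F LF e e0; pose B := 2 * K1 * (pi / Num.sqrt 2).
  have B0 : 0 <= B by rewrite /B mulr_ge0 ?(ltW (c2_gt0 R))// mulr_ge0.
  have B1 : 0 < B + 1 by rewrite ltr_wpDl.
  (* By linearity continuity follows from the bound [B]; the [+ 1] keeps the divisor positive. *)
  exists (e / (B + 1)); first exact: divr_gt0.
  move=> G LG hd; rewrite !DD_VT (VT_sub ad1)//.
  have LGF : vL2 (vsub G F) by move=> j; exact: L2B.
  apply: (le_lt_trans (VT_bound a0 ad1 LGF)); rewrite -/B.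
  apply: (@le_lt_trans _ _ ((B + 1) * vnorm (vsub G F))).
    by rewrite ler_wpM2r ?vnorm_ge0// lerDl.
  by rewrite mulrC -ltr_pdivlMr.
exists (VT a (kAC a)), (VT a (kK a k th)); split.
- exact: VT_op (adm_kAC a).
- exact: VT_op ad2.
- by move=> F /vL20_vL2; exact: VT_kAC.
(* [VT_compact] asks for a positive constant, while [kK_bound] provides a nonnegative one. *)
- have hK t s : a < t -> cabs (kK a k th t s) <= (K3 + 1) / (1 + rsq a t s).
    move=> ta; rewrite (le_trans (h3 t s ta))// ler_wpM2r ?lerDl//.
    by rewrite invr_ge0 addr_ge0// ltW// rsq_gt0.
  have K31 : 0 < K3 + 1 by rewrite ltr_wpDl.
  exact: VT_compact K31 hK (fun t s ta => kK_cvg a0 k0 th0 th1 s ta) ad2.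
- move=> F LF j; apply: nearW => t; rewrite DD_VT /VT /vadd /Sop.
  rewrite (Tk_split a0 k0 th0 th1 (- t) (LF _)).
  rewrite (Tk_split a0 k0 th0 th1 t (L20_Sop (LF (next4 j)))).
  by rewrite addrACA.
Qed.
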